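(* Fix real numbers $M>8$ and $\frac52<\alpha<M-\frac32$, and let $\overline\varepsilon>0$, $A>6$ be constants with property (WP) (defined in the context). Then there exists $0<\overline\varepsilon_3<\overline\varepsilon$ such that for every $0<\varepsilon_0<\overline\varepsilon_3$ the operators $U_\pm:B_{X_{M,\alpha}}(\varepsilon_0)\to U_\pm(B_{X_{M,\alpha}}(\varepsilon_0))$, $f_0\mapsto f_{\pm\infty}$, are injective.
   Context: $\langle y\rangle=\sqrt{1+|y|^2}$. $x,v\in\mathbb R^3$; $\|f\|_{L^p_xL^q_v}=\big\|\,\|f(x,\cdot)\|_{L^q_v}\big\|_{L^p_x}$ and $L^p_{xv}=L^p_xL^p_v$. $\langle v\rangle^{-M}L^\infty_{xv}$ is the space of $f$ with $\|\langle v\rangle^Mf\|_{L^\infty_{xv}}<\infty$, with this norm. Collision operator. Let $b=\mathbf 1_{(0,\infty)}$ and, for $v,v_1\in\mathbb R^3$, $\sigma\in\mathbb S^2$, $v^*=\frac{v+v_1}2+\frac{|v-v_1|}2\sigma$, $v_1^*=\frac{v+v_1}2-\frac{|v-v_1|}2\sigma$; $d\sigma$ is surface measure on $\mathbb S^2$. Define (pointwise in $x$) $$\mathcal G_1[f,g,h](v)=\tfrac14\int_{\mathbb R^3\times\mathbb S^2}|v-v_1|f(v_1)g(v^* )h(v_1^* )\,b((v-v_1)\cdot\sigma)\,d\sigma dv_1,$$ $$\mathcal G_2[f,g,h](v)=\tfrac14f(v)\int|v-v_1|g(v^* )h(v_1^* )\,b((v-v_1)\cdot\sigma)\,d\sigma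 dv_1,$$ $$\mathcal L_1[f,g,h](v)=\tfrac14f(v)\int|v-v_1|g(v_1)h(v_1^* )\,b((v-v_1)\cdot\sigma)\,d\sigma dv_1,$$ $$\mathcal L_2[f,g,h](v)=\tfrac14f(v)\int|v-v_1|g(v_1)h(v^* )\,b((v-v_1)\cdot\sigma)\,d\sigma dv_1,$$ and $\mathcal C[f]=\mathcal G_1[f,f,f]+\mathcal G_2[f,f,f]-\mathcal L_1[f,f,f]-\mathcal L_2[f,f,f]$. (KWE) is $\partial_tf+v\cdot\nabla_xf=\mathcal C[f]$, $f(t=0)=f_0$. Free transport: $(\mathcal S(t)f)(x,v)=f(x-vt,v)$. Data space: $X_{M,\alpha}$ is the set of $f\in\langle v\rangle^{-M}L^\infty_{xv}\cap L^1_{xv}$ with finite norm $$\|f\|_{X_{M,\alpha}}=\|\langle v\rangle^Mf\|_{L^\infty_{xv}}+\|f\|_{L^1_{xv}}+\sup_{t\in\mathbb R}\langle t\rangle^{3/2}\big(\|\langle v\rangle^\alpha\mathcal S(t)f\|_{L^\infty_xL^2_v}+\|\langle v\rangle\mathcal S(t)f\|_{L^2_xL^1_v}\big),$$ and $B_{X_{M,\alpha}}(\varepsilon_0)=\{f\in X_{M,\alpha}:\|f\|_{X_{M,\alpha}}\le\varepsilon_0\}$. Solution: for an interval $I\ni0$ and $f_0\in X_{M,\alpha}$, $f\in\mathcal C(I,\langle v\rangle^{-M}L^\infty_{xv})$ is a solution of (KWE) in $I$ with initial data $f_0$ if $f(t)=\mathcal S(t)f_0+\int_0^t\mathcal S(t-s)\mathcal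 C[f](s)\,ds$ for all $t\in I$; it is global if $I=\mathbb R$. Property (WP) of constants $\overline\varepsilon>0$, $A>6$ (such constants exist): for every $0<\varepsilon_0<\overline\varepsilon$ and $f_0\in B_{X_{M,\alpha}}(\varepsilon_0)$, (KWE) has a unique global solution $f\in\mathcal C(\mathbb R,\langle v\rangle^{-M}L^\infty_{xv})$ with $$\sup_{t\in\mathbb R}\Big\{\langle t\rangle^{3/2}\|\langle v\rangle f(t)\|_{L^2_xL^1_v}+\langle t\rangle^{3/2}\|\langle v\rangle^\alpha f(t)\|_{L^\infty_xL^2_v}+\|f(t)\|_{L^1_{xv}}+\|\langle v\rangle^Mf(t)\|_{L^\infty_{xv}}\Big\}<A\varepsilon_0,$$ and if $f,g$ are the solutions with data $f_0,g_0\in B_{X_{M,\alpha}}(\varepsilon_0)$ then $\sup_{t\in\mathbb R}\|f(t)-g(t)\|_{L^1_{xv}}\le2\|f_0-g_0\|_{L^1_{xv}}$. Scattering maps: for $f_0\in B_{X_{M,\alpha}}(\varepsilon_0)$, $U_\pm f_0=f_{\pm\infty}$ denote the unique elements of $L^1_{xv}\cap\langle v\rangle^{-M}L^\infty_{xv}$ (they exist) such that the global solution $f$ with data $f_0$ satisfies $\|\langle v\rangle^M(f(t)-\mathcal S(t)f_{\pm\infty})\|_{L^\infty_{xv}}+\|f(t)-\mathcal S(t)f_{\pm\infty}\|_{L^1_{xv}}\to0$ as $t\to\pm\infty$; explicitly $f_{+\infty}=f_0+\int_0^\infty\mathcal S(-s)\mathcal C[f](s)\,ds$ and $f_{-\infty}=f_0-\int_{-\infty}^0\mathcal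 S(-s)\mathcal C[f](s)\,ds$. *)

(* Defs.v *)
From HB Require Import structures.
From mathcomp Require Import all_boot all_order all_algebra.
From mathcomp Require Import all_classical all_reals all_analysis.
From mathcomp Require Import measurable_realfun ring lra.

Set Implicit Arguments.
Unset Strict Implicit.
Unset Printing Implicit Defensive.

Import Order.TTheory GRing.Theory Num.Theory.
Import numFieldNormedType.Exports.

Local Open Scope classical_set_scope.
Local Open Scope ring_scope.

(* measurableTypeR R is R with its Borel sigma-algebra, in the form in which
   lebesgue_measure is defined. *)
Notation vec3 R :=
  (measurableTypeR R * measurableTypeR R * measurableTypeR R)%type.
Notation phase R := (vec3 R * vec3 R)%type.

(* In this version of the library, the canonical sigma-finite structure on
   product measures is the one of products of subprobabilities. *)
Lemma sigma_finite_product d1 d2 (T1 : measurableType d1)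
    (T2 : measurableType d2) (R : realType)
    (m1 : {sigma_finite_measure set T1 -> \bar R})
    (m2 : {sigma_finite_measure set T2 -> \bar R}) :
  sigma_finite setT (m1 \x m2)%E.
Proof.
have /sigma_finiteP[F [TF ndF Foo]] := sigma_finiteT m1.
have /sigma_finiteP[G [TG ndG Goo]] := sigma_finiteT m2.
exists (fun n => F n `*` G n).
  rewrite -setXTT TF TG predeqE => -[x y]; split.
    move=> [/= [n _ Fnx] [k _ Gky]]; exists (maxn n k) => //; split.
    - by move: x Fnx; exact/subsetPset/ndF/leq_maxl.
    - by move: y Gky; exact/subsetPset/ndG/leq_maxr.
  by move=> [n _ []/= ? ?]; split; exists n.
move=> k; have [? ?] := Foo k; have [? ?] := Goo k.
split; first exact: measurableX.
by rewrite product_measure1E// lte_mul_pinfty// ge0_fin_numE.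
Qed.

Section Euclidean.
Context {R : realType}.
Implicit Types (u v : vec3 R) (t : R).

(* The library's norm on a product is the maximum norm, hence norm3. *)
Definition dot3 u v : R := u.1.1 * v.1.1 + u.1.2 * v.1.2 + u.2 * v.2.
Definition norm3 v : R := Num.sqrt (dot3 v v).

Definition japr t : R := Num.sqrt (1 + t ^+ 2).
Definition japv v : R := Num.sqrt (1 + norm3 v ^+ 2).

Definition leb2 : set (measurableTypeR R * measurableTypeR R) -> \bar R :=
  (lebesgue_measure \x lebesgue_measure)%E.
HB.instance Definition _ := Measure.on leb2.
HB.instance Definition _ := Measure_isSigmaFinite.Build _ _ _ leb2
  (sigma_finite_product lebesgue_measure lebesgue_measure).

Definition leb3 : set (vec3 R) -> \bar R := (leb2 \x lebesgue_measure)%E.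
HB.instance Definition _ := Measure.on leb3.
HB.instance Definition _ := Measure_isSigmaFinite.Build _ _ _ leb3
  (sigma_finite_product leb2 lebesgue_measure).

Definition leb6 : set (phase R) -> \bar R := (leb3 \x leb3)%E.
HB.instance Definition _ := Measure.on leb6.
HB.instance Definition _ := Measure_isSigmaFinite.Build _ _ _ leb6
  (sigma_finite_product leb3 leb3).

(* Surface measure on the unit sphere, as a measure on R^3 carried by the
   sphere: the measure of A is 3 times the Lebesgue measure of the cone
   { r s | 0 < r <= 1, s in A, |s| = 1 }, i.e. the normalisation for which
   dy = r^2 dr dsigma (Folland, Real Analysis, Theorem 2.49). *)
Definition punctured_ball : set (vec3 R) := [set y | 0 < norm3 y <= 1].
Definition direction (y : vec3 R) : vec3 R := (norm3 y)^-1 *: y.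

Definition sphere_measure (A : set (vec3 R)) : \bar R :=
  (3%:E * leb3 (direction @^-1` A `&` punctured_ball))%E.

Let c1 v : R := v.1.1.
Let c2 v : R := v.1.2.
Let c3 v : R := v.2.

Let mc1 : measurable_fun setT c1.
Proof.
exact: (measurableT_comp (@measurable_fst _ _ _ _) (@measurable_fst _ _ _ _)).
Qed.
Let mc2 : measurable_fun setT c2.
Proof.
exact: (measurableT_comp (@measurable_snd _ _ _ _) (@measurable_fst _ _ _ _)).
Qed.
Let mc3 : measurable_fun setT c3.
Proof. exact: (@measurable_snd _ _ _ _). Qed.

Lemma dot3_ge0 v : 0 <= dot3 v v.
Proof. by rewrite !addr_ge0 // -expr2 sqr_ge0. Qed.

Lemma measurable_norm3 : measurable_fun setT norm3.
Proof.
have md : measurable_fun setT (fun v : vec3 R => dot3 v v).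
  apply: measurable_funD; first apply: measurable_funD.
  - exact: (measurable_funM mc1 mc1).
  - exact: (measurable_funM mc2 mc2).
  - exact: (measurable_funM mc3 mc3).
rewrite (_ : norm3 = (@powR R ^~ 2^-1) \o (fun v => dot3 v v)).
  by apply: measurableT_comp md; exact: measurable_powR.
by apply/funext => v; rewrite /= powR12_sqrt // dot3_ge0.
Qed.

Lemma measurable_punctured_ball : measurable punctured_ball.
Proof.
rewrite (_ : punctured_ball = norm3 @^-1` `]0, 1]%classic); last first.
  by apply/seteqP; split=> y /=; rewrite in_itv.
by rewrite -[_ @^-1` _]setTI; exact: measurable_norm3.
Qed.

Lemma measurable_direction : measurable_fun setT direction.
Proof.
have mi : measurable_fun setT (fun y => (norm3 y)^-1).
  rewrite (_ : (fun _ => _) = (@powR R ^~ (-1)) \o norm3).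
    by apply: measurableT_comp measurable_norm3; exact: measurable_powR.
  by apply/funext => v; rewrite /= powR_inv1 // sqrtr_ge0.
apply: measurable_fun_pair; first apply: measurable_fun_pair.
- exact: (measurable_funM mi mc1).
- exact: (measurable_funM mi mc2).
- exact: (measurable_funM mi mc3).
Qed.

Let sphere0 : sphere_measure set0 = 0%E.
Proof. by rewrite /sphere_measure preimage_set0 set0I measure0 mule0. Qed.

Let sphere_ge0 A : (0 <= sphere_measure A)%E.
Proof. by rewrite /sphere_measure mule_ge0. Qed.

Let sphere_sigma_additive : semi_sigma_additive sphere_measure.
Proof.
move=> F mF tF mUF.
have mD i : measurable (direction @^-1` F i `&` punctured_ball).
  apply: measurableI measurable_punctured_ball.
  by rewrite -[_ @^-1` _]setTI; exact: measurable_direction.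
rewrite [X in X @ \oo --> _](_ : _ = (fun n => 3%:E *
    \sum_(0 <= i < n) leb3 (direction @^-1` F i `&` punctured_ball))%E).
  apply: cvgeZl => //; rewrite preimage_bigcup setI_bigcupl.
  apply: measure_semi_sigma_additive => //.
    apply/trivIsetP => i j _ _ ij; rewrite setIACA -preimage_setI.
    by move/trivIsetP : tF => -> //; rewrite preimage_set0 set0I.
  exact: bigcup_measurable.
by apply/funext => n; rewrite ge0_sume_distrr.
Qed.

HB.instance Definition _ := isMeasure.Build _ _ _ sphere_measure
  sphere0 sphere_ge0 sphere_sigma_additive.

Let sphere_fin : fin_num_fun sphere_measure.
Proof.
apply: lty_fin_num_fun; rewrite /= /sphere_measure.
rewrite (_ : _ `&` _ = punctured_ball); last by rewrite -[RHS]setTI.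
rewrite lte_mul_pinfty //.
pose I : set (measurableTypeR R) := `[-1, 1]%classic.
have mI : measurable I by exact: measurable_itv.
have I2 : lebesgue_measure I = 2%:E.
  by rewrite lebesgue_measure_itv /= lte_fin gtrN // -EFinD opprK.
have I8 : leb3 (I `*` I `*` I) = (2%:E * 2%:E * 2%:E)%E.
  transitivity (leb2 (I `*` I) * lebesgue_measure I)%E.
    by apply: product_measure1E => //; exact: measurableX.
  congr (_ * _)%E; last exact: I2.
  transitivity (lebesgue_measure I * lebesgue_measure I)%E.
    exact: product_measure1E.
  by congr (_ * _)%E; exact: I2.
apply: (@le_lt_trans _ _ (leb3 (I `*` I `*` I))); last first.
  by rewrite I8 -!EFinM ltry.
apply: le_measure; rewrite ?inE; [exact: measurable_punctured_ball| |].
  by do 2 (apply: measurableX => //).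
have sq (x : R) : x ^+ 2 <= 1 -> I x.
  by move=> x1; rewrite /I /= in_itv /= -ler_norml -(@ler_pXn2r _ 2) ?nnegrE //
    real_normK ?num_real // expr1n.
move=> y /= /andP[_]; rewrite -[1]sqrtr1 ler_sqrt // /dot3 -!expr2 => y1.
have h1 : 0 <= c1 y ^+ 2 by exact: sqr_ge0.
have h2 : 0 <= c2 y ^+ 2 by exact: sqr_ge0.
have h3 : 0 <= c3 y ^+ 2 by exact: sqr_ge0.
have {}y1 : c1 y ^+ 2 + c2 y ^+ 2 + c3 y ^+ 2 <= 1 by exact: y1.
split; [split|]; [apply: (sq (c1 y))|apply: (sq (c2 y))|apply: (sq (c3 y))].
all: lra.
Qed.

HB.instance Definition _ :=
  @Measure_isFinite.Build _ _ _ sphere_measure sphere_fin.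

End Euclidean.

Section KineticEquation.
Context {R : realType}.
Implicit Types (f g F : phase R -> R) (M alpha A eps epsbar t : R)
  (u w : R -> phase R -> R).

(* (x, v) |-> (x - t v, v) *)
Definition transport t f : phase R -> R :=
  fun z => f (z.1 - t *: z.2 : vec3 R, z.2).

Definition Lxv (p q : \bar R) f : \bar R :=
  Lnorm leb3 p (fun x => Lnorm leb3 q (fun v => (f (x, v))%:E)).

Definition L1norm f : \bar R := Lxv 1%E 1%E f.
Definition wLinf_norm M f : \bar R :=
  Lxv +oo%E +oo%E (fun z => japv z.2 `^ M * f z).

Definition wLinf M : set (phase R -> R) :=
  [set f | measurable_fun setT f /\ (wLinf_norm M f < +oo)%E].
Definition L1 : set (phase R -> R) :=
  [set f | measurable_fun setT f /\ (L1norm f < +oo)%E].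

Definition bcut : R -> R := \1_[set r : R | 0 < r].

Definition vpost (v v1 s : vec3 R) : vec3 R :=
  2^-1 *: (v + v1) + (norm3 (v - v1 : vec3 R) / 2) *: s.
Definition vpost1 (v v1 s : vec3 R) : vec3 R :=
  2^-1 *: (v + v1) - (norm3 (v - v1 : vec3 R) / 2) *: s.

Definition coll_int (v : vec3 R) (K : vec3 R -> vec3 R -> R) : R :=
  4^-1 * \int[(leb3 \x sphere_measure)%E]_p
    (norm3 (v - p.1 : vec3 R) * K p.1 p.2 * bcut (dot3 (v - p.1) p.2)).

Implicit Types a b c : vec3 R -> R.

Definition collG1 a b c v : R :=
  coll_int v (fun v1 s => a v1 * b (vpost v v1 s) * c (vpost1 v v1 s)).
Definition collG2 a b c v : R :=
  a v * coll_int v (fun v1 s => b (vpost v v1 s) * c (vpost1 v v1 s)).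
Definition collL1 a b c v : R :=
  a v * coll_int v (fun v1 s => b v1 * c (vpost1 v v1 s)).
Definition collL2 a b c v : R :=
  a v * coll_int v (fun v1 s => b v1 * c (vpost v v1 s)).

Definition coll f : phase R -> R := fun z =>
  let a := fun v => f (z.1, v) in
  collG1 a a a z.2 + collG2 a a a z.2 - collL1 a a a z.2 - collL2 a a a z.2.

Definition oint0 t (k : R -> R) : R :=
  if 0 <= t then \int[lebesgue_measure]_(s in `[0, t]) k s
  else - \int[lebesgue_measure]_(s in `[t, 0]) k s.

Definition Xnorm M alpha f : \bar R :=
  (wLinf_norm M f + L1norm f +
   ereal_sup [set (japr t `^ (3 / 2))%:E *
     (Lxv +oo 2%:E (fun z => (japv z.2 `^ alpha * transport t f z)%R) +
      Lxv 2%:E 1 (fun z => (japv z.2 * transport t f z)%R)) | t in setT])%E.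

Definition Xball M alpha eps : set (phase R -> R) :=
  [set f | [/\ wLinf M f, L1 f & (Xnorm M alpha f <= eps%:E)%E]].

(* Elements of Lebesgue spaces are represented by measurable functions, and
   equality is almost everywhere.  A continuous curve in the weighted L^infty
   space has a representative that is jointly measurable in (t, x, v); the
   time integral in Duhamel's formula is taken pointwise along such a
   representative, and is almost everywhere independent of its choice. *)
Definition global_solution M f0 u : Prop :=
  [/\ measurable_fun [set: measurableTypeR R * phase R]
        (fun z => u z.1 z.2),
      forall t, wLinf M (u t),
      forall t0, wLinf_norm M (u t \- u t0) @[t --> t0] --> 0%E &
      forall t, {ae leb6, forall z, u t z = transport t f0 z +
        oint0 t (fun s => transport (t - s) (coll (u s)) z)}].

Definition sol_norm M alpha u : \bar R :=
  ereal_sup [set ((japr t `^ (3 / 2))%:E * Lxv 2%:E 1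
                    (fun z => (japv z.2 * u t z)%R) +
                  (japr t `^ (3 / 2))%:E * Lxv +oo 2%:E
                    (fun z => (japv z.2 `^ alpha * u t z)%R) +
                  L1norm (u t) + wLinf_norm M (u t))%E | t in setT].

(* The solution with data f0 in the ball of radius eps provided by
   [well_posed] below: it is unique among those satisfying the bound. *)
Definition small_solution M alpha A eps f0 u : Prop :=
  global_solution M f0 u /\ (sol_norm M alpha u < (A * eps)%:E)%E.

Definition well_posed M alpha epsbar A : Prop :=
  forall eps, 0 < eps < epsbar ->
    (forall f0, Xball M alpha eps f0 ->
       exists2 u, small_solution M alpha A eps f0 u &
         forall w, small_solution M alpha A eps f0 w ->
           forall t, u t = w t %[ae leb6]) /\
    (forall f0 g0 u w, Xball M alpha eps f0 -> Xball M alpha eps g0 ->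
       small_solution M alpha A eps f0 u ->
       small_solution M alpha A eps g0 w ->
       (ereal_sup [set L1norm (u t \- w t)%R | t in setT] <=
        2%:E * L1norm (f0 \- g0)%R)%E).

Definition scatters_to M (T : set_system R) u F : Prop :=
  [/\ L1 F, wLinf M F &
      (wLinf_norm M (u t \- transport t F)%R +
       L1norm (u t \- transport t F)%R)%E
        @[t --> T] --> 0%E].

(* Graphs of the scattering maps U_+ and U_- on the ball of radius eps. *)
Definition Uplus M alpha A eps f0 F : Prop :=
  Xball M alpha eps f0 /\
  exists2 u, small_solution M alpha A eps f0 u & scatters_to M +oo u F.
Definition Uminus M alpha A eps f0 F : Prop :=
  Xball M alpha eps f0 /\
  exists2 u, small_solution M alpha A eps f0 u & scatters_to M -oo u F.

Definition ae_injective (U : (phase R -> R) -> (phase R -> R) -> Prop) : Prop :=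
  forall f0 g0 F G, U f0 F -> U g0 G ->
    F = G %[ae leb6] -> f0 = g0 %[ae leb6].

End KineticEquation.

(* Main.v *)
Require Import Defs.
From mathcomp Require Import all_boot all_order all_algebra.
From mathcomp Require Import all_classical all_reals all_analysis.
From mathcomp Require Import measurable_realfun ess_sup_inf hoelder ring lra.

(* Let u, w be the solutions with data f0, g0, and N = |f0 - g0|_{L^1}.  Free
   transport preserves L^1, so Duhamel's formula at time T bounds N by
   |u(T) - w(T)|_{L^1} plus the integral over all times of
   |C[u(s)] - C[w(s)]|_{L^1}.  For almost every x, the trilinear operator C is
   Lipschitz on L^1_v with a constant proportional to the product of
   |<v>^M f|_{L^oo_v} and |f|_{L^1_v}, and the latter is at most a multiple of
   |<v>^alpha f|_{L^2_v} = O(A eps <s>^(-3/2)).  As <s>^(-3/2) is integrable and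
   |u(s) - w(s)|_{L^1} <= 2 N by well-posedness, this gives
     N <= |u(T) - w(T)|_{L^1} + B (A eps)^2 N   for every T.
   If the two solutions have the same scattering state, the first term vanishes
   as T goes to infinity, hence N = 0 when eps is small.

   For the estimate on C, every term is put in weak form; exchanging the
   pairs v, v_1 and v^*, v_1^* turns gain terms into loss terms.  The unbounded
   factor |v - v_1| is absorbed by the average of <.>^(-5) over sigma: when sigma
   varies, v_1^* runs over a sphere of diameter |v - v_1|. *)

Set Implicit Arguments.
Unset Strict Implicit.
Unset Printing Implicit Defensive.

Import Order.TTheory GRing.Theory Num.Theory.
Import numFieldNormedType.Exports.

Local Open Scope classical_set_scope.
Local Open Scope ring_scope.

(** * Change of variables for expanding maps *)

(** The estimate on C has one factor with pointwise decay, one factor in L^1 and the difference, in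
    any order, against the unbounded |v - v_1|. If the decaying factor sits at v_1^*, averaging over
    sigma at fixed v, v_1 gains 1/|v - v_1|. If it sits at v_1, the variable v_1 is traded for q = v
    - v_1^* at fixed sigma; then v_1, as a function of sigma at fixed q, expands distances on the
    sphere by at least |q|, and the same average applies.

    No Jacobian is computed. A map of the line that expands distances by c pulls measure back by at
    most 1/c; applied one coordinate at a time, this gives every inequality between integrals under
    substitution. The exchange of v, v_1 with the post-collisional pair must be an identity: in
    polar coordinates v - v_1 = r w it exchanges w and sigma, up to a translation of v.

    The real integrals in C and in Duhamel's formula are 0 by convention where they diverge, so two
    of them may be subtracted only where both converge. Estimates are therefore made on nonnegative
    extended-valued integrals, whose finiteness yields convergence almost everywhere. *)

Section Integral.
Context d (T : measurableType d) (R : realType) (mu : {measure set T -> \bar R}).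
Implicit Types f g : T -> \bar R.

(** The integral of a nonnegative function is a supremum over the simple functions below it, and
    those below [f] are below [g]; measurability plays no part in this. *)
Lemma ge0_le_integralT f g : (forall x, 0 <= f x)%E ->
  (forall x, f x <= g x)%E -> (\int[mu]_x f x <= \int[mu]_x g x)%E.
Proof.
move=> f0 fg; have g0 x : (0 <= g x)%E by exact: le_trans (fg x).
rewrite !ge0_integralTE//; apply: ereal_sup_le => _ [h hf <-].
exists h => //= x; exact: le_trans (hf x) (fg x).
Qed.

(** [mu] is the sum of its restrictions to [D] and to the complement of [D]; the latter does not
    charge [D], so the former carries the whole integral over [D]. *)
Lemma ge0_le_integral_mrestr (D : set T) (mD : measurable D) f :
  measurable_fun setT f -> (forall x, 0 <= f x)%E ->
  (\int[mu]_(x in D) f x <= \int[mrestr mu mD]_x f x)%E.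
Proof.
move=> mf f0; have mDc : measurable (~` D) by exact: measurableC.
pose m2 := measure_add (mrestr mu mD) (mrestr mu mDc).
apply: (@le_trans _ _ (\int[m2]_(x in D) f x)%E).
  apply: ge0_le_measure_integral => // S mS.
  rewrite [leRHS](_ : _ = mrestr mu mD S + mrestr mu mDc S)%E; last first.
    exact: measure_addE.
  rewrite /mrestr -measureU//.
  - by rewrite -setIUr setUv setIT.
  - exact: measurableI.
  - exact: measurableI.
  - by rewrite setIACA setICr setI0.
rewrite ge0_integral_measure_add//; last exact: measurable_funTS.
rewrite [X in (_ + X)%E]null_set_integral ?adde0//.
- by apply: ge0_subset_integral.
- exact: measurable_funTS.
- exact: etrans (congr1 mu (setICr D)) (measure0 mu).
Qed.

Lemma ge0_integral_image d' (T' : measurableType d')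
    (nu : {measure set T' -> \bar R}) (h : T -> T') (f : T' -> \bar R) :
  measurable_fun setT h ->
  (forall S, measurable S -> nu S = mu (h @^-1` S)) ->
  measurable_fun setT f -> (forall x, 0 <= f x)%E ->
  (\int[nu]_y f y = \int[mu]_x f (h x))%E.
Proof.
move=> mh nuE mf f0.
rewrite -[RHS](@ge0_integral_pushforward _ _ _ _ _ h mh mu setT f)//.
apply/eqP; rewrite eq_le; apply/andP; split.
- by apply: ge0_le_measure_integral => // S mS; rewrite nuE.
- by apply: ge0_le_measure_integral => // S mS; rewrite nuE.
Qed.

End Integral.

(** The relation between [nu] and [mu] is the one that defines [sphere_measure], with [h] the
    direction, [D] the punctured ball and c = 3. *)
Lemma ge0_integral_scaled_image d d' (T : measurableType d)
    (T' : measurableType d') (R : realType) (mu : {measure set T -> \bar R})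
    (nu : {measure set T' -> \bar R}) (h : T -> T') (D : set T) (c : R)
    (f : T' -> \bar R) :
  0 <= c -> measurable D -> measurable_fun setT h ->
  (forall S, measurable S -> nu S = c%:E * mu (h @^-1` S `&` D))%E ->
  measurable_fun setT f -> (forall x, 0 <= f x)%E ->
  (\int[nu]_y f y = c%:E * \int[mu]_(x in D) f (h x))%E.
Proof.
move=> c0 mD mh nuE mf f0; pose m0 := mrestr mu mD.
have mfh : measurable_fun setT (fun x => f (h x)) by exact: measurableT_comp.
rewrite (@ge0_integral_image _ _ _ (mscale (NngNum c0) m0) _ _ nu h f mh)//.
rewrite ge0_integral_mscale//; congr (_ * _)%E.
apply/eqP; rewrite eq_le; apply/andP; split; last exact: ge0_le_integral_mrestr.
rewrite (@ge0_negligible_integral _ _ _ _ _ (~` D))//; last 2 first.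
- exact: measurableC.
- exact: etrans (congr1 mu (setICl _)) (measure0 _).
rewrite setDE setCK setTI; apply: ge0_le_measure_integral => // S mS.
by apply: le_measure; rewrite ?inE//; apply: measurableI.
Qed.

Section Expanding.
Context (R : realType).
Notation mR := (measurableTypeR R).

(** [S] lies in the interval of length [l] that starts at its infimum. *)
Lemma lebesgue_measure_diam (S : set mR) (l : R) : measurable S -> 0 <= l ->
  (forall s t, S s -> S t -> `|s - t| <= l) -> (lebesgue_measure S <= l%:E)%E.
Proof.
move=> mS l0 Sl; have [->|/set0P[s0 Ss0]] := eqVneq S set0.
  by rewrite measure0 lee_fin.
have lbS : has_lbound S.
  exists (s0 - l) => s Ss; have := Sl _ _ Ss0 Ss.
  by rewrite ler_norml => /andP[_]; rewrite lerBlDr lerBlDl addrC.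
apply: (@le_trans _ _ (lebesgue_measure (`[inf S, inf S + l]%classic : set R))).
  apply: le_measure; rewrite ?inE//.
  move=> s Ss /=; rewrite in_itv/=; apply/andP; split; first exact: ge_inf.
  rewrite -lerBlDr; apply: lb_le_inf; first by exists s0.
  move=> t St; have := Sl _ _ Ss St.
  by rewrite ler_norml => /andP[_]; rewrite lerBlDr lerBlDl addrC.
rewrite lebesgue_measure_itv/=; case: ifP => _; last by rewrite lee_fin.
by rewrite lee_fin addrAC subrr add0r.
Qed.

(** An interval of length l pulls back, within [D], to a set of diameter at most l/c, hence of
    measure at most l/c. Summing over a cover of [S] by open intervals of total length within [e] of
    its measure gives the bound. *)
Lemma lebesgue_measure_expanding (D : set mR) (psi : mR -> mR) (c : R)
    (S : set mR) :
  measurable D -> measurable_fun setT psi -> 0 < c ->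
  (forall s t, D s -> D t -> c * `|s - t| <= `|psi s - psi t|) ->
  measurable S ->
  (lebesgue_measure (psi @^-1` S `&` D) <= c^-1%:E * lebesgue_measure S)%E.
Proof.
move=> mD mpsi c0 Dpsi mS.
rewrite lee_pdivlMl//.
apply/lee_addgt0Pr => e e0.
have [->|Soo] := eqVneq (lebesgue_measure S) +oo%E.
  by rewrite addye ?leey//.
have Sfin : lebesgue_measure S \is a fin_num.
  by rewrite ge0_fin_numE ?measure_ge0// ltey.
have [F FS Fe] : exists2 F, open_itv_cover (S : set R) F &
    (\sum_(0 <= k <oo) wlength idfun (F k) <= lebesgue_measure S + e%:E)%E.
  have := outer_measure_open_itv_cover (S : set R).
  rewrite [LHS](_ : _ = lebesgue_measure S)// => SE.
  have := Sfin; rewrite SE => /lb_ereal_inf_adherent-/(_ _ e0)[_/= [F AF <-] Fe].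
  by exists F => //; exact/ltW.
apply: le_trans Fe.
have mpre B : measurable B -> measurable (psi @^-1` B).
  by move=> mB; rewrite -[_ @^-1` _]setTI; exact: mpsi.
have mF k : measurable (F k : set mR).
  by have [/(_ k)[ab -> _]] := FS; exact: measurable_itv.
rewrite -lee_pdivlMl//.
apply: (@le_trans _ _ (\sum_(0 <= k <oo) lebesgue_measure (psi @^-1` F k `&` D))%E).
  apply: measure_sigma_subadditive.
  - by move=> k; apply: measurableI => //; exact: mpre.
  - by apply: measurableI => //; exact: mpre.
  - rewrite -setI_bigcupl -preimage_bigcup; apply: setSI => s /= Ss.
    by have [_] := FS; apply.
rewrite -nneseriesZl//.
apply: lee_nneseries => [k _ _|k _]; first exact: measure_ge0.
have [/(_ k)[[a b] Fk _]] := FS.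
have [ab|ba] := ltP a b; last first.
  rewrite Fk/= set_itv_ge -?leNgt ?bnd_simp//= ?preimage_set0 ?set0I ?measure0.
  by rewrite mule0.
rewrite [X in wlength _ X]Fk (_ : wlength _ _ = (b - a)%:E); last first.
  by rewrite wlength_itv/= lte_fin ab.
rewrite -EFinM.
apply: lebesgue_measure_diam.
- by apply: measurableI => //; exact: mpre.
- by rewrite mulr_ge0 ?invr_ge0 ?subr_ge0// ltW.
- move=> s t [/= Fs Ds] [Ft Dt].
  rewrite mulrC ler_pdivlMr// mulrC (le_trans (Dpsi _ _ Ds Dt))//.
  move: Fs Ft; rewrite Fk/= !in_itv/= => /andP[? ?] /andP[? ?].
  by rewrite ler_norml; apply/andP; split; lra.
Qed.

(** The measure bound says that the image under [psi] of Lebesgue measure on [D] is at most 1/c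
    times Lebesgue measure; [f] is integrated against both. *)
Lemma ge0_integral_expanding (D : set mR) (psi : mR -> mR) (c : R)
    (f : mR -> \bar R) :
  measurable D -> measurable_fun setT psi -> 0 < c ->
  (forall s t, D s -> D t -> c * `|s - t| <= `|psi s - psi t|) ->
  measurable_fun setT f -> (forall x, 0 <= f x)%E ->
  (\int[lebesgue_measure]_(s in D) f (psi s) <=
   c^-1%:E * \int[lebesgue_measure]_s f s)%E.
Proof.
move=> mD mpsi c0 Dpsi mf f0.
have ci0 : 0 <= c^-1 by rewrite invr_ge0 ltW.
pose m1 := mrestr lebesgue_measure mD.
have c1 : 0 <= c^-1 by rewrite invr_ge0 ltW.
pose m2 := mscale (NngNum c1) (@lebesgue_measure R).
apply: (@le_trans _ _ (\int[m1]_s f (psi s))%E).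
  by apply: ge0_le_integral_mrestr => //; exact: measurableT_comp.
rewrite -[leLHS](@ge0_integral_pushforward _ _ _ _ _ psi mpsi m1 setT f)//.
rewrite -[leRHS](@ge0_integral_mscale _ _ _ lebesgue_measure setT _ (NngNum c1))//.
apply: ge0_le_measure_integral => // S mS.
exact: lebesgue_measure_expanding.
Qed.

End Expanding.

(** * Measurability *)

Section Measurability.
Context d (T : measurableType d) (R : realType).
Implicit Types (f g : T -> R) (u w : T -> vec3 R) (F G : T -> \bar R).

Lemma mfunD f g : measurable_fun setT f -> measurable_fun setT g ->
  measurable_fun setT (fun x => f x + g x).
Proof. exact: measurable_funD. Qed.

Lemma mfunB f g : measurable_fun setT f -> measurable_fun setT g ->
  measurable_fun setT (fun x => f x - g x).
Proof. exact: measurable_funB. Qed.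

Lemma mfunN f : measurable_fun setT f -> measurable_fun setT (fun x => - f x).
Proof. by move=> mf; exact: measurableT_comp mf. Qed.

Lemma mfunM f g : measurable_fun setT f -> measurable_fun setT g ->
  measurable_fun setT (fun x => f x * g x).
Proof. exact: measurable_funM. Qed.

Lemma mfunX f n : measurable_fun setT f -> measurable_fun setT (fun x => f x ^+ n).
Proof. exact: measurable_funX. Qed.

Lemma mfun_norm f : measurable_fun setT f -> measurable_fun setT (fun x => `|f x|).
Proof. by move=> mf; exact: measurableT_comp mf. Qed.

(** Inversion is continuous on the open complement of 0, and a singleton raises no question of
    measurability. *)
Lemma mfunV f : measurable_fun setT f -> measurable_fun setT (fun x => (f x)^-1).
Proof.
move=> mf; rewrite (_ : (fun _ => _) = GRing.inv \o f)//.
apply: measurableT_comp mf.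
rewrite (_ : setT = [set 0%R : R] `|` [set~ 0%R]); last by rewrite setUv.
apply/measurable_funU => //; first exact: measurableC.
split; first exact: measurable_fun_set1.
apply: open_continuous_measurable_fun.
  exact: closed_openC (@closed_eq R 0).
by move=> x; rewrite inE => x0; apply: inv_continuous; exact/eqP.
Qed.

Lemma mfun_sqrt f : measurable_fun setT f -> measurable_fun setT (fun x => Num.sqrt (f x)).
Proof.
move=> mf; apply: (measurableT_comp _ mf).
exact: continuous_measurable_fun (@sqrt_continuous R).
Qed.

Lemma mfun_powR f p : measurable_fun setT f -> measurable_fun setT (fun x => f x `^ p).
Proof. by move=> mf; apply: (measurableT_comp (measurable_powR p) mf). Qed.

Lemma mfun_EFin f : measurable_fun setT f -> measurable_fun setT (fun x => (f x)%:E).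
Proof. by move=> mf; exact/measurable_EFinP. Qed.

Lemma mfunDe F G : measurable_fun setT F -> measurable_fun setT G ->
  measurable_fun setT (fun x => F x + G x)%E.
Proof. exact: emeasurable_funD. Qed.

Lemma mfunMe F G : measurable_fun setT F -> measurable_fun setT G ->
  measurable_fun setT (fun x => F x * G x)%E.
Proof. exact: emeasurable_funM. Qed.

Lemma mfun_abse F : measurable_fun setT F -> measurable_fun setT (fun x => `|F x|%E).
Proof. by move=> mF; exact: measurableT_comp mF. Qed.

Lemma mfunDv u w : measurable_fun setT u -> measurable_fun setT w ->
  measurable_fun setT (fun x => u x + w x : vec3 R).
Proof.
move=> mu mw.
have m11 (v : T -> vec3 R) : measurable_fun setT v ->
    measurable_fun setT (fun x => (v x).1.1).
  move=> mv; apply: (measurableT_comp (@measurable_fst _ _ _ _)).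
  exact: (measurableT_comp (@measurable_fst _ _ _ _) mv).
have m12 (v : T -> vec3 R) : measurable_fun setT v ->
    measurable_fun setT (fun x => (v x).1.2).
  move=> mv; apply: (measurableT_comp (@measurable_snd _ _ _ _)).
  exact: (measurableT_comp (@measurable_fst _ _ _ _) mv).
have m2 (v : T -> vec3 R) : measurable_fun setT v ->
    measurable_fun setT (fun x => (v x).2).
  by move=> mv; exact: (measurableT_comp (@measurable_snd _ _ _ _) mv).
apply: measurable_fun_pair; first apply: measurable_fun_pair.
- exact: (mfunD (m11 _ mu) (m11 _ mw)).
- exact: (mfunD (m12 _ mu) (m12 _ mw)).
- exact: (mfunD (m2 _ mu) (m2 _ mw)).
Qed.

Lemma mfunZv f u : measurable_fun setT f -> measurable_fun setT u ->
  measurable_fun setT (fun x => f x *: u x : vec3 R).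
Proof.
move=> mf mu.
apply: measurable_fun_pair; first apply: measurable_fun_pair.
- apply: (mfunM mf); apply: (measurableT_comp (@measurable_fst _ _ _ _)).
  exact: (measurableT_comp (@measurable_fst _ _ _ _) mu).
- apply: (mfunM mf); apply: (measurableT_comp (@measurable_snd _ _ _ _)).
  exact: (measurableT_comp (@measurable_fst _ _ _ _) mu).
- apply: (mfunM mf); exact: (measurableT_comp (@measurable_snd _ _ _ _) mu).
Qed.

Lemma mfunNv u : measurable_fun setT u -> measurable_fun setT (fun x => - u x : vec3 R).
Proof.
move=> mu; rewrite (_ : (fun _ => _) = (fun x => (-1) *: u x : vec3 R)).
  by apply: mfunZv => //; exact: measurable_cst.
by apply/funext => x; rewrite scaleN1r.
Qed.

Lemma mfun_dot u w : measurable_fun setT u -> measurable_fun setT w ->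
  measurable_fun setT (fun x => dot3 (u x) (w x)).
Proof.
move=> mu mw; rewrite /dot3; apply: mfunD; first apply: mfunD.
- by apply: mfunM; apply: (measurableT_comp (@measurable_fst _ _ _ _));
    exact: (measurableT_comp (@measurable_fst _ _ _ _)).
- by apply: mfunM; apply: (measurableT_comp (@measurable_snd _ _ _ _));
    exact: (measurableT_comp (@measurable_fst _ _ _ _)).
- by apply: mfunM; exact: (measurableT_comp (@measurable_snd _ _ _ _)).
Qed.

Lemma mfun_norm3 u : measurable_fun setT u -> measurable_fun setT (fun x => norm3 (u x)).
Proof. by move=> mu; exact: (measurableT_comp measurable_norm3 mu). Qed.

Lemma mfun_japv u : measurable_fun setT u -> measurable_fun setT (fun x => japv (u x)).
Proof.
move=> mu; apply: mfun_sqrt; apply: mfunD; first exact: measurable_cst.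
exact: (mfunX 2 (mfun_norm3 mu)).
Qed.

End Measurability.

Section Tonelli.
Context d1 d2 (T1 : measurableType d1) (T2 : measurableType d2) (R : realType).
Context (m1 : {sigma_finite_measure set T1 -> \bar R})
  (m2 : {sigma_finite_measure set T2 -> \bar R}).
Context (h : T1 -> T2 -> \bar R).
Context (mh : measurable_fun setT (fun p => h p.1 p.2)).
Context (h0 : forall x y, (0 <= h x y)%E).

Lemma mfun_int : measurable_fun setT (fun x => \int[m2]_y h x y)%E.
Proof. exact: (@measurable_fun_fubini_tonelli_F _ _ _ _ _ m2 (fun p => h p.1 p.2)). Qed.

Lemma tonelli1 :
  (\int[(m1 \x m2)%E]_p h p.1 p.2 = \int[m1]_x \int[m2]_y h x y)%E.
Proof. exact: (@fubini_tonelli1 _ _ _ _ _ m1 m2 (fun p => h p.1 p.2)). Qed.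

Lemma tonelli :
  (\int[m1]_x \int[m2]_y h x y = \int[m2]_y \int[m1]_x h x y)%E.
Proof. exact: (@fubini_tonelli _ _ _ _ _ m1 m2 (fun p => h p.1 p.2)). Qed.

End Tonelli.

Section Scaling.
Context d (T : measurableType d) (R : realType) (mu : {measure set T -> \bar R}).
Context (k : \bar R) (f : T -> \bar R).
Context (mf : measurable_fun setT f) (f0 : forall x, (0 <= f x)%E) (k0 : (0 <= k)%E).

Lemma intZl : (\int[mu]_x (k * f x) = k * \int[mu]_x f x)%E.
Proof. exact: ge0_integralZl. Qed.

Lemma intZr : (\int[mu]_x (f x * k) = (\int[mu]_x f x) * k)%E.
Proof. exact: ge0_integralZr. Qed.

End Scaling.

Section FunctionComposition.
Context d (T : measurableType d).

Lemma mfun_app1 d1 (T1 : measurableType d1) d' (T' : measurableType d')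
    (h : T1 -> T') (e : T -> T1) :
  measurable_fun setT h -> measurable_fun setT e ->
  measurable_fun setT (fun x => h (e x)).
Proof. by move=> mh me; exact: measurableT_comp mh me. Qed.

Lemma mfun_fst d1 d2 (T1 : measurableType d1) (T2 : measurableType d2)
    (e : T -> T1 * T2) :
  measurable_fun setT e -> measurable_fun setT (fun x => (e x).1).
Proof. by move=> me; apply: (measurableT_comp _ me). Qed.

Lemma mfun_snd d1 d2 (T1 : measurableType d1) (T2 : measurableType d2)
    (e : T -> T1 * T2) :
  measurable_fun setT e -> measurable_fun setT (fun x => (e x).2).
Proof. by move=> me; apply: (measurableT_comp _ me). Qed.

Lemma mfun_pair d1 d2 (T1 : measurableType d1) (T2 : measurableType d2)
    (a : T -> T1) (b : T -> T2) :
  measurable_fun setT a -> measurable_fun setT b ->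
  measurable_fun setT (fun x => (a x, b x)).
Proof. by move=> ma mb; apply: measurable_fun_pair. Qed.

End FunctionComposition.

Lemma mfun_bcut d (T : measurableType d) (R : realType) (f : T -> R) :
  measurable_fun setT f -> measurable_fun setT (fun x => bcut (f x)).
Proof.
move=> mf; apply: (measurableT_comp _ mf); apply: measurable_indic.
rewrite (_ : [set _ | _] = `]0, +oo[%classic); first exact: measurable_itv.
by apply/seteqP; split=> r /=; rewrite in_itv/= andbT.
Qed.

Section PostCollisional.
Context d (T : measurableType d) (R : realType) (a b s : T -> vec3 R).
Context (ma : measurable_fun setT a) (mb : measurable_fun setT b).
Context (ms : measurable_fun setT s).

Let mhalf : measurable_fun setT (fun x => 2^-1 *: (a x + b x) : vec3 R).
Proof. by apply: mfunZv; [exact: measurable_cst|exact: mfunDv]. Qed.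

Let mradius : measurable_fun setT (fun x => (norm3 (a x - b x : vec3 R) / 2) *: s x : vec3 R).
Proof.
apply: mfunZv => //; apply: mfunM; last exact: measurable_cst.
by apply: mfun_norm3; apply: mfunDv => //; exact: mfunNv.
Qed.

Lemma mfun_vpost : measurable_fun setT (fun x => vpost (a x) (b x) (s x)).
Proof. exact: mfunDv mhalf mradius. Qed.

Lemma mfun_vpost1 : measurable_fun setT (fun x => vpost1 (a x) (b x) (s x)).
Proof. exact: mfunDv mhalf (mfunNv mradius). Qed.

End PostCollisional.

Ltac meas_hyp := match goal with
  | H : ?G |- ?G' => constr_eq G G'; exact H
  end.

Ltac meas_step := first [meas_hyp | lazymatch goal with
  | |- @measurable_fun _ _ _ _ _ (fun x => x) => exact: measurable_id
  | |- @measurable_fun _ _ _ _ _ fst => exact: measurable_fst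
  | |- @measurable_fun _ _ _ _ _ snd => exact: measurable_snd
  | |- @measurable_fun _ _ _ _ _ (fun x => (@?a x, @?b x)) =>
      apply: (@mfun_pair _ _ _ _ _ _ a b)
  | |- @measurable_fun _ _ _ _ _ (fun x => fst _) => apply: mfun_fst
  | |- @measurable_fun _ _ _ _ _ (fun x => snd _) => apply: mfun_snd
  | |- @measurable_fun _ _ _ _ _ (fun x => EFin _) => apply: mfun_EFin
  | |- @measurable_fun _ _ _ _ _ (fun x => adde _ _) => apply: mfunDe
  | |- @measurable_fun _ _ _ _ _ (fun x => mule _ _) => apply: mfunMe
  | |- @measurable_fun _ _ _ _ _ (fun x => abse _) => apply: mfun_abse
  | |- @measurable_fun _ _ _ _ _ (fun x => dot3 _ _) => apply: mfun_dot
  | |- @measurable_fun _ _ _ _ _ (fun x => bcut _) => apply: mfun_bcut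
  | |- @measurable_fun _ _ _ _ _ (fun x => vpost _ _ _) => apply: mfun_vpost
  | |- @measurable_fun _ _ _ _ _ (fun x => vpost1 _ _ _) => apply: mfun_vpost1
  | |- @measurable_fun _ _ _ _ _ (fun x => norm3 _) => apply: mfun_norm3
  | |- @measurable_fun _ _ _ _ _ (fun x => japv _) => apply: mfun_japv
  | |- @measurable_fun _ _ _ _ _ (fun x => @GRing.add _ _ _) =>
      first [apply: mfunD | apply: mfunDv]
  | |- @measurable_fun _ _ _ _ _ (fun x => @Algebra.add _ _ _) =>
      first [apply: mfunD | apply: mfunDv]
  | |- @measurable_fun _ _ _ _ _ (fun x => @Algebra.opp _ _) =>
      first [apply: mfunN | apply: mfunNv]
  | |- @measurable_fun _ _ _ _ _ (fun x => @GRing.scale _ _ _ _) => apply: mfunZv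
  | |- @measurable_fun _ _ _ _ _ (fun x => @GRing.mul _ _ _) => apply: mfunM
  | |- @measurable_fun _ _ _ _ _ (fun x => @GRing.exp _ _ _) => apply: mfunX
  | |- @measurable_fun _ _ _ _ _ (fun x => @GRing.inv _ _) => apply: mfunV
  | |- @measurable_fun _ _ _ _ _ (fun x => @Num.norm _ _ _) => apply: mfun_norm
  | |- @measurable_fun _ _ _ _ _ (fun x => @Num.sqrt _ _) => apply: mfun_sqrt
  | |- @measurable_fun _ _ _ _ _ (fun x => powR _ _) => apply: mfun_powR
  | |- @measurable_fun _ _ _ _ _ (fun x => @integral _ _ _ _ _ (@?h x)) =>
      apply: (@mfun_int _ _ _ _ _ _ h)
  | H : @measurable_fun _ _ _ _ _ ?h |- @measurable_fun _ _ _ _ _ (fun x => ?h (@?e x)) =>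
      apply: (@mfun_app1 _ _ _ _ _ _ h e H)
  | |- @measurable_fun ?d1 ?d2 ?T1 ?T2 ?D ?f =>
      lazymatch f with
      | (fun x => _) => exact: measurable_cst
      | _ => change (@measurable_fun d1 d2 T1 T2 D (fun x => f x))
      end
  end].

Ltac meas := repeat meas_step.

Lemma norm3_ge0 (R : realType) (v : vec3 R) : 0 <= norm3 v.
Proof. exact: sqrtr_ge0. Qed.

Ltac nneg := solve [intros; cbv beta; repeat first [
    by []
  | lazymatch goal with
    | |- is_true (@Order.le _ _ _ (integral _ _ _)) => apply: integral_ge0; intros
    | |- is_true (@Order.le _ _ _ (mule _ _)) => apply: mule_ge0
    | |- is_true (@Order.le _ _ _ (adde _ _)) => apply: adde_ge0
    | |- is_true (@Order.le _ _ _ (abse _)) => exact: abse_ge0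
    | |- is_true (@Order.le _ _ _ (EFin _)) => rewrite lee_fin
    | |- is_true (@Order.le _ _ _ (GRing.mul _ _)) => apply: mulr_ge0
    | |- is_true (@Order.le _ _ _ (GRing.add _ _)) => apply: addr_ge0
    | |- is_true (@Order.le _ _ _ (GRing.inv _)) => rewrite invr_ge0
    | |- is_true (@Order.le _ _ _ (GRing.exp _ _)) =>
        first [exact: sqr_ge0 | exact: exprn_even_ge0 | apply: exprn_ge0]
    | |- is_true (@Order.le _ _ _ (norm3 _)) => exact: norm3_ge0
    | |- is_true (@Order.le _ _ _ (japv _)) => exact: sqrtr_ge0
    | |- is_true (@Order.le _ _ _ (japr _)) => exact: sqrtr_ge0
    | |- is_true (@Order.le _ _ _ (@GRing.natmul _ _ _)) => exact: ler0n
    | |- is_true (@Order.le _ _ _ (powR _ _)) => exact: powR_ge0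
    | |- is_true (@Order.le _ _ _ (Num.sqrt _)) => exact: sqrtr_ge0
    | |- is_true (@Order.le _ _ _ (Num.norm _)) => exact: normr_ge0
    | |- is_true (@Order.le _ _ _ (bcut _)) => rewrite /bcut
    | |- is_true (@Order.le _ _ _ (indic _ _)) => rewrite indicE; exact: ler0n
    | H : context [ @Order.le _ _ _ (?h _) ] |- is_true (@Order.le _ _ _ (?h _)) => exact: H
    | H : context [ @Order.le _ _ _ (?h _ _) ] |- is_true (@Order.le _ _ _ (?h _ _)) => exact: H
    | H : context [ @Order.le _ _ _ (?h _ _ _ _) ] |- is_true (@Order.le _ _ _ (?h _ _ _ _)) => exact: H
    end ]].
Ltac meas0 := solve [meas; nneg].

(** * Lebesgue measure on the space of velocities *)

Section Leb3.
Context (R : realType).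
Notation mR := (measurableTypeR R).
Notation leb := (@lebesgue_measure R).
Local Open Scope ereal_scope.
Implicit Types (f : vec3 R -> \bar R).

Lemma leb2E (f : mR * mR -> \bar R) : measurable_fun setT f ->
  (forall x, 0 <= f x) ->
  \int[leb2]_p f p = \int[leb]_x \int[leb]_y f (x, y).
Proof. by move=> mf f0; exact: (@fubini_tonelli1 _ _ _ _ _ leb leb f). Qed.

Lemma leb2E' (f : mR * mR -> \bar R) : measurable_fun setT f ->
  (forall x, 0 <= f x) ->
  \int[leb2]_p f p = \int[leb]_y \int[leb]_x f (x, y).
Proof. by move=> mf f0; exact: (@fubini_tonelli2 _ _ _ _ _ leb leb f). Qed.

Lemma leb3E f : measurable_fun setT f -> (forall x, 0 <= f x) ->
  \int[leb3]_p f p = \int[leb2]_p \int[leb]_z f (p, z).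
Proof. by move=> mf f0; exact: (@fubini_tonelli1 _ _ _ _ _ leb2 leb f). Qed.

Lemma leb3E' f : measurable_fun setT f -> (forall x, 0 <= f x) ->
  \int[leb3]_p f p = \int[leb]_z \int[leb2]_p f (p, z).
Proof. by move=> mf f0; exact: (@fubini_tonelli2 _ _ _ _ _ leb2 leb f). Qed.

Lemma leb3_xyz f : measurable_fun setT f -> (forall x, 0 <= f x) ->
  \int[leb3]_p f p = \int[leb]_x \int[leb]_y \int[leb]_z f ((x, y), z).
Proof.
move=> mf f0; rewrite leb3E// leb2E//; meas => // x; exact: integral_ge0.
Qed.

Lemma leb3_zyx f : measurable_fun setT f -> (forall x, 0 <= f x) ->
  \int[leb3]_p f p = \int[leb]_z \int[leb]_y \int[leb]_x f ((x, y), z).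
Proof.
move=> mf f0; rewrite leb3E'//; apply: eq_integral => z _.
by rewrite leb2E'//; meas.
Qed.

(** The permutations of coordinates serve later to choose which coordinate of a given unit vector is
    the large one. *)
Lemma leb3_swap23 f : measurable_fun setT f -> (forall x, 0 <= f x) ->
  \int[leb3]_p f ((p.1.1, p.2), p.1.2) = \int[leb3]_p f p.
Proof.
move=> mf f0; rewrite [LHS]leb3_xyz//; last by meas.
rewrite [RHS](leb3_xyz mf f0).
apply: eq_integral => x _.
rewrite /=.
by apply: (@tonelli _ _ _ _ _ leb leb (fun y z => f (x, z, y))) => //; meas.
Qed.

Lemma leb3_swap12 f : measurable_fun setT f -> (forall x, 0 <= f x) ->
  \int[leb3]_p f ((p.1.2, p.1.1), p.2) = \int[leb3]_p f p.
Proof.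
move=> mf f0; rewrite [LHS]leb3_zyx//; last by meas.
rewrite [RHS](leb3_zyx mf f0).
apply: eq_integral => z _.
rewrite /=.
by apply: (@tonelli _ _ _ _ _ leb leb (fun y x => f (y, x, z))) => //; meas.
Qed.

Lemma leb3_swap13 f : measurable_fun setT f -> (forall x, 0 <= f x) ->
  \int[leb3]_p f ((p.2, p.1.2), p.1.1) = \int[leb3]_p f p.
Proof.
move=> mf f0; rewrite -[RHS]leb3_swap12// -[RHS]leb3_swap23//; last by meas.
by rewrite -[RHS]leb3_swap12//; meas.
Qed.

Lemma leb_affine (a t : R) (f : mR -> \bar R) : t != 0%R ->
  measurable_fun setT f -> (forall x, 0 <= f x) ->
  \int[leb]_s f (a + t * s)%R <= (`|t|^-1)%:E * \int[leb]_s f s.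
Proof.
move=> t0 mf f0; apply: ge0_integral_expanding => //.
- by meas.
- by rewrite normr_gt0.
- by move=> s u _ _; rewrite opprD addrACA subrr add0r -mulrBr normrM.
Qed.

(** The one-dimensional bound is applied in each coordinate, which gives the third power. *)
Lemma leb3_affine_le (a : vec3 R) (t : R) f : t != 0%R ->
  measurable_fun setT f -> (forall x, 0 <= f x) ->
  \int[leb3]_x f (a + t *: x)%R <= (`|t|^-1 ^+ 3)%:E * \int[leb3]_x f x.
Proof.
move=> t0 mf f0; pose c := (`|t|^-1)%R.
have c0 : (0 <= c)%R by rewrite invr_ge0.
rewrite [leLHS]leb3_xyz//; last by meas.
rewrite [X in _ <= _ * X](leb3_xyz mf f0).
rewrite !exprS expr0 mulr1 !EFinM -!muleA.
pose g y z := \int[leb]_x0 f (x0, y, z).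
have step2 x : \int[leb]_y \int[leb]_z f (a + t *: ((x, y, z) : vec3 R))%R <=
   c%:E * (c%:E * \int[leb]_y \int[leb]_z f ((a.1.1 + t * x)%R, y, z)).
  apply: (@le_trans _ _ (\int[leb]_y (c%:E * \int[leb]_z
       f (a.1.1 + t * x, a.1.2 + t * y, z)%R))).
    apply: ge0_le_integralT => y; first exact: integral_ge0.
    have := @leb_affine a.2 t (fun z => f (a.1.1 + t * x, a.1.2 + t * y, z)%R) t0.
    by apply => //; meas.
  rewrite ge0_integralZl//; [|meas0|nneg].
  apply: lee_wpmul2l; first by rewrite lee_fin.
  have := @leb_affine a.1.2 t (fun y => \int[leb]_z f (a.1.1 + t * x, y, z)%R) t0.
  by apply; [meas0|nneg].
apply: (le_trans (ge0_le_integralT _ _ step2)); first nneg.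
rewrite ge0_integralZl//; [|meas0|nneg].
rewrite ge0_integralZl//; [|meas0|nneg].
do 2 (apply: lee_wpmul2l; first by rewrite lee_fin).
have := @leb_affine a.1.1 t (fun x => \int[leb]_y \int[leb]_z f (x, y, z)%R) t0.
by apply; [meas0|nneg].
Qed.

(** The reverse inequality is the same bound for the inverse affine map. *)
Lemma leb3_affine (a : vec3 R) (t : R) f : t != 0%R ->
  measurable_fun setT f -> (forall x, 0 <= f x) ->
  \int[leb3]_x f (a + t *: x)%R = (`|t|^-1 ^+ 3)%:E * \int[leb3]_x f x.
Proof.
move=> t0 mf f0; apply/eqP; rewrite eq_le leb3_affine_le//=.
have tn : (`|t| != 0)%R by rewrite normr_eq0.
have e x : (a + t *: (- (t^-1 *: a) + t^-1 *: x) = x)%R.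
  by rewrite scalerDr scalerN !scalerA mulfV// !scale1r addrA addrN add0r.
have H := @leb3_affine_le (- (t^-1 *: a))%R t^-1 (fun x => f (a + t *: x)%R).
rewrite invr_eq0 in H; have {}H := H t0 _ (fun x => f0 _).
have fe : (fun x => f (a + t *: (- (t^-1 *: a) + t^-1 *: x))%R) = f.
  by apply/funext => x; rewrite e.
rewrite fe in H.
apply: (@le_trans _ _ ((`|t|^-1 ^+ 3)%:E * ((`|t^-1|^-1 ^+ 3)%:E *
    \int[leb3]_x f (a + t *: x)%R))).
  by apply: lee_wpmul2l; rewrite ?lee_fin ?exprn_ge0 ?invr_ge0//; apply: H; meas.
rewrite muleA -EFinM normfV invrK -exprMn mulVf// expr1n mul1e//.
Qed.

Lemma leb3_shift (a : vec3 R) f :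
  measurable_fun setT f -> (forall x, 0 <= f x) ->
  \int[leb3]_x f (a + x)%R = \int[leb3]_x f x.
Proof.
move=> mf f0; have := @leb3_affine a 1%R f (oner_neq0 _) mf f0.
rewrite normr1 invr1 expr1n mul1e => <-.
by under [RHS]eq_integral do rewrite scale1r.
Qed.

Lemma leb3_subl (a : vec3 R) f :
  measurable_fun setT f -> (forall x, 0 <= f x) ->
  \int[leb3]_x f (a - x)%R = \int[leb3]_x f x.
Proof.
move=> mf f0; have := @leb3_affine a (-1)%R f _ mf f0.
rewrite oppr_eq0 oner_eq0 => /(_ isT).
rewrite normrN1 invr1 expr1n mul1e => <-.
by under [RHS]eq_integral do rewrite scaleN1r.
Qed.

End Leb3.

(** * The Euclidean norm on R^3 *)

Section EuclideanNorm.
Context (R : realType).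
Implicit Types (u v w : vec3 R) (t : R).

Lemma vec3_eq u v : u.1.1 = v.1.1 -> u.1.2 = v.1.2 -> u.2 = v.2 -> u = v.
Proof. by case: u v => [[? ?] ?] [[? ?] ?] /= -> -> ->. Qed.

Lemma coordDE u v : ((u + v : vec3 R).1.1 = u.1.1 + v.1.1) *
  ((u + v : vec3 R).1.2 = u.1.2 + v.1.2) * ((u + v : vec3 R).2 = u.2 + v.2).
Proof. by []. Qed.

Lemma coordNE v : ((- v : vec3 R).1.1 = - v.1.1) *
  ((- v : vec3 R).1.2 = - v.1.2) * ((- v : vec3 R).2 = - v.2).
Proof. by []. Qed.

Lemma coordZE t v : ((t *: v : vec3 R).1.1 = t * v.1.1) *
  ((t *: v : vec3 R).1.2 = t * v.1.2) * ((t *: v : vec3 R).2 = t * v.2).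
Proof. by []. Qed.

Lemma dot3C u v : dot3 u v = dot3 v u.
Proof. by rewrite /dot3 (mulrC u.1.1) (mulrC u.1.2) (mulrC u.2). Qed.

Lemma dot3Dl u v w : dot3 (u + v : vec3 R) w = dot3 u w + dot3 v w.
Proof. by case: u v => [[u1 u2] u3] [[v1 v2] v3]; rewrite /dot3 /= !mulrDl; ring. Qed.

Lemma dot3Zl t u v : dot3 (t *: u : vec3 R) v = t * dot3 u v.
Proof. by case: u => [[u1 u2] u3]; rewrite /dot3 /= !mulrDr !mulrA. Qed.

Lemma dot3Nl u v : dot3 (- u : vec3 R) v = - dot3 u v.
Proof. by rewrite -scaleN1r dot3Zl mulN1r. Qed.

Lemma dot3Dr u v w : dot3 w (u + v : vec3 R) = dot3 w u + dot3 w v.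
Proof. by rewrite dot3C dot3Dl !(dot3C w). Qed.

Lemma dot3Zr t u v : dot3 v (t *: u : vec3 R) = t * dot3 v u.
Proof. by rewrite dot3C dot3Zl (dot3C v). Qed.

Lemma dot3Nr u v : dot3 v (- u : vec3 R) = - dot3 v u.
Proof. by rewrite dot3C dot3Nl (dot3C v). Qed.

Lemma norm3_sqr v : norm3 v ^+ 2 = dot3 v v.
Proof. by rewrite /norm3 sqr_sqrtr// dot3_ge0. Qed.

Lemma norm3Z t v : norm3 (t *: v : vec3 R) = `|t| * norm3 v.
Proof.
rewrite /norm3 dot3Zl dot3Zr mulrA -expr2 sqrtrM ?sqr_ge0//.
by rewrite sqrtr_sqr.
Qed.

Lemma norm3N v : norm3 (- v : vec3 R) = norm3 v.
Proof. by rewrite -scaleN1r norm3Z normrN1 mul1r. Qed.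

Lemma norm3B u v : norm3 (u - v : vec3 R) = norm3 (v - u : vec3 R).
Proof. by rewrite -norm3N opprB. Qed.

Lemma norm3_0 : norm3 (0 : vec3 R) = 0.
Proof. by rewrite -(scale0r (0 : vec3 R)) norm3Z normr0 mul0r. Qed.

Lemma norm3_eq0 v : norm3 v = 0 -> v = 0.
Proof.
move=> v0; have : dot3 v v = 0 by rewrite -norm3_sqr v0 expr0n.
case: v {v0} => [[a b] c]; rewrite /dot3 /= -!expr2 => /eqP.
rewrite paddr_eq0 ?addr_ge0 ?sqr_ge0// paddr_eq0 ?sqr_ge0//.
by rewrite !sqrf_eq0 => /andP[/andP[/eqP-> /eqP->] /eqP->].
Qed.

Lemma norm3_gt0 v : v != 0 -> 0 < norm3 v.
Proof.
by rewrite lt0r norm3_ge0 andbT; apply: contra_neq; exact: norm3_eq0.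
Qed.

Lemma dot3_le u v : dot3 u v <= norm3 u * norm3 v.
Proof.
have [->|u0] := eqVneq u 0.
  by rewrite norm3_0 mul0r -(scale0r (0 : vec3 R)) dot3Zl mul0r.
have [->|v0] := eqVneq v 0.
  by rewrite norm3_0 mulr0 -(scale0r (0 : vec3 R)) dot3Zr mul0r.
have := norm3_gt0 u0; have := norm3_gt0 v0.
set a := norm3 u; set b := norm3 v => b0 a0.
(* With a = |u| and b = |v| this square equals 2 a b (a b - u.v), which gives the Cauchy-Schwarz
   inequality. *)
have : 0 <= dot3 (b *: u - a *: v : vec3 R) (b *: u - a *: v : vec3 R) by exact: dot3_ge0.
rewrite dot3Dl !dot3Dr !dot3Nl !dot3Nr !dot3Zl !dot3Zr -!norm3_sqr (dot3C v u).
rewrite -/a -/b => H.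
have : 0 <= (a * b) * (a * b - dot3 u v) by nra.
by rewrite pmulr_rge0 ?mulr_gt0// subr_ge0.
Qed.

Lemma norm3D u v : norm3 (u + v : vec3 R) <= norm3 u + norm3 v.
Proof.
rewrite -(@ler_pXn2r _ 2) ?nnegrE ?addr_ge0 ?norm3_ge0//.
rewrite sqrrD !norm3_sqr dot3Dl !dot3Dr (dot3C v u).
by have := dot3_le u v; rewrite mulr2n; lra.
Qed.

Lemma coord3_le v : [/\ `|v.1.1| <= norm3 v, `|v.1.2| <= norm3 v & `|v.2| <= norm3 v].
Proof.
case: v => [[a b] c] /=.
have s (x y : R) : x ^+ 2 <= y -> `|x| <= Num.sqrt y.
  by move=> xy; rewrite -sqrtr_sqr ler_sqrt// (le_trans _ xy)// sqr_ge0.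
have := sqr_ge0 a; have := sqr_ge0 b; have := sqr_ge0 c.
by rewrite /norm3 /dot3 /= -!expr2 => ? ? ?; split; apply: s; lra.
Qed.

Lemma norm3_direction v : 0 < norm3 v -> norm3 (direction v) = 1.
Proof.
by move=> v0; rewrite norm3Z normfV ger0_norm ?norm3_ge0// mulVf// gt_eqF.
Qed.

(** Otherwise the three squares would sum to at most 3/4. *)
Lemma unit3_coord v : norm3 v = 1 ->
  [\/ 2^-1 <= `|v.1.1|, 2^-1 <= `|v.1.2| | 2^-1 <= `|v.2|].
Proof.
move=> v1; have : dot3 v v = 1 by rewrite -norm3_sqr v1 expr1n.
case: v {v1} => [[a b] c]; rewrite /dot3 /= -!expr2 => abc.
have [?|ha] := lerP 2^-1 `|a|; first by constructor 1.
have [?|hb] := lerP 2^-1 `|b|; first by constructor 2.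
have [?|hc] := lerP 2^-1 `|c|; first by constructor 3.
have q (x : R) : `|x| < 2^-1 -> x ^+ 2 <= 4^-1.
  rewrite -real_normK ?num_real// => x2.
  have := normr_ge0 x; nra.
by have := q _ ha; have := q _ hb; have := q _ hc; lra.
Qed.

(** With k = u.v, the difference of the squared norms is (a - b)^2 + 2 (1 - k) (a b - 1).
    Geometrically, radial projection of the exterior of the unit ball onto the sphere does not
    increase distances. *)
Lemma norm3_dilate u v (a b : R) : norm3 u = 1 -> norm3 v = 1 ->
  1 <= a -> 1 <= b -> norm3 (u - v : vec3 R) <= norm3 (a *: u - b *: v : vec3 R).
Proof.
move=> u1 v1 a1 b1.
rewrite -(@ler_pXn2r _ 2) ?nnegrE ?norm3_ge0// !norm3_sqr.
rewrite !dot3Dl !dot3Dr !dot3Nl !dot3Nr !dot3Zl !dot3Zr (dot3C v u) -!norm3_sqr.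
rewrite u1 v1.
have : dot3 u v <= 1 by rewrite (le_trans (dot3_le _ _))// u1 v1 mulr1.
set k := dot3 u v => k1.
have : 0 <= (a - b) ^+ 2 by exact: sqr_ge0.
have : 0 <= (1 - k) * (a * b - 1) by rewrite mulr_ge0 ?subr_ge0 ?mulr_ege1.
by rewrite !expr2 => H1 H2; lra.
Qed.

End EuclideanNorm.

Ltac vec3_field := apply: vec3_eq; rewrite ?(coordDE, coordNE, coordZE); field.

(** * Averages over the unit sphere *)

Section Sphere.
Context (R : realType).
Notation mR := (measurableTypeR R).
Notation leb := (@lebesgue_measure R).
Notation sph := (@sphere_measure R).
Notation pb := (@punctured_ball R).
Local Open Scope ereal_scope.
Implicit Types (f g : vec3 R -> \bar R).

Lemma sphereE f : measurable_fun setT f -> (forall s, 0 <= f s) ->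
  \int[sph]_s f s = 3%:E * \int[leb3]_(y in pb) f (direction y).
Proof.
move=> mf f0; apply: (@ge0_integral_scaled_image _ _ _ _ _ _ _ (@direction R)) => //.
- exact: measurable_punctured_ball.
- exact: measurable_direction.
Qed.

Lemma sphere_indicE f : measurable_fun setT f -> (forall s, 0 <= f s) ->
  \int[sph]_s f s = 3%:E * \int[leb3]_y ((\1_pb y)%:E * f (direction y)).
Proof.
move=> mf f0; rewrite (sphereE mf f0); congr (_ * _).
rewrite integral_mkcond; apply: eq_integral => y _.
by rewrite patchE indicE; case: (y \in pb); rewrite ?mul1e ?mul0e.
Qed.

(** The sphere measure lives on R^3 and integrals run over the whole space; the comparison is asked
    only on unit vectors because the direction of a point of the punctured ball is one. *)
Lemma le_integral_sphere f g : measurable_fun setT f -> measurable_fun setT g ->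
  (forall s, 0 <= f s) -> (forall s, 0 <= g s) ->
  (forall s, norm3 s = 1%R -> f s <= g s) ->
  \int[sph]_s f s <= \int[sph]_s g s.
Proof.
move=> mf mg f0 g0 fg; rewrite (sphereE mf f0) (sphereE mg g0).
apply: lee_wpmul2l => //; apply: ge0_le_integral => //.
- exact: measurable_punctured_ball.
- by apply: measurable_funTS; exact: measurableT_comp mf (@measurable_direction R).
- by apply: measurable_funTS; exact: measurableT_comp mg (@measurable_direction R).
- by move=> y /andP[y0 _]; apply: fg; exact: norm3_direction.
Qed.

Lemma eq_integral_sphere f g : measurable_fun setT f -> measurable_fun setT g ->
  (forall s, 0 <= f s) -> (forall s, 0 <= g s) ->
  (forall s, norm3 s = 1%R -> f s = g s) ->
  \int[sph]_s f s = \int[sph]_s g s.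
Proof.
move=> mf mg f0 g0 fg; apply/eqP; rewrite eq_le.
by apply/andP; split; apply: le_integral_sphere => // s s1; rewrite fg.
Qed.

Lemma sphere_opp f : measurable_fun setT f -> (forall s, 0 <= f s) ->
  \int[sph]_s f (- s)%R = \int[sph]_s f s.
Proof.
move=> mf f0; have mfN : measurable_fun setT (fun s : vec3 R => f (- s)%R) by meas.
rewrite (sphere_indicE mf f0) (sphere_indicE mfN)//; congr (_ * _).
have mi : measurable_fun setT (\1_pb : vec3 R -> R).
  by apply: measurable_indic; exact: measurable_punctured_ball.
have md : measurable_fun setT (@direction R) := @measurable_direction R.
rewrite -(@leb3_subl R 0%R (fun y => (\1_pb y)%:E * f (direction y))); [|meas0|nneg].
apply: eq_integral => y _; rewrite sub0r !indicE.
have -> : (- y \in pb)%R = (y \in pb) by apply/idP/idP; rewrite !inE /punctured_ball /= norm3N.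
by have -> : (direction (- y : vec3 R) = - direction y)%R by rewrite /direction norm3N scalerN.
Qed.

End Sphere.

(** * Dyadic estimate of integrals of negative powers *)

Section Dyadic.
Context d (T : measurableType d) (R : realType) (mu : {measure set T -> \bar R}).

Lemma japr_ge1 (t : R) : 1 <= japr t.
Proof. by rewrite /japr -{1}sqrtr1 ler_sqrt ?addr_ge0 ?sqr_ge0// lerDl sqr_ge0. Qed.

Lemma japr_gt0 (t : R) : 0 < japr t.
Proof. exact: lt_le_trans (japr_ge1 t). Qed.

Lemma le_japr (t : R) : `|t| <= japr t.
Proof. by rewrite /japr -sqrtr_sqr ler_sqrt ?addr_ge0 ?sqr_ge0// lerDr. Qed.

(** Take the least such n. If n > 0, minimality gives 2^(n-1) < t, and the shift by one costs the
    factor 2^k; if n = 0, the left side is at most 1 and the right side is 2^k. *)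
Lemma japr_dyadic (k t : R) : 0 <= k -> 0 <= t ->
  exists n : nat, t <= 2 ^+ n /\ japr t `^ (- k) <= 2 `^ k * (2 `^ (- k)) ^+ n.
Proof.
move=> k0 t0.
have ex : exists n : nat, t <= 2 ^+ n.
  exists (Num.truncn t).+1; rewrite (le_trans (ltW (truncnS_gt t)))//.
  by rewrite -natrX ler_nat ltnW// ltn_expl.
have [n tn nmin] := ex_minnP ex.
exists n; split=> //.
have p2 (x : R) (m : nat) : (2 `^ x) ^+ m = 2 `^ (x *+ m).
  by rewrite -powR_mulrn ?powR_ge0// -powRrM mulr_natr.
case: n tn nmin => [|n] tn nmin.
  rewrite expr0 mulr1 (@le_trans _ _ 1)//.
    by rewrite -(powRr0 (japr t)) ler_powR ?japr_ge1 ?oppr_le0.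
  by rewrite -[leLHS](powRr0 2) ler_powR// ler1n.
have tn' : 2 ^+ n < t by rewrite ltNge; apply/negP => /nmin; rewrite ltnn.
rewrite exprS mulrA -powRD ?subrr ?powRr0 ?mul1r; last by rewrite pnatr_eq0 implybT.
have -> : (2 `^ (- k)) ^+ n = (2 ^+ n) `^ (- k).
  by rewrite p2 -(powR_mulrn n)// -powRrM mulr_natl.
rewrite !powRN lef_pV2 ?posrE ?powR_gt0 ?japr_gt0 ?exprn_gt0//.
apply: ge0_ler_powR => //; rewrite ?nnegrE ?exprn_ge0 ?(ltW (japr_gt0 _))//.
by rewrite (le_trans (ltW tn'))// (le_trans _ (le_japr t))// ler_norm.
Qed.

Local Open Scope ereal_scope.

(** The integrand is dominated by the sum over n of 2^k 2^(-kn) on the set where Z <= 2^n, since the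
    dyadic n of [Z x] already contributes enough. Integration gives a geometric series of ratio
    2^(j-k). It is used with j = 1 on the sphere and on the line, and with j = 3 on R^3. *)
Lemma integral_japr_le (D : set T) (Z : T -> R) (c j k : R) :
  measurable D -> measurable_fun setT Z -> (forall x, 0 <= Z x)%R ->
  (0 <= c)%R -> (0 <= k)%R -> (j < k)%R ->
  (forall n : nat, mu (D `&` [set x | (Z x <= 2 ^+ n)%R]) <=
     (c * (2 `^ j) ^+ n)%:E) ->
  \int[mu]_(x in D) (japr (Z x) `^ (- k))%:E <=
    (c * (2 `^ k / (1 - 2 `^ (j - k))))%:E.
Proof.
move=> mD mZ Z0 c0 k0 jk muZ.
pose q := (2 `^ (j - k) : R)%R.
have q0 : (0 < q)%R by rewrite powR_gt0.
have q1 : (q < 1)%R.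
  rewrite /q -opprB powRN invf_lt1 ?powR_gt0//.
  have kj : (0 < k - j)%R by rewrite subr_gt0.
  have := @gt0_ltr_powR R _ kj 1%R 2%R; rewrite powR1; apply.
  - by rewrite nnegrE.
  - by rewrite nnegrE.
  - by rewrite ltr1n.
pose E n := [set x | (Z x <= 2 ^+ n)%R].
have mE n : measurable (E n).
  rewrite (_ : E n = Z @^-1` `]-oo, (2 ^+ n)%R]%classic).
    by rewrite -[_ @^-1` _]setTI; exact: mZ.
  by apply/seteqP; split=> x /=; rewrite in_itv.
pose w n x : \bar R := (2 `^ k * (2 `^ (- k)) ^+ n * \1_(E n) x)%:E.
have w0 n x : 0 <= w n x by rewrite /w; nneg.
have mw n : measurable_fun setT (w n).
  by apply: mfun_EFin; apply: mfunM; [exact: measurable_cst|exact: measurable_indic].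
apply: (@le_trans _ _ (\int[mu]_(x in D) \sum_(0 <= n <oo) w n x)).
  apply: ge0_le_integral => //.
  - by move=> x _; rewrite lee_fin powR_ge0.
  - apply: measurable_funTS; apply: mfun_EFin; apply: mfun_powR.
    by rewrite /japr; meas.
  - by apply: ge0_emeasurable_sum => //; move=> n _; exact: measurable_funTS.
  move=> x _; have [n [Zn Hn]] := japr_dyadic k0 (Z0 x).
  apply: (@le_trans _ _ (w n x)).
    by rewrite /w lee_fin indicE mem_set ?mulr1//.
  rewrite (@nneseriesD1 _ (fun m => w m x) n predT)//.
  by rewrite leeDl// nneseries_ge0// => m _ _; exact: w0.
rewrite integral_nneseries//; last by move=> n; exact: measurable_funTS.
have wi n : \int[mu]_(x in D) w n x <= (c * 2 `^ k * q ^+ n)%:E.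
  rewrite /w; under eq_integral do rewrite EFinM.
  rewrite ge0_integralZl ?lee_fin ?mulr_ge0 ?exprn_ge0 ?powR_ge0//; last first.
    by apply: measurable_funTS; apply: mfun_EFin; exact: measurable_indic.
  rewrite integral_indic//.
  apply: (@le_trans _ _ ((2 `^ k * (2 `^ (- k)) ^+ n)%:E * (c * (2 `^ j) ^+ n)%:E)).
    by apply: lee_wpmul2l; [rewrite lee_fin mulr_ge0 ?exprn_ge0 ?powR_ge0|rewrite setIC; exact: muZ].
  rewrite -EFinM lee_fin (_ : q = 2 `^ (- k) * 2 `^ j)%R; last first.
    by rewrite -powRD ?pnatr_eq0 ?implybT// addrC.
  by rewrite exprMn; rewrite le_eqVlt; apply/orP; left; apply/eqP; ring.
apply: (@le_trans _ _ (\sum_(0 <= n <oo) (c * 2 `^ k * q ^+ n)%:E)).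
  by apply: lee_nneseries => [n _ _|n _]; [exact: integral_ge0|exact: wi].
have q1' : (`|q| < 1)%R by rewrite ger0_norm// ltW.
have cg := @cvg_geometric_series R (c * 2 `^ k)%R q q1'.
rewrite le_eqVlt; apply/orP; left; apply/eqP.
rewrite mulrA; apply/cvg_lim => //.
rewrite [X in X @ _ --> _](_ : _ = EFin \o series (geometric (c * 2 `^ k)%R q)).
  exact: (cvg_comp _ _ cg (fun _ => id)).
by apply/funext => n; rewrite /= sumEFin.
Qed.

End Dyadic.

(** * Area of caps and averages of weights over the sphere *)

Section Caps.
Context (R : realType).
Notation mR := (measurableTypeR R).
Notation leb := (@lebesgue_measure R).
Notation sph := (@sphere_measure R).
Notation pb := (@punctured_ball R).
Local Open Scope ereal_scope.

Lemma integral_indic_itv (c h : R) : (0 <= h)%R ->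
  \int[leb]_x (\1_(`[(c - h)%R, (c + h)%R]%classic : set R) x)%:E = (2 * h)%:E.
Proof.
move=> h0; rewrite integral_indic//= setIT lebesgue_measure_itv/= lte_fin.
case: ltP => [_|H]; first by congr EFin; lra.
by congr EFin; lra.
Qed.

(** For fixed third coordinate in [-1, 1], the first two range over intervals of length 2h: the
    volume is at most 2 (2h)^2. *)
Lemma leb3_tube (A : set (vec3 R)) (a b h : R) : (0 <= h)%R -> measurable A ->
  (forall y, A y -> [/\ `|y.1.1 - a * y.2| <= h, `|y.1.2 - b * y.2| <= h
     & `|y.2| <= 1])%R ->
  leb3 A <= (8 * h ^+ 2)%:E.
Proof.
move=> h0 mA Ah.
pose J (c r : R) : set mR := `[(c - r)%R, (c + r)%R]%classic.
have mJ c r : measurable (J c r) by exact: measurable_itv.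
have JP (c r x : R) : (`|x - c| <= r)%R -> J c r x.
  by rewrite /J /= in_itv /= ler_norml => /andP[? ?]; apply/andP; split; lra.
have mi (S : set mR) : measurable S -> measurable_fun setT (fun x : mR => (\1_S x)%:E : \bar R).
  by move=> mS; apply: mfun_EFin; exact: measurable_indic.
have iA : measurable_fun setT (fun y : vec3 R => (\1_A y)%:E : \bar R).
  by apply: mfun_EFin; exact: measurable_indic.
have iA0 (y : vec3 R) : 0 <= (\1_A y)%:E :> \bar R by rewrite lee_fin.
rewrite -[X in leb3 X]setIT -integral_indic// (leb3_zyx iA iA0).
apply: (@le_trans _ _ (\int[leb]_z ((2 * h * (2 * h))%:E * (\1_(J 0%R 1%R) z)%:E))).
  apply: ge0_le_integralT => [z|z]; first nneg.
  apply: (@le_trans _ _ (\int[leb]_y (((2 * h) * \1_(J 0%R 1%R) z)%:E *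
      (\1_(J (b * z) h)%R y)%:E))).
    apply: ge0_le_integralT => [y|y]; first nneg.
    apply: (@le_trans _ _ (\int[leb]_x ((\1_(J 0%R 1%R) z * \1_(J (b * z) h)%R y)%:E *
       (\1_(J (a * z) h)%R x)%:E))).
      apply: ge0_le_integralT => [x|x]; first nneg.
      rewrite -EFinM lee_fin !indicE.
      case: (boolP ((x, y, z) \in A)); last by move=> _; rewrite !mulr_ge0.
      rewrite inE => /Ah[/= /JP h1 /JP h2]; rewrite -(subr0 z) => /JP; rewrite subr0 => h3.
      by rewrite !mem_set// !mulr1.
    rewrite ge0_integralZl ?lee_fin//; last exact: mi.
    by rewrite integral_indic_itv// -!EFinM lee_fin; lra.
  rewrite ge0_integralZl ?lee_fin ?mulr_ge0//; last exact: mi.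
  by rewrite integral_indic_itv// -!EFinM lee_fin; lra.
rewrite ge0_integralZl ?lee_fin ?mulr_ge0//; last exact: mi.
rewrite integral_indic_itv// -!EFinM lee_fin expr2; lra.
Qed.

(** Some coordinate of [e] is at least 1/2 in absolute value. Eliminating |y| between it and each
    other coordinate puts [A], up to a permutation of coordinates, in a tube of half-width h + 2h,
    and 8 (3h)^2 = 72 h^2. *)
Lemma leb3_cap (A : set (vec3 R)) (e : vec3 R) (h : R) : (0 <= h)%R ->
  measurable A -> norm3 e = 1%R ->
  (forall y, A y -> norm3 y <= 1 /\ norm3 (y - norm3 y *: e : vec3 R) <= h)%R ->
  leb3 A <= (72 * h ^+ 2)%:E.
Proof.
move=> h0 mA e1 Ah.
have [e11 e12 e2] := coord3_le e; rewrite e1 in e11 e12 e2.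
have key (p q ei ej : R) : (2^-1 <= `|ei| -> `|ej| <= 1 -> `|p| <= h -> `|q| <= h ->
    `|p - (ej / ei) * q| <= 3 * h)%R.
  move=> i1 j1 ph qh.
  have r2 : (`|ej / ei| <= 2)%R.
    rewrite normrM normfV ler_pdivrMr; last by lra.
    lra.
  rewrite (le_trans (ler_normB _ _))// normrM.
  have : (`|ej / ei| * `|q| <= 2 * h)%R by apply: ler_pM.
  lra.
have h3 : (0 <= 3 * h)%R by rewrite mulr_ge0.
have -> : (72 * h ^+ 2 = 8 * (3 * h) ^+ 2)%R by rewrite exprMn; ring.
have iA : measurable_fun setT (fun y : vec3 R => (\1_A y)%:E : \bar R).
  by apply: mfun_EFin; exact: measurable_indic.
have iA0 (y : vec3 R) : 0 <= (\1_A y)%:E :> \bar R by rewrite lee_fin.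
have swapA (sw : vec3 R -> vec3 R) : measurable_fun setT sw ->
    \int[leb3]_y (\1_A (sw y))%:E = \int[leb3]_y (\1_A y)%:E ->
    leb3 A = leb3 (sw @^-1` A).
  move=> msw E; have mswA : measurable (sw @^-1` A).
    by rewrite -[_ @^-1` _]setTI; exact: msw.
  have := integral_indic (@leb3 R) measurableT mA; rewrite setIT => <-.
  have := integral_indic (@leb3 R) measurableT mswA; rewrite setIT => <-.
  rewrite -E; apply: eq_integral => y _; rewrite !indicE.
  by have -> : (sw y \in A) = (y \in sw @^-1` A) by apply/idP/idP; rewrite !inE.
have mpre (sw : vec3 R -> vec3 R) : measurable_fun setT sw -> measurable (sw @^-1` A).
  by move=> msw; rewrite -[_ @^-1` _]setTI; exact: msw.
(* The multiple [n] of the axis cancels, so both brackets are deviations bounded by h. *)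
have split3 (ei ej x y n : R) : (ei != 0 ->
    x - ej / ei * y = (x - n * ej) - ej / ei * (y - n * ei))%R.
  by move=> ei0; field.
have nz (x : R) : (2^-1 <= `|x| -> x != 0)%R.
  by move=> x2; rewrite -normr_gt0; lra.
have Ac y : A y -> [/\ `|y.1.1 - norm3 y * e.1.1| <= h, `|y.1.2 - norm3 y * e.1.2| <= h,
    `|y.2 - norm3 y * e.2| <= h, `|y.1.1| <= 1 & `|y.1.2| <= 1 /\ `|y.2| <= 1]%R.
  move=> /Ah[y1 yh]; have [? ? ?] := coord3_le y.
  have [h11 h12 h2] := coord3_le (y - norm3 y *: e : vec3 R)%R.
  split; [exact: le_trans yh|exact: le_trans yh|exact: le_trans yh|exact: le_trans y1|].
  by split; exact: le_trans y1.
case: (unit3_coord e1) => ei.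
- pose sw (p : vec3 R) : vec3 R := ((p.2, p.1.2), p.1.1).
  have msw : measurable_fun setT sw by rewrite /sw; meas.
  rewrite (swapA sw msw (leb3_swap13 iA iA0)).
  apply: (@leb3_tube _ (e.2 / e.1.1) (e.1.2 / e.1.1)) => //; first exact: mpre.
  move=> [[y1 y2] y3] /Ac[/= ? ? ? ? []] ? ?; split => //.
  + by rewrite (split3 _ _ _ _ (norm3 ((y3, y2, y1) : vec3 R)) (nz _ ei)); apply: key.
  + by rewrite (split3 _ _ _ _ (norm3 ((y3, y2, y1) : vec3 R)) (nz _ ei)); apply: key.
- pose sw (p : vec3 R) : vec3 R := ((p.1.1, p.2), p.1.2).
  have msw : measurable_fun setT sw by rewrite /sw; meas.
  rewrite (swapA sw msw (leb3_swap23 iA iA0)).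
  apply: (@leb3_tube _ (e.1.1 / e.1.2) (e.2 / e.1.2)) => //; first exact: mpre.
  move=> [[y1 y2] y3] /Ac[/= ? ? ? ? []] ? ?; split => //.
  + by rewrite (split3 _ _ _ _ (norm3 ((y1, y3, y2) : vec3 R)) (nz _ ei)); apply: key.
  + by rewrite (split3 _ _ _ _ (norm3 ((y1, y3, y2) : vec3 R)) (nz _ ei)); apply: key.
- apply: (@leb3_tube _ (e.1.1 / e.2) (e.1.2 / e.2)) => //.
  move=> [[y1 y2] y3] /Ac[/= ? ? ? ? []] ? ?; split => //.
  + by rewrite (split3 _ _ _ _ (norm3 ((y1, y2, y3) : vec3 R)) (nz _ ei)); apply: key.
  + by rewrite (split3 _ _ _ _ (norm3 ((y1, y2, y3) : vec3 R)) (nz _ ei)); apply: key.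
Qed.

(** The cone over [E] satisfies the cap bound with axis any one of its directions, because |y| <= 1
    there; the constant is 3 times 72. *)
Lemma sphere_cap (E : set (vec3 R)) (h : R) : (0 <= h)%R -> measurable E ->
  (forall s t, E s -> E t -> norm3 s = 1 -> norm3 t = 1 ->
     norm3 (s - t : vec3 R) <= h)%R ->
  sph E <= (216 * h ^+ 2)%:E.
Proof.
move=> h0 mE Eh.
rewrite /sphere_measure (_ : 216 = 3 * 72 :> R)%R; last by ring.
rewrite -mulrA EFinM; apply: lee_wpmul2l => //.
set A := _ `&` _.
have mA : measurable A.
  apply: measurableI (@measurable_punctured_ball R).
  by rewrite -[_ @^-1` _]setTI; exact: measurable_direction.
have [->|/set0P[y0 [Ey0 /andP[y00 _]]]] := eqVneq A set0.
  by rewrite measure0 lee_fin mulr_ge0 ?exprn_ge0.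
apply: (@leb3_cap _ (direction y0)) => //; first exact: norm3_direction.
move=> y [/= Ey /andP[yp y1]]; split => //.
have -> : (y - norm3 y *: direction y0 = norm3 y *: (direction y - direction y0))%R.
  by rewrite scalerBr; congr (_ - _)%R; rewrite /direction scalerA mulfV ?gt_eqF// scale1r.
rewrite norm3Z ger0_norm ?norm3_ge0// -[leRHS]mul1r.
apply: ler_pM => //; rewrite ?norm3_ge0//.
by apply: Eh => //; exact: norm3_direction.
Qed.

(** 864 = 216 * 4 comes from caps of diameter 2 * 2^n / r, the other factor from the dyadic sum with
    j = 1 and k = 5. *)
Definition sphere_avg_const : R := (864 * (2 `^ 5 / (1 - 2 `^ (1 - 5))))%R.

(** Where |Z| <= 2^n, two unit vectors of [E] are at distance at most 2 * 2^n / r, so this part of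
    [E] has area at most a multiple of (2^n / r)^2. Replacing the square by the first power makes
    the area grow linearly in 2^n, with the factor 1/r that compensates the [r] in front. *)
Lemma sphere_average (E : set (vec3 R)) (Z : vec3 R -> vec3 R) (r : R) :
  measurable E -> measurable_fun setT Z -> (0 < r)%R ->
  (forall s t, E s -> E t -> norm3 s = 1 -> norm3 t = 1 ->
     r * norm3 (s - t : vec3 R) <= norm3 (Z s - Z t : vec3 R))%R ->
  r%:E * \int[sph]_(s in E) (japv (Z s) `^ (- 5))%:E <= sphere_avg_const%:E.
Proof.
move=> mE mZ r0 EZ.
have mz : measurable_fun setT (fun s => norm3 (Z s)) by meas.
have mF (n : nat) : measurable [set s | (norm3 (Z s) <= 2 ^+ n)%R].
  rewrite (_ : [set _ | _] = (fun s => norm3 (Z s)) @^-1` `]-oo, (2 ^+ n)%R]%classic).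
    by rewrite -[_ @^-1` _]setTI; exact: mz.
  by apply/seteqP; split=> x /=; rewrite in_itv.
have c0 : (0 <= 864 / r)%R.
  rewrite divr_ge0 ?ler0n//.
  exact: ltW.
have H := @integral_japr_le _ _ R sph E (fun s => norm3 (Z s)) (864 / r)%R 1%R 5%R mE mz.
rewrite muleC -lee_pdivlMr//.
apply: (le_trans (H _ c0 _ _ _)) => //.
- by move=> s; exact: norm3_ge0.
- by rewrite ltr1n.
- move=> n; rewrite powRr1//.
  have m2n : (1 <= 2 ^+ n :> R)%R by rewrite exprn_ege1// ler1n.
  (* If 2^n <= r, one factor 2^n / r is bounded by 1; otherwise the trivial diameter 2 gives area
     864, and 2^n / r exceeds 1. *)
  have [rn|rn] := leP (2 ^+ n)%R r.
    apply: (@le_trans _ _ (216 * (2 * 2 ^+ n / r) ^+ 2)%:E).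
      apply: sphere_cap; [by rewrite !mulr_ge0 ?invr_ge0 ?exprn_ge0// ltW|exact: measurableI|].
      move=> s t [Es /= sn] [Et /= tn] s1 t1.
      rewrite ler_pdivlMr// mulrC (le_trans (EZ _ _ Es Et s1 t1))//.
      rewrite (le_trans (norm3D _ _))// norm3N; lra.
    rewrite lee_fin (_ : (216 * (2 * 2 ^+ n / r) ^+ 2 = 864 * (2 ^+ n / r) * (2 ^+ n / r)))%R; last by ring.
    rewrite -[leRHS]mulrA [(r^-1 * _)%R]mulrC -[leRHS]mulr1.
    apply: ler_wpM2l; last by rewrite ler_pdivrMr// mul1r.
    by rewrite !mulr_ge0 ?ler0n ?invr_ge0 ?exprn_ge0 ?(ltW r0).
  apply: (@le_trans _ _ (216 * 2 ^+ 2)%:E).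
    apply: sphere_cap => //; first exact: measurableI.
    by move=> s t _ _ s1 t1; rewrite (le_trans (norm3D _ _))// norm3N s1 t1.
  rewrite lee_fin (_ : (216 * 2 ^+ 2 = 864))%R; last by ring.
  rewrite -mulrA -[leLHS]mulr1; apply: ler_wpM2l; first exact: ler0n.
  by rewrite mulrC ler_pdivlMr ?mul1r ?(ltW rn).
- rewrite /sphere_avg_const -EFinM lee_fin.
  by rewrite mulrAC lexx.
Qed.

Lemma measurable_norm3_le (n : R) : measurable [set v : vec3 R | (norm3 v <= n)%R].
Proof.
rewrite (_ : [set _ | _] = (@norm3 R) @^-1` `]-oo, n]%classic).
  by rewrite -[_ @^-1` _]setTI; exact: measurable_norm3.
by apply/seteqP; split=> x /=; rewrite in_itv.
Qed.

Lemma leb3_ball (n : R) : (0 <= n)%R ->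
  leb3 [set v : vec3 R | norm3 v <= n]%R <= (8 * n ^+ 3)%:E.
Proof.
move=> n0; pose I : set mR := `[(0 - n)%R, (0 + n)%R]%classic.
have mI : measurable I by exact: measurable_itv.
have I2 : lebesgue_measure I = (2 * n)%:E.
  by rewrite -(integral_indic_itv 0 n0) integral_indic//= setIT.
have -> : (8 * n ^+ 3)%:E = (2 * n)%:E * (2 * n)%:E * (2 * n)%:E.
  by rewrite -!EFinM; congr EFin; ring.
rewrite -I2.
have -> : lebesgue_measure I * lebesgue_measure I * lebesgue_measure I =
    leb3 (I `*` I `*` I).
  apply/esym; transitivity (leb2 (I `*` I) * lebesgue_measure I).
    by apply: product_measure1E => //; exact: measurableX.
  by congr (_ * _); exact: product_measure1E.
apply: le_measure; rewrite ?inE.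
- exact: measurable_norm3_le.
- by do 2 apply: measurableX => //.
move=> v /= vn; have [v11 v12 v2] := coord3_le v.
have Iv (x : R) : (`|x| <= norm3 v)%R -> I x.
  by rewrite /I /= in_itv /= ler_norml => /andP[? ?]; apply/andP; split; lra.
by split; [split|]; exact: Iv.
Qed.

Lemma japv_integrable (k : R) : (3 < k)%R ->
  \int[leb3]_v (japv v `^ (- k))%:E <= (8 * (2 `^ k / (1 - 2 `^ (3 - k))))%:E.
Proof.
move=> k3.
apply: (@integral_japr_le _ _ R (@leb3 R) setT (@norm3 R)) => //.
- exact: measurable_norm3.
- by move=> v; exact: norm3_ge0.
- lra.
move=> n; rewrite setTI powR_mulrn// (le_trans (leb3_ball _)) ?exprn_ge0//.
by rewrite -!exprM mulnC.
Qed.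

End Caps.

(** * Polar coordinates *)

Section Polar.
Context (R : realType).
Notation mR := (measurableTypeR R).
Notation leb := (@lebesgue_measure R).
Notation sph := (@sphere_measure R).
Notation pb := (@punctured_ball R).
Local Open Scope ereal_scope.
Implicit Types f : vec3 R -> \bar R.

Lemma bcutE (r : R) : bcut r = (0 < r)%R%:R :> R.
Proof.
rewrite /bcut indicE.
by have -> : (r \in [set r : R | 0 < r]%R) = (0 < r)%R by apply/idP/idP; rewrite inE.
Qed.

Lemma leb_scale (t : R) (f : mR -> \bar R) : (0 < t)%R ->
  measurable_fun setT f -> (forall x, 0 <= f x) ->
  \int[leb]_s f s = t%:E * \int[leb]_s f (t * s)%R.
Proof.
move=> t0 mf f0; have t1 : (t != 0)%R by rewrite gt_eqF.
apply/eqP; rewrite eq_le; apply/andP; split.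
  have := @leb_affine R 0%R t^-1 (fun s => f (t * s)%R).
  rewrite invr_eq0 normfV invrK (gtr0_norm t0) => /(_ t1).
  have -> : (fun s => f (t * (0 + t^-1 * s)))%R = f.
    by apply/funext => s; rewrite add0r mulrA mulfV// mul1r.
  by apply; [meas0|nneg].
have := @leb_affine R 0%R t f t1 mf f0; rewrite (gtr0_norm t0).
have -> : (fun s => f (0 + t * s))%R = (fun s => f (t * s))%R.
  by apply/funext => s; rewrite add0r.
by rewrite lee_pdivlMl.
Qed.

Lemma norm3_le0_set : [set v : vec3 R | norm3 v <= 0]%R = [set 0%R].
Proof.
apply/seteqP; split=> v /=; last by move=> ->; rewrite norm3_0.
by move=> v0; apply: norm3_eq0; apply/eqP; rewrite eq_le v0 norm3_ge0.
Qed.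

Lemma leb3_set0 : leb3 [set 0%R : vec3 R] = 0.
Proof.
apply/eqP; rewrite eq_le measure_ge0 andbT -norm3_le0_set.
by rewrite (le_trans (leb3_ball _))// expr0n mulr0.
Qed.

(** The value is 1; positivity and finiteness, proved below, are enough to cancel it from both sides
    of an identity. *)
Definition polar_const : \bar R :=
  3%:E * \int[leb]_u (bcut u * u ^- 4 * \1_([set r : R | (1 <= r)%R]) u)%:E.

(** The integral over the sphere is one over the punctured ball of f (r y / |y|). The substitutions
    r = |y| s, x = s y and s = |x| u turn the density r^2 into u^(-4) and the condition |y| <= 1
    into u >= 1, so that the integral in u separates from that in x. *)
Lemma polar f : measurable_fun setT f -> (forall x, 0 <= f x) ->
  \int[leb]_r ((bcut r * r ^+ 2)%:E * \int[sph]_w f (r *: w)%R) =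
  polar_const * \int[leb3]_x f x.
Proof.
move=> mf f0.
pose ipb : vec3 R -> R := \1_pb.
have mipb : measurable_fun setT ipb.
  by apply: measurable_indic; exact: measurable_punctured_ball.
have ipb0 x : (0 <= ipb x)%R by rewrite /ipb; nneg.
pose i1 : mR -> R := \1_([set r : R | (1 <= r)%R]).
have mi1 : measurable_fun setT i1.
  apply: measurable_indic; rewrite (_ : [set _ | _] = `[1%R, +oo[%classic); first exact: measurable_itv.
  by apply/seteqP; split=> r /=; rewrite in_itv/= andbT.
have i10 x : (0 <= i1 x)%R by rewrite /i1; nneg.
have msn : measurable_fun setT (@direction R) := @measurable_direction R.
transitivity (3%:E * \int[leb]_r \int[leb3]_y
    ((bcut r * r ^+ 2 * ipb y)%:E * f (r *: direction y)%R)).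
  rewrite -ge0_integralZl//; [|meas0|nneg].
  apply: eq_integral => r _.
  have mfr : measurable_fun setT (fun w : vec3 R => f (r *: w)%R) by meas.
  rewrite (sphere_indicE mfr)// muleCA; congr (_ * _).
  rewrite -ge0_integralZl//; [|meas0|nneg|nneg].
  by apply: eq_integral => y _; rewrite muleA EFinM.
rewrite /polar_const -muleA; congr (_ * _).
rewrite tonelli; [|meas0|nneg].
(* Substitution r = |y| s, in the inner integral. *)
transitivity (\int[leb3]_y \int[leb]_s
    ((bcut s * s ^+ 2 * (ipb y * norm3 y ^+ 3))%:E * f (s *: y)%R)).
  apply: eq_integral => y _.
  have [yb|yb] := boolP (y \in pb); last first.
    rewrite [LHS](@eq_integral _ _ _ _ setT (cst 0)); last first.
      by move=> r _; rewrite /ipb indicE (negbTE yb) mulr0 mul0e.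
    rewrite [RHS](@eq_integral _ _ _ _ setT (cst 0))//.
    by move=> r _; rewrite /ipb indicE (negbTE yb) mul0r mulr0 mul0e.
  move: (yb); rewrite inE => /andP[y0 _].
  rewrite [LHS](leb_scale y0); [|meas0|nneg].
  rewrite -ge0_integralZl//; [|meas0|nneg|nneg].
  apply: eq_integral => s _; rewrite muleA -EFinM.
  congr (_%:E * f _).
    have -> : bcut (norm3 y * s)%R = bcut s by rewrite !bcutE pmulr_rgt0.
    by ring.
  by rewrite /direction scalerA mulrAC mulfV ?mul1r// gt_eqF.
rewrite tonelli; [|meas0|nneg].
(* Substitution x = s y: the powers of s are 2 from the density, -3 from the volume and -3 from
   |y|^3. *)
transitivity (\int[leb]_s \int[leb3]_x
   ((bcut s * s ^- 4 * ipb (s^-1 *: x)%R * norm3 x ^+ 3)%:E * f x)).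
  apply: eq_integral => s _.
  have [s0|s0] := ltP 0%R s; last first.
    rewrite [LHS](@eq_integral _ _ _ _ setT (cst 0)); last first.
      by move=> r _; rewrite bcutE ltNge s0 !mul0r mul0e.
    rewrite [RHS](@eq_integral _ _ _ _ setT (cst 0))//.
    by move=> r _; rewrite bcutE ltNge s0 !mul0r mul0e.
  have sn : (s != 0)%R by rewrite gt_eqF.
  pose G x := (bcut s * s ^+ 2 * (ipb (s^-1 *: x)%R * norm3 (s^-1 *: x : vec3 R)%R ^+ 3))%:E * f x.
  have mG : measurable_fun setT G by rewrite /G; meas0.
  have G0 x : 0 <= G x by rewrite /G; nneg.
  transitivity (\int[leb3]_y G (0 + s *: y)%R).
    apply: eq_integral => y _.
    by rewrite /G add0r scalerA mulVf// scale1r.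
  rewrite leb3_affine// (gtr0_norm s0) -ge0_integralZl//; last by rewrite lee_fin exprn_ge0// invr_ge0 ltW.
  apply: eq_integral => x _; rewrite /G muleA -EFinM; congr (_%:E * _).
  rewrite norm3Z normfV (gtr0_norm s0) exprMn -!exprVn.
  by field.
rewrite tonelli; [|meas0|nneg].
rewrite -ge0_integralZl//; last by apply: integral_ge0 => u _; nneg.
apply: ge0_ae_eq_integral => //.
- by meas0.
- by meas0.
- by nneg.
- by move=> x _; apply: mule_ge0 => //; nneg.
(* The last substitution s = |x| u requires x to be nonzero. *)
exists [set 0%R : vec3 R]; split.
- by rewrite -norm3_le0_set; exact: measurable_norm3_le.
- exact: leb3_set0.
move=> y /= ny; apply: contrapT => y0; apply: ny => _.
have {}y0 : (0 < norm3 y)%R by apply: norm3_gt0; apply/eqP.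
have y1 : (norm3 y != 0)%R by rewrite gt_eqF.
rewrite ge0_integralZr//; [|meas0|nneg].
congr (_ * _); rewrite [LHS](leb_scale y0); [|meas0|nneg].
rewrite -ge0_integralZl//; [|meas0|nneg|nneg].
apply: eq_integral => u _; rewrite -EFinM; congr _%:E.
have [u0|u0] := ltP 0%R u; last first.
  by rewrite !bcutE pmulr_rgt0// ltNge u0 !mul0r mulr0.
have un : (u != 0)%R by rewrite gt_eqF.
have -> : bcut (norm3 y * u)%R = bcut u by rewrite !bcutE pmulr_rgt0.
rewrite /ipb !indicE.
have -> : ((norm3 y * u)^-1 *: y \in pb)%R = (u \in [set r : R | (1 <= r)%R]).
  have e : (norm3 ((norm3 y * u)^-1 *: y : vec3 R) = u^-1)%R.
    rewrite norm3Z normfV ger0_norm; last by rewrite mulr_ge0// ltW.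
    by rewrite invfM mulrAC mulVf// mul1r.
  by apply/idP/idP; rewrite !inE /punctured_ball /= e invr_gt0 u0 /= invf_le1.
by field; rewrite un y1.
Qed.

(** On [1, 2], an interval of length 1, the integrand is at least 1/16. *)
Lemma polar_const_gt0 : 0 < polar_const.
Proof.
have h2 : (0 <= 2^-1 :> R)%R by [].
rewrite /polar_const mule_gt0//.
have H : 0 < (2^-1 ^+ 4)%:E * (2 * 2^-1)%:E :> \bar R.
  by rewrite -EFinM lte_fin mulr_gt0.
apply: (lt_le_trans H); rewrite -(integral_indic_itv (3 / 2) h2).
rewrite -ge0_integralZl ?lee_fin ?exprn_ge0//; last first.
  by apply: mfun_EFin; exact: measurable_indic.
apply: ge0_le_integralT => u; first by rewrite lee_fin; nneg.
rewrite -EFinM lee_fin.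
rewrite indicE; case: (boolP (u \in _)) => [|_]; last by rewrite mulr0; nneg.
rewrite inE /= in_itv /= mulr1 => /andP[u1 u2].
have {}u1 : (1 <= u)%R by lra.
have {}u2 : (u <= 2)%R by lra.
rewrite bcutE indicE mem_set//= (lt_le_trans _ u1)// mul1r mulr1.
by rewrite exprVn lef_pV2 ?posrE ?exprn_gt0 ?(lt_le_trans _ u1)// lerXn2r ?nnegrE// (le_trans _ u1).
Qed.

Lemma leb_japr (k : R) : (1 < k)%R ->
  \int[leb]_t (japr t `^ (- k))%:E <= (2 * (2 `^ k / (1 - 2 `^ (1 - k))))%:E.
Proof.
move=> k1.
apply: (@le_trans _ _ (\int[leb]_(t in setT) (japr `|t| `^ (- k))%:E)).
  by apply: ge0_le_integralT => t; [nneg|rewrite /japr real_normK ?num_real].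
apply: (@integral_japr_le _ _ R leb setT (fun t => `|t|%R)) => //.
- by apply: mfun_norm.
- by rewrite ltW// (lt_trans _ k1).
move=> n; rewrite setTI powRr1//.
have n0 : (0 <= 2 ^+ n :> R)%R by rewrite exprn_ge0.
rewrite -(integral_indic_itv 0 n0) integral_indic//= setIT.
rewrite le_eqVlt; apply/orP; left; apply/eqP; congr (leb _).
by apply/seteqP; split=> x /=; rewrite in_itv/= ler_norml sub0r add0r.
Qed.

(** For u >= 1 one has 1 + u^2 <= 2 u^2, so u^(-4) is at most 4 times the fourth negative power of
    the Japanese bracket. *)
Lemma polar_const_fin : polar_const < +oo.
Proof.
rewrite /polar_const lte_mul_pinfty//.
have k4 : (1 < 4 :> R)%R by rewrite ltr1n.
apply: (@le_lt_trans _ _ (4%:E * \int[leb]_t (japr t `^ (- 4))%:E)); last first.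
  by rewrite (le_lt_trans (lee_wpmul2l _ (leb_japr k4)))// -EFinM ltry.
rewrite -ge0_integralZl//; last 2 first.
- by apply: mfun_EFin; apply: mfun_powR; rewrite /japr; meas.
- by nneg.
apply: ge0_le_integralT => u; first by rewrite lee_fin; nneg.
rewrite -EFinM lee_fin indicE; case: (boolP (u \in _)) => [|_]; last by rewrite mulr0; nneg.
rewrite inE /= => u1; rewrite mulr1 bcutE (lt_le_trans _ u1)// mul1r.
rewrite powRN powR_mulrn ?(ltW (japr_gt0 _))//.
rewrite ler_pdivlMr ?exprn_gt0 ?japr_gt0//.
have u4 : (0 < u ^+ 4)%R by rewrite exprn_gt0// (lt_le_trans _ u1).
rewrite mulrC ler_pdivrMr// (_ : 4 = 2 * 2)%N// !exprM /japr sqr_sqrtr ?addr_ge0 ?sqr_ge0//.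
rewrite (_ : 4%:R * (u ^+ 2) ^+ 2 = (2 * u ^+ 2) ^+ 2)%R; last by ring.
have u2 : (1 <= u ^+ 2)%R by rewrite exprn_ege1.
by rewrite lerXn2r ?nnegrE ?addr_ge0 ?mulr_ge0 ?sqr_ge0//; lra.
Qed.

End Polar.

(** * The collision form *)

Section CollisionIntegral.
Context (R : realType).
Notation mR := (measurableTypeR R).
Notation V := (vec3 R).
Notation leb := (@lebesgue_measure R).
Notation sph := (@sphere_measure R).
Local Open Scope ereal_scope.
Implicit Types Phi : V * V * V * V -> \bar R.

Definition coll_kernel (v v1 s : V) : R := (norm3 (v - v1 : V) * bcut (dot3 (v - v1 : V) s))%R.

(** The weak form: the collision kernel integrated against a function of the quadruple v, v_1, v^*,
    v_1^*. Its values are nonnegative extended reals, so Tonelli's theorem applies without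
    integrability. *)
Definition coll_form Phi : \bar R :=
  \int[leb3]_v \int[leb3]_v1 \int[sph]_s
    ((coll_kernel v v1 s)%:E * Phi (v, v1, vpost v v1 s, vpost1 v v1 s)).

Lemma bcut_ge0 (r : R) : (0 <= bcut r)%R.
Proof. by rewrite bcutE ler0n. Qed.

Lemma coll_kernel_ge0 v v1 s : (0 <= coll_kernel v v1 s)%R.
Proof. by rewrite mulr_ge0 ?norm3_ge0 ?bcut_ge0. Qed.

Definition swap_pair (p : V * V * V * V) : V * V * V * V :=
  (p.1.1.2, p.1.1.1, p.2, p.1.2).
Definition swap_post (p : V * V * V * V) : V * V * V * V :=
  (p.1.2, p.2, p.1.1.1, p.1.1.2).

(** Relabelling v and v_1 and replacing sigma by its opposite leaves the kernel unchanged and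
    exchanges the two post-collisional velocities. *)
Lemma coll_form_swap_pair Phi : measurable_fun setT Phi ->
  (forall p, 0 <= Phi p) -> coll_form (Phi \o swap_pair) = coll_form Phi.
Proof.
move=> mP P0; rewrite /coll_form /coll_kernel /vpost /vpost1 /swap_pair /=.
rewrite [RHS]tonelli; [|meas0|nneg].
apply: eq_integral => v _; apply: eq_integral => v1 _.
rewrite -[RHS]sphere_opp; [|meas0|nneg].
apply: eq_integral => s _.
rewrite (norm3B v1 v) -[in RHS](opprB v v1) dot3Nl dot3Nr opprK.
by rewrite !scalerN opprK (addrC v1 v).
Qed.

Lemma muleI_fin (k x y : \bar R) : k \is a fin_num -> 0 < k ->
  k * x = k * y -> x = y.
Proof.
move=> kf k0 E; apply/eqP; rewrite eq_le.
by apply/andP; split; rewrite -(lee_pmul2l kf k0) E.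
Qed.

(** The quadruple written with v_1 = v - r w and |w| = 1; the factor |r| is |v - v_1|. The weight is
    symmetric in w and s. *)
Definition polar_integrand Phi (p : V * mR * V * V) : \bar R :=
  let: (v, r, w, s) := p in
  (bcut r * r ^+ 2 * `|r| * bcut (dot3 w s))%:E *
     Phi (v, v - r *: w, v - (r / 2) *: (w - s : V), v - (r / 2) *: (w + s : V))%R.

Lemma polar_integrand_ge0 Phi : (forall p, 0 <= Phi p) ->
  forall p, 0 <= polar_integrand Phi p.
Proof.
by move=> P0 [[[v r] w] s]; apply: mule_ge0 => //; nneg.
Qed.

Lemma measurable_polar_integrand Phi : measurable_fun setT Phi ->
  measurable_fun setT (polar_integrand Phi).
Proof.
move=> mP; rewrite (_ : polar_integrand Phi = fun p =>
  (bcut p.1.1.2 * p.1.1.2 ^+ 2 * `|p.1.1.2| * bcut (dot3 p.1.2 p.2))%:E *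
     Phi (p.1.1.1, p.1.1.1 - p.1.1.2 *: p.1.2,
     p.1.1.1 - (p.1.1.2 / 2) *: (p.1.2 - p.2 : V),
     p.1.1.1 - (p.1.1.2 / 2) *: (p.1.2 + p.2 : V))%R).
  by meas.
by apply/funext => -[[[v r] w] s].
Qed.

(** The integral in v is placed innermost, so that v can be translated by a vector depending on r, w
    and s. *)
Lemma coll_form_polar Phi : measurable_fun setT Phi -> (forall p, 0 <= Phi p) ->
  polar_const R * coll_form Phi =
  \int[leb]_r \int[sph]_w \int[sph]_s \int[leb3]_v polar_integrand Phi (v, r, w, s).
Proof.
move=> mP P0; set H := polar_integrand Phi.
have H0 : forall p, 0 <= H p := polar_integrand_ge0 P0.
have mH : measurable_fun setT H := measurable_polar_integrand mP.
pose g (p : V * V) := \int[sph]_s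
    ((coll_kernel p.1 p.2 s)%:E * Phi (p.1, p.2, vpost p.1 p.2 s, vpost1 p.1 p.2 s)).
have g0 p : 0 <= g p.
  by apply: integral_ge0 => s _; rewrite mule_ge0// lee_fin coll_kernel_ge0.
have mg : measurable_fun setT g.
  by rewrite /g /coll_kernel; meas0.
transitivity (\int[leb3]_v \int[leb]_r \int[sph]_w \int[sph]_s H (v, r, w, s)); last first.
  rewrite [LHS]tonelli; [|meas0|nneg].
  apply: eq_integral => r _.
  rewrite [LHS]tonelli; [|meas0|nneg].
  apply: eq_integral => w _.
  by rewrite [LHS]tonelli; [|meas0|nneg].
have -> : coll_form Phi = \int[leb3]_v \int[leb3]_v1 g (v, v1) by [].
rewrite -[LHS]ge0_integralZl//; [|meas0|nneg|exact/ltW/polar_const_gt0].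
apply: eq_integral => v _.
rewrite -(leb3_subl v); [|meas0|nneg].
rewrite -polar; [|meas0|nneg].
apply: eq_integral => r _.
have [r0|r0] := ltP 0%R r; last first.
  rewrite bcutE ltNge r0 mul0r mul0e; apply/esym.
  rewrite (@eq_integral _ _ _ _ setT (cst 0)) ?integral0// => w _.
  rewrite (@eq_integral _ _ _ _ setT (cst 0)) ?integral0// => s _.
  by rewrite /H /polar_integrand bcutE ltNge r0 !mul0r mul0e.
rewrite -[LHS]ge0_integralZl//; [|meas0|nneg].
apply: eq_integral_sphere; [meas0|meas0|nneg|nneg|] => w w1.
rewrite /g /= -[LHS]ge0_integralZl//; [|rewrite /coll_kernel; meas0|
  by move=> s _; rewrite mule_ge0// lee_fin coll_kernel_ge0|nneg].
apply: eq_integral => s _; rewrite /H /polar_integrand muleA -EFinM.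
have nr : norm3 (v - (v - r *: w) : V)%R = r.
  by rewrite opprB addrC subrK norm3Z w1 mulr1 gtr0_norm.
congr (_%:E * Phi _).
- rewrite /coll_kernel nr opprB addrC subrK dot3Zl gtr0_norm//.
  by rewrite !bcutE pmulr_rgt0// mulrA.
- rewrite /vpost /vpost1 nr.
  have e1 : (2^-1 *: (v + (v - r *: w)) + r / 2 *: s = v - r / 2 *: (w - s) :> V)%R.
    by vec3_field.
  have e2 : (2^-1 *: (v + (v - r *: w)) - r / 2 *: s = v - r / 2 *: (w + s) :> V)%R.
    by vec3_field.
  by rewrite e1 e2.
Qed.

(** In polar form, exchanging w and s and translating v by (r/2)(s - w) carries v, v_1, v^*, v_1^*
    to v^*, v_1^*, v, v_1; translation and Tonelli's theorem replace the Jacobian of the collision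
    map. *)
Lemma coll_form_swap_post Phi : measurable_fun setT Phi ->
  (forall p, 0 <= Phi p) -> coll_form (Phi \o swap_post) = coll_form Phi.
Proof.
move=> mP P0.
have mP' : measurable_fun setT (Phi \o swap_post).
  by rewrite /comp /swap_post; meas.
have P0' p : 0 <= (Phi \o swap_post) p by exact: P0.
have cf : polar_const R \is a fin_num.
  by rewrite ge0_fin_numE ?polar_const_fin// ltW// polar_const_gt0.
apply: (muleI_fin cf (polar_const_gt0 R)).
rewrite [LHS](coll_form_polar mP' P0') [RHS](coll_form_polar mP P0).
have H0 : forall p, 0 <= polar_integrand Phi p := polar_integrand_ge0 P0.
have mH : measurable_fun setT (polar_integrand Phi) := measurable_polar_integrand mP.
apply: eq_integral => r _.
rewrite [RHS]tonelli; [|meas0|nneg].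
apply: eq_integral => w _; apply: eq_integral => s _.
rewrite -[RHS](@leb3_shift _ ((r / 2) *: (s - w : V))%R); [|meas0|nneg].
apply: eq_integral => v _; rewrite /polar_integrand dot3C /swap_post /=.
congr (_ * Phi _).
by congr (_, _, _, _); vec3_field.
Qed.

End CollisionIntegral.

(** * Trading v_1 for v_1^* at fixed sigma *)

Section Fold.
Context (R : realType).
Notation mR := (measurableTypeR R).
Notation V := (vec3 R).
Notation leb := (@lebesgue_measure R).
Notation sph := (@sphere_measure R).
Local Open Scope ereal_scope.

(* [fold s z] is [v - v_1^*] as a function of [z = v - v_1]. *)
Definition fold (s z : V) : V := (2^-1 *: (z + norm3 z *: s : V))%R.

Lemma measurable_fold d (T : measurableType d) (s z : T -> V) :
  measurable_fun setT s -> measurable_fun setT z ->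
  measurable_fun setT (fun x => fold (s x) (z x)).
Proof. by move=> ms mz; rewrite /fold; meas. Qed.

Lemma integral_bcut (h : mR -> R) (f : mR -> \bar R) : measurable_fun setT h ->
  \int[leb]_t ((bcut (h t))%:E * f t) = \int[leb]_(t in [set t | (0 < h t)%R]) f t.
Proof.
move=> mh; rewrite [RHS]integral_mkcond; apply: eq_integral => t _.
rewrite patchE bcutE.
have -> : (t \in [set t | (0 < h t)%R]) = (0 < h t)%R by apply/idP/idP; rewrite inE.
by case: (0 < h t)%R; rewrite ?mul1e ?mul0e.
Qed.

(** The squared norm grows by 2 k (z'.s) + k^2 |s|^2. *)
Lemma norm3_along (s z z' : V) (k : R) : (0 <= k)%R -> (z = z' + k *: s)%R ->
  (0 < dot3 z' s)%R -> (norm3 z' <= norm3 z)%R.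
Proof.
move=> k0 -> zs; rewrite -(@ler_pXn2r _ 2) ?nnegrE ?norm3_ge0// !norm3_sqr.
rewrite dot3Dl !dot3Dr !dot3Zl !dot3Zr (dot3C s z').
have := dot3_ge0 s; have := mulr_ge0 k0 (ltW zs); have : (0 <= k * k)%R by rewrite mulr_ge0.
move=> h1 h2 h3; have := mulr_ge0 h1 h3; lra.
Qed.

(* Along a line of direction [s], the norm increases as long as the scalar
   product with [s] is positive, so that [fold s] expands by [1/2]. *)
Lemma fold_expanding (s a b : V) (t u : R) : s.2 != 0%R ->
  a = (b + (t - u) / s.2 *: s)%R -> (a.2 = t)%R -> (b.2 = u)%R ->
  (0 < dot3 a s)%R -> (0 < dot3 b s)%R ->
  (2^-1 * `|t - u| <= `|(fold s a).2 - (fold s b).2|)%R.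
Proof.
move=> s3 ab a2 b2 da db.
have -> : ((fold s a).2 - (fold s b).2 = 2^-1 * ((t - u) + s.2 * (norm3 a - norm3 b)))%R.
  by rewrite /fold !(coordZE, coordDE) a2 b2; ring.
rewrite normrM (ger0_norm (_ : 0 <= 2^-1)%R)// ler_wpM2l//.
have {}key (x y : R) : (0 <= x * y)%R -> (`|x| <= `|x + y|)%R.
  move=> xy; rewrite -(@ler_pXn2r _ 2) ?nnegrE// !real_normK ?num_real// sqrrD.
  by have := sqr_ge0 y; rewrite mulr2n; lra.
apply: key.
have [k0|k0] := leP 0%R ((t - u) / s.2)%R.
  have na : (norm3 b <= norm3 a)%R by exact: norm3_along k0 ab db.
  have -> : ((t - u) * (s.2 * (norm3 a - norm3 b)) =
      ((t - u) / s.2) * s.2 ^+ 2 * (norm3 a - norm3 b))%R by field.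
  by apply: mulr_ge0; [apply: mulr_ge0 => //; exact: sqr_ge0|rewrite subr_ge0].
have ba : (b = a + (u - t) / s.2 *: s)%R.
  rewrite ab -addrA -scalerDl -mulrDl (_ : t - u + (u - t) = 0)%R; last by ring.
  by rewrite mul0r scale0r addr0.
have k0' : (0 <= (u - t) / s.2)%R by move: k0; rewrite -(opprB u t) mulNr oppr_lt0 => /ltW.
have na : (norm3 a <= norm3 b)%R by exact: norm3_along k0' ba da.
have -> : ((t - u) * (s.2 * (norm3 a - norm3 b)) =
    ((u - t) / s.2) * s.2 ^+ 2 * (norm3 b - norm3 a))%R by field.
by apply: mulr_ge0; [apply: mulr_ge0 => //; exact: sqr_ge0|rewrite subr_ge0].
Qed.

Lemma leb_shift (a : R) (f : mR -> \bar R) : measurable_fun setT f ->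
  (forall x, 0 <= f x) -> \int[leb]_x f (x - a)%R <= \int[leb]_x f x.
Proof.
move=> mf f0; have := @leb_affine R (- a)%R 1%R f (oner_neq0 _) mf f0.
rewrite normr1 invr1 mul1e; apply: le_trans; rewrite le_eqVlt; apply/orP; left; apply/eqP.
by apply: eq_integral => x _; rewrite mul1r addrC.
Qed.

Lemma leb_half (a : R) (f : mR -> \bar R) : measurable_fun setT f ->
  (forall x, 0 <= f x) -> \int[leb]_x f (2^-1 * x + a)%R <= 2%:E * \int[leb]_x f x.
Proof.
move=> mf f0; have h : (2^-1 != 0 :> R)%R by rewrite invr_eq0.
have := @leb_affine R a 2^-1%R f h mf f0.
rewrite ger0_norm// invrK; apply: le_trans; rewrite le_eqVlt; apply/orP; left; apply/eqP.
by apply: eq_integral => x _; rewrite addrC.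
Qed.

(** On a line of direction [s], the first two coordinates of [fold s] are affine functions of the
    third. The third expands by 1/2 along the line, which costs 2, and halving each of the other two
    coordinates costs 2 again. *)
Lemma integral_fold3 (s : V) (f : V -> \bar R) : s.2 != 0%R ->
  measurable_fun setT f -> (forall x, 0 <= f x) ->
  \int[leb3]_z ((bcut (dot3 z s))%:E * f (fold s z)) <= 8%:E * \int[leb3]_z f z.
Proof.
move=> s3 mf f0.
pose c1 := (s.1.1 / s.2)%R; pose c2 := (s.1.2 / s.2)%R.
(* A shear that makes the third coordinate run along lines of direction [s]. *)
pose up (p : V) : V := (p.1.1 + p.2 * c1, p.1.2 + p.2 * c2, p.2)%R.
have mup : measurable_fun setT up by rewrite /up; meas.
have mfold : measurable_fun setT (fold s).
  by apply: measurable_fold; meas.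
pose G (p : V) := (bcut (dot3 (up p) s))%:E * f (fold s (up p)).
have mG : measurable_fun setT G by rewrite /G; meas0.
have G0 p : 0 <= G p by rewrite /G; nneg.
(* On the line through (x, y, 0), the image under [fold s] is (x/2 + c1 t, y/2 + c2 t, t), with t
   its third coordinate. *)
pose F (p : V) := f (2^-1 * p.1.1 + p.2 * c1, 2^-1 * p.1.2 + p.2 * c2, p.2)%R.
have mF : measurable_fun setT F by rewrite /F; meas.
have F0 p : 0 <= F p by rewrite /F.
have step1 : \int[leb3]_z ((bcut (dot3 z s))%:E * f (fold s z)) <= \int[leb3]_p G p.
  have mz : measurable_fun setT (fun z => (bcut (dot3 z s))%:E * f (fold s z)) by meas0.
  rewrite (leb3_zyx mz); last by nneg.
  rewrite (leb3_zyx mG G0).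
  apply: ge0_le_integralT => z; first nneg.
  apply: (@le_trans _ _ (\int[leb]_y \int[leb]_x G (x, y - z * c2, z)%R)).
    apply: ge0_le_integralT => y; first nneg.
    have := @leb_shift (z * c1)%R (fun x => G (x, y - z * c2, z))%R.
    move=> /(_ ltac:(meas) (fun x => G0 _)); apply: le_trans.
    apply: ge0_le_integralT => x; first nneg.
    by rewrite /G /up /= !subrK.
  have := @leb_shift (z * c2)%R (fun y => \int[leb]_x G (x, y, z)).
  by apply; [meas0|nneg].
apply: (le_trans step1).
have step2 : \int[leb3]_p G p <= 2%:E * \int[leb3]_p F p.
  rewrite (leb3_xyz mG G0) (leb3_xyz mF F0).
  rewrite -ge0_integralZl//; [|meas0|nneg].
  apply: ge0_le_integralT => x; first nneg.
  rewrite -ge0_integralZl//; [|meas0|nneg].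
  apply: ge0_le_integralT => y; first nneg.
  have mh : measurable_fun setT (fun t : mR => dot3 (up (x, y, t)) s) by meas.
  rewrite (_ : \int[leb]_z G (x, y, z) = \int[leb]_t ((bcut (dot3 (up (x, y, t)) s))%:E *
    F (x, y, (fold s (up (x, y, t))).2))); last first.
    apply: eq_integral => t _; rewrite /G /F; congr (_ * f _).
    by apply: vec3_eq; rewrite /fold /up !(coordZE, coordDE) /c1 /c2 /=; field.
  rewrite (integral_bcut _ mh).
  have := @ge0_integral_expanding R [set t | (0 < dot3 (up (x, y, t)) s)%R]
    (fun t => (fold s (up (x, y, t))).2) 2^-1%R (fun t => F (x, y, t)).
  rewrite invrK; apply => //.
  - rewrite (_ : [set _ | _] = (fun t : mR => dot3 (up (x, y, t)) s) @^-1` `]0%R, +oo[%classic).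
      by rewrite -[_ @^-1` _]setTI; exact: mh.
    by apply/seteqP; split=> r /=; rewrite in_itv/= andbT.
  - by meas.
  - move=> t u ht hu; apply: (@fold_expanding s (up (x, y, t)) (up (x, y, u))) => //.
    by apply: vec3_eq; rewrite /up !(coordZE, coordDE) /c1 /c2 /=; field.
  - by meas.
apply: (le_trans step2).
rewrite (_ : 8%:E = 2%:E * 4%:E :> \bar R); last by rewrite -EFinM; congr EFin; ring.
rewrite -muleA; apply: lee_wpmul2l => //.
rewrite (leb3_zyx mF F0) (leb3_zyx mf f0).
rewrite -ge0_integralZl//; [|meas0|nneg].
apply: ge0_le_integralT => z; first nneg.
rewrite (_ : 4%:E = 2%:E * 2%:E :> \bar R); last by rewrite -EFinM; congr EFin; ring.
rewrite -muleA.
apply: (@le_trans _ _ (\int[leb]_y (2%:E * \int[leb]_x f (x, 2^-1 * y + z * c2, z)%R))).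
  apply: ge0_le_integralT => y; first nneg.
  have := @leb_half (z * c1)%R (fun x => f (x, 2^-1 * y + z * c2, z))%R.
  by apply; [meas0|nneg].
rewrite ge0_integralZl//; [|meas0|nneg].
apply: lee_wpmul2l => //.
have := @leb_half (z * c2)%R (fun y => \int[leb]_x f (x, y, z)).
by apply; [meas0|nneg].
Qed.

(** A unit vector has a nonzero coordinate, and a permutation, which preserves norms and scalar
    products, makes it the third. The constant does not depend on [s]. *)
Lemma integral_fold (s : V) (f : V -> \bar R) : norm3 s = 1%R ->
  measurable_fun setT f -> (forall x, 0 <= f x) ->
  \int[leb3]_z ((bcut (dot3 z s))%:E * f (fold s z)) <= 8%:E * \int[leb3]_z f z.
Proof.
move=> s1 mf f0.
have nz (x : R) : (2^-1 <= `|x| -> x != 0)%R.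
  by move=> x2; rewrite -normr_gt0; lra.
have mfold : measurable_fun setT (fold s) by apply: measurable_fold; meas.
have mz : measurable_fun setT (fun z => (bcut (dot3 z s))%:E * f (fold s z)) by meas0.
have z0 z : 0 <= (bcut (dot3 z s))%:E * f (fold s z) by nneg.
case: (unit3_coord s1) => /nz si.
- pose sw (p : V) : V := ((p.2, p.1.2), p.1.1).
  have mfs : measurable_fun setT (fun p => f (sw p)) by rewrite /sw; meas.
  have nsw p : norm3 (sw p) = norm3 p.
    by rewrite /norm3 /dot3 /sw /=; congr Num.sqrt; ring.
  rewrite -(leb3_swap13 mz z0) -(leb3_swap13 mf f0).
  have := @integral_fold3 (sw s) (fun p => f (sw p)) si mfs (fun p => f0 _).
  apply: le_trans; rewrite le_eqVlt; apply/orP; left; apply/eqP.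
  apply: eq_integral => z _; rewrite -/(sw z); congr ((bcut _)%:E * f _).
    by rewrite /dot3 /sw /=; ring.
  by rewrite /fold nsw.
- pose sw (p : V) : V := ((p.1.1, p.2), p.1.2).
  have mfs : measurable_fun setT (fun p => f (sw p)) by rewrite /sw; meas.
  have nsw p : norm3 (sw p) = norm3 p.
    by rewrite /norm3 /dot3 /sw /=; congr Num.sqrt; ring.
  rewrite -(leb3_swap23 mz z0) -(leb3_swap23 mf f0).
  have := @integral_fold3 (sw s) (fun p => f (sw p)) si mfs (fun p => f0 _).
  apply: le_trans; rewrite le_eqVlt; apply/orP; left; apply/eqP.
  apply: eq_integral => z _; rewrite -/(sw z); congr ((bcut _)%:E * f _).
    by rewrite /dot3 /sw /=; ring.
  by rewrite /fold nsw.
- exact: integral_fold3.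
Qed.

End Fold.

(** * Weighted averages of the collision kernel *)

Section Trilinear.
Context (R : realType).
Notation V := (vec3 R).
Notation sph := (@sphere_measure R).
Local Open Scope ereal_scope.
Implicit Types (f g h d a b : V -> \bar R) (v q s : V).

(** For M > 8 it dominates the power -M of the same bracket; the exponent 5 exceeds 1, as the
    convergence of the dyadic sum on the sphere requires. *)
Definition weight (v : V) : \bar R := (japv v `^ (- 5))%:E.

Lemma weight_ge0 v : 0 <= weight v.
Proof. by rewrite lee_fin powR_ge0. Qed.

Lemma measurable_weight : measurable_fun setT weight.
Proof. by rewrite /weight; meas. Qed.

Let C := sphere_avg_const R.

Lemma sphere_avg_const_ge0 : (0 <= C)%R.
Proof.
rewrite /C /sphere_avg_const; apply: mulr_ge0; first exact: ler0n.
apply: mulr_ge0; first exact: powR_ge0.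
rewrite invr_ge0 subr_ge0; have h2 : (1 <= 2 :> R)%R by rewrite ler1n.
have := @ler_powR R 2 h2 (1 - 5)%R 0%R; rewrite powRr0; apply.
by rewrite subr_le0 ler1n.
Qed.

(** With r = |v - v_1|, the map from sigma to v_1^* expands by exactly r/2; the average absorbs r/2,
    and the remaining factor is 2. *)
Lemma kernel_average v v1 :
  \int[sph]_s ((coll_kernel v v1 s)%:E * weight (vpost1 v v1 s)) <= (2 * C)%:E.
Proof.
have C0 := sphere_avg_const_ge0.
have mw := measurable_weight; have w0 := weight_ge0.
have mz : measurable_fun setT (fun s => vpost1 v v1 s) by meas.
set r := norm3 (v - v1 : V)%R.
apply: (@le_trans _ _ (\int[sph]_s (r%:E * weight (vpost1 v v1 s)))).
  apply: ge0_le_integralT => s; first by rewrite mule_ge0// lee_fin coll_kernel_ge0.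
  apply: lee_wpmul2r => //; rewrite lee_fin /coll_kernel -/r bcutE.
  by case: ltP => _; rewrite ?mulr1// mulr0 norm3_ge0.
rewrite intZl; [|meas0|exact: (fun s => w0 _)|exact: norm3_ge0].
have [r0|r0] := leP r 0%R.
  have -> : r = 0%R by apply/eqP; rewrite eq_le r0 norm3_ge0.
  by rewrite mul0e lee_fin mulr_ge0.
have r2 : (0 < r / 2)%R by rewrite divr_gt0.
have := @sphere_average R setT (vpost1 v v1) (r / 2) measurableT mz r2.
move=> H; rewrite (_ : r = 2 * (r / 2))%R; last by field.
rewrite !EFinM -muleA; apply: lee_wpmul2l => //; apply: H.
move=> s t _ _ _ _; rewrite /vpost1 -/r.
have -> : (2^-1 *: (v + v1) - r / 2 *: s - (2^-1 *: (v + v1) - r / 2 *: t) =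
  (- (r / 2)) *: (s - t) :> V)%R by vec3_field.
by rewrite norm3Z normrN ger0_norm// ltW.
Qed.

(* [unfold v s q] is the velocity [v_1] for which [v - v_1^* = q]. *)
Definition unfold v s q : V := (v - (2 *: q - (norm3 q ^+ 2 / dot3 q s) *: s))%R.

(** Up to a constant vector, [unfold v s q] is |q| times s dilated by |q| / (q.s), which is at least
    1 where q.s > 0; by [norm3_dilate] the map expands by |q| there. *)
Lemma unfold_average v q :
  \int[sph]_s ((bcut (dot3 q s) * norm3 q)%:E * weight (unfold v s q)) <= C%:E.
Proof.
have C0 := sphere_avg_const_ge0.
have mw := measurable_weight; have w0 := weight_ge0.
have mz : measurable_fun setT (fun s => unfold v s q) by rewrite /unfold; meas.
have [->|q0] := eqVneq q 0%R.
  rewrite (@eq_integral _ _ _ _ setT (cst 0)) ?integral0 ?lee_fin// => s _.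
  by rewrite norm3_0 mulr0 mul0e.
have {}q0 := norm3_gt0 q0.
have mE : measurable [set s | (0 < dot3 q s)%R].
  rewrite (_ : [set _ | _] = (fun s : V => dot3 q s) @^-1` `]0%R, +oo[%classic).
    by rewrite -[_ @^-1` _]setTI; have: measurable_fun setT (fun s : V => dot3 q s) by [meas]; apply.
  by apply/seteqP; split=> r /=; rewrite in_itv/= andbT.
have := @sphere_average R [set s | (0 < dot3 q s)%R] (fun s => unfold v s q) (norm3 q) mE mz q0.
move=> H; apply: le_trans (H _); last first.
  move=> s t /= qs qt s1 t1; rewrite /unfold.
  set k := (norm3 q ^+ 2 / dot3 q s)%R; set l := (norm3 q ^+ 2 / dot3 q t)%R.
  have -> : (v - (2 *: q - k *: s) - (v - (2 *: q - l *: t)) =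
    norm3 q *: ((norm3 q / dot3 q s) *: s - (norm3 q / dot3 q t) *: t) :> V)%R.
    by rewrite /k /l; apply: vec3_eq; rewrite ?(coordDE, coordNE, coordZE); field;
      rewrite !gt_eqF.
  rewrite norm3Z ger0_norm ?norm3_ge0// ler_wpM2l ?norm3_ge0// norm3_dilate//.
    by rewrite ler_pdivlMr// mul1r (le_trans (dot3_le _ _))// s1 mulr1.
  by rewrite ler_pdivlMr// mul1r (le_trans (dot3_le _ _))// t1 mulr1.
rewrite [X in _ <= _ * X]integral_mkcond -[leRHS]intZl; last 3 first.
- apply/measurable_restrict => //; apply: measurable_funTS.
  exact: measurableT_comp mw mz.
- by move=> s; rewrite patchE; case: ifP => // _; exact: w0.
- by nneg.
 apply: ge0_le_integralT => s.
  by rewrite mule_ge0// lee_fin mulr_ge0 ?norm3_ge0 ?bcut_ge0.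
rewrite patchE bcutE.
have -> : (s \in [set s | (0 < dot3 q s)%R]) = (0 < dot3 q s)%R by apply/idP/idP; rewrite inE.
by case: (0 < dot3 q s)%R; rewrite ?mul1r// mul0r mul0e mule0.
Qed.

(** For q = [fold s z] one finds |q|^2 = |z| (q.s), so the coefficient of s in [unfold] is |z| and 2
    q - |z| s = z. *)
Lemma unfoldK v s z : norm3 s = 1%R -> (0 < dot3 z s)%R ->
  [/\ (0 < dot3 (fold s z) s)%R, (norm3 z <= 2 * norm3 (fold s z))%R &
      unfold v s (fold s z) = (v - z)%R].
Proof.
move=> s1 zs; rewrite /fold; set q := (_ *: _)%R.
have z0 : (0 < norm3 z)%R.
  rewrite ltNge; apply/negP => z0; suff z00 : z = 0%R.
    by move: zs; rewrite z00 -(scale0r (0 : V)%R) dot3Zl mul0r ltxx.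
  by apply: norm3_eq0; apply/eqP; rewrite eq_le z0 norm3_ge0.
have qs : (dot3 q s = 2^-1 * (dot3 z s + norm3 z))%R.
  by rewrite /q dot3Zl dot3Dl dot3Zl -norm3_sqr s1 expr1n mulr1.
have qs0 : (0 < dot3 q s)%R by rewrite qs mulr_gt0// addr_gt0.
have q2 : (norm3 q ^+ 2 = norm3 z * dot3 q s)%R.
  rewrite qs norm3_sqr /q dot3Zl dot3Zr dot3Dl !dot3Dr !dot3Zl !dot3Zr (dot3C s z).
  by rewrite -!norm3_sqr s1; field.
split=> //.
  rewrite -(@ler_pXn2r _ 2) ?nnegrE ?mulr_ge0 ?norm3_ge0// exprMn q2 qs.
  have := mulr_gt0 z0 zs; have := mulr_gt0 z0 z0; lra.
rewrite /unfold q2 mulfK ?gt_eqF//; congr (_ - _)%R.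
by rewrite /q; vec3_field.
Qed.

(** The variable becomes q = v - v_1^* at fixed sigma, at the cost of 8 for the change of variable
    and 2 for |v - v_1| <= 2 |q|. At fixed q the weight is then averaged over sigma, which absorbs
    |q| and leaves the integral of [h]. *)
Lemma far_kernel_average v h : measurable_fun setT h -> (forall x, 0 <= h x) ->
  \int[leb3]_v1 \int[sph]_s ((coll_kernel v v1 s)%:E *
     (weight v1 * h (vpost1 v v1 s))) <= (16 * C)%:E * \int[leb3]_x h x.
Proof.
move=> mh h0.
have C0 := sphere_avg_const_ge0.
have mw := measurable_weight; have w0 := weight_ge0.
rewrite -(leb3_subl v); last 2 first.
- by rewrite /coll_kernel; meas; nneg.
- by rewrite /coll_kernel; nneg.
rewrite tonelli; last 2 first.
- by rewrite /coll_kernel; meas; nneg.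
- by rewrite /coll_kernel; nneg.
pose phi s q := (bcut (dot3 q s) * norm3 q)%:E * weight (unfold v s q) * h (v - q)%R.
have mphi : measurable_fun setT (fun p : V * V => phi p.1 p.2).
  by rewrite /phi /unfold; meas.
have phi0 s q : 0 <= phi s q.
  by rewrite /phi; apply: mule_ge0 => //; apply: mule_ge0 => //; nneg.
have mfoldu (s : V) : measurable_fun setT (fold s) by apply: measurable_fold; meas.
apply: (@le_trans _ _ (\int[sph]_s (16%:E * \int[leb3]_q phi s q))).
  apply: le_integral_sphere.
  - by rewrite /coll_kernel; meas; nneg.
  - by meas; nneg.
  - by rewrite /coll_kernel; nneg.
  - by move=> s; apply: mule_ge0 => //; apply: integral_ge0.
  move=> s s1.
  have mps : measurable_fun setT (fun q => 2%:E * phi s q) by rewrite /phi /unfold; meas.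
  have ps0 q : 0 <= 2%:E * phi s q by rewrite mule_ge0.
  have := integral_fold s1 mps ps0.
  rewrite intZl; [|rewrite /phi /unfold; meas|exact: phi0|by []].
  rewrite muleA -EFinM (_ : 8 * 2 = 16)%R; last by ring.
  apply: le_trans; apply: ge0_le_integralT => z; first by rewrite /coll_kernel; nneg.
  have e : (v - (v - z) = z)%R by rewrite opprB addrC subrK.
  have [zs|zs] := ltP 0%R (dot3 z s); last first.
    by rewrite /coll_kernel e !bcutE ltNge zs mulr0 !mul0e.
  have [fs zf uz] := unfoldK v s1 zs.
  have vf : (v - fold s z = vpost1 v (v - z) s)%R.
    by rewrite /fold /vpost1 e; vec3_field.
  rewrite /phi uz vf /coll_kernel e !bcutE zs fs !mul1r mul1e mulr1.
  have wh := mule_ge0 (w0 (v - z)%R) (h0 (vpost1 v (v - z)%R s)).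
  rewrite -[X in _ <= _ * X]muleA [leRHS]muleA -EFinM.
  by apply: lee_wpmul2r => //; rewrite lee_fin.
rewrite intZl; [|meas0|nneg|by []].
rewrite (_ : (16 * C)%:E = 16%:E * C%:E)// -muleA; apply: lee_wpmul2l => //.
rewrite tonelli//.
rewrite -(leb3_subl v mh h0) -intZl; [|meas0|nneg|by rewrite lee_fin].
apply: ge0_le_integralT => q; first exact: integral_ge0.
rewrite /phi intZr; [|rewrite /unfold; meas| |exact: h0]; last first.
  by move=> s; rewrite mule_ge0// lee_fin mulr_ge0 ?norm3_ge0 ?bcut_ge0.
by apply: lee_wpmul2r => //; exact: unfold_average.
Qed.

End Trilinear.

(** * Bounds on the collision form when one factor decays pointwise *)

Section TrilinearBounds.
Context (R : realType).
Notation V := (vec3 R).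
Notation V4 := (V * V * V * V)%type.
Notation sph := (@sphere_measure R).
Local Open Scope ereal_scope.
Implicit Types (f g h d a b : V -> \bar R) (Phi Psi : V4 -> \bar R) (e : V4 -> V).

Definition slot0 (p : V4) : V := p.1.1.1.
Definition slot1 (p : V4) : V := p.1.1.2.
Definition slot' (p : V4) : V := p.1.2.
Definition slot1' (p : V4) : V := p.2.

(** Each of the four terms of the collision operator involves three of the four velocities, selected
    by [e1], [e2], [e3]. *)
Definition prod3 e1 e2 e3 f g h (p : V4) : \bar R := f (e1 p) * g (e2 p) * h (e3 p).

Lemma prod3_ge0 e1 e2 e3 f g h : (forall x, 0 <= f x) -> (forall x, 0 <= g x) ->
  (forall x, 0 <= h x) -> forall p, 0 <= prod3 e1 e2 e3 f g h p.
Proof. by move=> f0 g0 h0 p; apply: mule_ge0 => //; exact: mule_ge0. Qed.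

Lemma le_coll_form Phi Psi : (forall p, 0 <= Phi p) -> (forall p, Phi p <= Psi p) ->
  coll_form Phi <= coll_form Psi.
Proof.
move=> P0 PQ.
have K0 v v1 s : 0 <= (coll_kernel v v1 s)%:E by rewrite lee_fin coll_kernel_ge0.
apply: ge0_le_integralT => v.
  by do 2 (apply: integral_ge0 => ? _); exact: mule_ge0.
apply: ge0_le_integralT => v1; first by apply: integral_ge0 => ? _; exact: mule_ge0.
apply: ge0_le_integralT => s; first exact: mule_ge0.
by apply: lee_wpmul2l; [exact: K0|exact: PQ].
Qed.

Lemma coll_formD Phi Psi : measurable_fun setT Phi -> measurable_fun setT Psi ->
  (forall p, 0 <= Phi p) -> (forall p, 0 <= Psi p) ->
  coll_form (fun p => Phi p + Psi p) = coll_form Phi + coll_form Psi.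
Proof.
move=> mP mQ P0 Q0.
pose G Phi (p : V * V * V) := (coll_kernel p.1.1 p.1.2 p.2)%:E *
   Phi (p.1.1, p.1.2, vpost p.1.1 p.1.2 p.2, vpost1 p.1.1 p.1.2 p.2).
have mG Phi' : measurable_fun setT Phi' -> measurable_fun setT (G Phi').
  by move=> mP'; rewrite /G /coll_kernel; meas.
have G0 Phi' : (forall p, 0 <= Phi' p) -> forall p, 0 <= G Phi' p.
  by move=> P0' p; apply: mule_ge0 => //; rewrite lee_fin coll_kernel_ge0.
have mGP := mG _ mP; have mGQ := mG _ mQ.
have GP0 := G0 _ P0; have GQ0 := G0 _ Q0.
have E Phi' : coll_form Phi' = \int[leb3]_v \int[leb3]_v1 \int[sph]_s G Phi' (v, v1, s) by [].
rewrite !E -ge0_integralD//; [|nneg|meas0|nneg|meas0].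
apply: eq_integral => v _; rewrite -ge0_integralD//; [|nneg|meas0|nneg|meas0].
apply: eq_integral => v1 _; rewrite -ge0_integralD//; [|meas0|meas0].
by apply: eq_integral => s _; rewrite /G ge0_muleDr.
Qed.

(* Adding [infty_on N], with [N] null, turns an almost everywhere bound into a
   pointwise one and leaves the collision form unchanged. *)
Definition infty_on (N : set V) (v : V) : \bar R := +oo * (\1_N v)%:E.

Lemma infty_on_ge0 N v : 0 <= infty_on N v.
Proof. by rewrite mule_ge0. Qed.

Lemma measurable_infty_on N : measurable N -> measurable_fun setT (infty_on N).
Proof.
move=> mN; have m1 : measurable_fun setT (\1_N : V -> R) by exact: measurable_indic.
by rewrite /infty_on; meas.
Qed.

Lemma coll_form_null1 N : measurable N -> leb3 N = 0 ->
  coll_form (infty_on N \o slot1) = 0.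
Proof.
move=> mN N0; have mI := measurable_infty_on mN; have I0 := infty_on_ge0 N.
rewrite /coll_form (@eq_integral _ _ _ _ setT (cst 0)) ?integral0// => v _.
rewrite -[RHS](@integral0 _ _ _ (@leb3 R) setT).
apply: ge0_ae_eq_integral => //.
- by rewrite /coll_kernel /slot1 /=; meas; nneg.
- move=> v1 _; apply: integral_ge0 => s _.
  by apply: mule_ge0; [rewrite lee_fin; exact: coll_kernel_ge0|exact: I0].
exists N; split => // v1 /= nv1; apply: contrapT => Nv1; apply: nv1 => _.
rewrite (@eq_integral _ _ _ _ setT (cst 0)) ?integral0// => s _.
by rewrite /slot1 /infty_on /= indicE memNset// mule0 mule0.
Qed.

(** v_1^* is the second velocity of the exchanged quadruple, so the exchange identity reduces the
    claim to a null set of v_1. *)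
Lemma coll_form_null1' N : measurable N -> leb3 N = 0 ->
  coll_form (infty_on N \o slot1') = 0.
Proof.
move=> mN N0; have mI := measurable_infty_on mN; have I0 := infty_on_ge0 N.
rewrite -[RHS](coll_form_null1 mN N0).
have -> : infty_on N \o slot1' = (infty_on N \o slot1) \o @swap_post R by [].
apply: coll_form_swap_post; last by move=> p; exact: I0.
by rewrite /comp /slot1; meas.
Qed.

Section Bounds.
Context (C : R) (C0 : (0 <= C)%R).
Context (near_avg : forall v v1, \int[sph]_s ((coll_kernel v v1 s)%:E *
  weight (vpost1 v v1 s)) <= C%:E).
Context (far_avg : forall v h, measurable_fun setT h -> (forall x, 0 <= h x) ->
  \int[leb3]_v1 \int[sph]_s ((coll_kernel v v1 s)%:E *
     (weight v1 * h (vpost1 v v1 s))) <= C%:E * \int[leb3]_x h x).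

(** The decaying factor is at v_1^*: it is averaged over sigma at fixed v and v_1, and the other two
    integrals separate. *)
Lemma near_bound f g h (K : R) : measurable_fun setT f -> measurable_fun setT g ->
  measurable_fun setT h -> (forall x, 0 <= f x) -> (forall x, 0 <= g x) ->
  (forall x, 0 <= h x) -> (0 <= K)%R ->
  (forall x, h x <= K%:E * weight x) ->
  coll_form (prod3 slot0 slot1 slot1' f g h) <=
  (C * K)%:E * (\int[leb3]_x f x * \int[leb3]_x g x).
Proof.
move=> mf mg mh f0 g0 h0 K0 hK.
have prod_ge0 v v1 s : 0 <= (coll_kernel v v1 s)%:E * prod3 slot0 slot1 slot1' f g h
    (v, v1, vpost v v1 s, vpost1 v v1 s).
  by apply: mule_ge0; [rewrite lee_fin coll_kernel_ge0|exact: prod3_ge0].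
have If : 0 <= \int[leb3]_x f x by exact: integral_ge0.
have Ig : 0 <= \int[leb3]_x g x by exact: integral_ge0.
have k0 : 0 <= (C * K)%:E by rewrite lee_fin mulr_ge0.
rewrite -intZr// -intZl//; [|by meas|by move=> x; exact: mule_ge0].
apply: ge0_le_integralT => v.
  by do 2 (apply: integral_ge0 => ? _); exact: prod_ge0.
rewrite muleA -intZl//; last exact: mule_ge0.
apply: ge0_le_integralT => v1.
  by apply: integral_ge0 => ? _; exact: prod_ge0.
have fgK : 0 <= f v * g v1 * K%:E by rewrite !mule_ge0.
apply: (@le_trans _ _ (\int[sph]_s (f v * g v1 * K%:E *
    ((coll_kernel v v1 s)%:E * weight (vpost1 v v1 s))))).
  apply: ge0_le_integralT => s.
    by exact: prod_ge0.
  rewrite /prod3 /slot0 /slot1 /slot1' /= [leRHS]muleCA; apply: lee_wpmul2l.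
    by rewrite lee_fin coll_kernel_ge0.
  by rewrite -[leRHS]muleA; apply: lee_wpmul2l => //; exact: mule_ge0.
have mw := @measurable_weight R.
rewrite intZl; [|by rewrite /coll_kernel; meas| |exact: fgK]; last first.
  by move=> s; apply: mule_ge0; [rewrite lee_fin coll_kernel_ge0|exact: weight_ge0].
apply: (@le_trans _ _ (f v * g v1 * K%:E * C%:E)).
  apply: lee_wpmul2l => //; exact: near_avg.
by rewrite -[leLHS]muleA -EFinM [leLHS]muleC (mulrC K) -[leRHS]muleA.
Qed.

(** The decaying factor is at v_1: the average is over v_1 and sigma together at fixed v, and leaves
    the integral of [h]. *)
Lemma far_bound f g h (K : R) : measurable_fun setT f -> measurable_fun setT g ->
  measurable_fun setT h -> (forall x, 0 <= f x) -> (forall x, 0 <= g x) ->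
  (forall x, 0 <= h x) -> (0 <= K)%R ->
  (forall x, g x <= K%:E * weight x) ->
  coll_form (prod3 slot0 slot1 slot1' f g h) <=
  (C * K)%:E * (\int[leb3]_x f x * \int[leb3]_x h x).
Proof.
move=> mf mg mh f0 g0 h0 K0 gK.
have prod_ge0 v v1 s : 0 <= (coll_kernel v v1 s)%:E * prod3 slot0 slot1 slot1' f g h
    (v, v1, vpost v v1 s, vpost1 v v1 s).
  by apply: mule_ge0; [rewrite lee_fin coll_kernel_ge0|exact: prod3_ge0].
have Ih : 0 <= \int[leb3]_x h x by exact: integral_ge0.
have k0 : 0 <= (C * K)%:E by rewrite lee_fin mulr_ge0.
have mw := @measurable_weight R; have w0 := @weight_ge0 R.
rewrite -intZr// -intZl//; [|by meas|by move=> x; exact: mule_ge0].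
apply: ge0_le_integralT => v.
  by do 2 (apply: integral_ge0 => ? _); exact: prod_ge0.
have fK : 0 <= f v * K%:E by rewrite mule_ge0.
apply: (@le_trans _ _ (\int[leb3]_v1 (f v * K%:E * \int[sph]_s
    ((coll_kernel v v1 s)%:E * (weight v1 * h (vpost1 v v1 s)))))).
  apply: ge0_le_integralT => v1.
    by apply: integral_ge0 => ? _; exact: prod_ge0.
  rewrite -intZl//; last 2 first.
  - by rewrite /coll_kernel; meas.
  - by move=> s; apply: mule_ge0; [rewrite lee_fin coll_kernel_ge0|exact: mule_ge0].
  apply: ge0_le_integralT => s.
    by exact: prod_ge0.
  rewrite /prod3 /slot0 /slot1 /slot1' /= [leRHS]muleCA; apply: lee_wpmul2l.
    by rewrite lee_fin coll_kernel_ge0.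
  rewrite [leRHS]muleA; apply: lee_wpmul2r => //; rewrite -[leRHS]muleA.
  exact: lee_wpmul2l.
rewrite intZl//; last 2 first.
- by rewrite /coll_kernel; meas; nneg.
- by move=> v1; apply: integral_ge0 => s _; apply: mule_ge0; [rewrite lee_fin coll_kernel_ge0|exact: mule_ge0].
apply: (@le_trans _ _ (f v * K%:E * (C%:E * \int[leb3]_x h x))).
  by apply: lee_wpmul2l => //; exact: far_avg.
by rewrite [leLHS]muleA -[X in X * _ <= _]muleA -EFinM [X in X * _ <= _]muleC (mulrC K) -[leLHS]muleA.
Qed.

End Bounds.

End TrilinearBounds.

(** * Trilinear estimates *)

Section TriBound.
Context (R : realType).
Notation V := (vec3 R).
Notation V4 := (V * V * V * V)%type.
Notation sph := (@sphere_measure R).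
Local Open Scope ereal_scope.
Implicit Types (f g h d a b : V -> \bar R) (e : V4 -> V).

Definition controlled (L K : R) a :=
  [/\ measurable_fun setT a, (forall x, 0 <= a x), \int[leb3]_x a x <= L%:E &
      {ae leb3, forall x, a x <= K%:E * weight x}].

(** The three inequalities are those needed for the telescoped difference of two products of three
    factors: [d] is the difference, in each possible position. *)
Definition tri_bound (C : R) e1 e2 e3 := forall (L K : R) d a b, (0 <= K)%R ->
  measurable_fun setT d -> (forall x, 0 <= d x) ->
  controlled L K a -> controlled L K b ->
  [/\ coll_form (prod3 e1 e2 e3 d a b) <= (C * K * L)%:E * \int[leb3]_x d x,
      coll_form (prod3 e1 e2 e3 a d b) <= (C * K * L)%:E * \int[leb3]_x d x &
      coll_form (prod3 e1 e2 e3 a b d) <= (C * K * L)%:E * \int[leb3]_x d x].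

Lemma measurable_slots : [/\ measurable_fun setT (@slot0 R),
  measurable_fun setT (@slot1 R), measurable_fun setT (@slot' R) &
  measurable_fun setT (@slot1' R)].
Proof. by rewrite /slot0 /slot1 /slot' /slot1'; split; meas. Qed.

Lemma measurable_prod3 e1 e2 e3 f g h : measurable_fun setT e1 ->
  measurable_fun setT e2 -> measurable_fun setT e3 -> measurable_fun setT f ->
  measurable_fun setT g -> measurable_fun setT h ->
  measurable_fun setT (prod3 e1 e2 e3 f g h).
Proof. by move=> *; rewrite /prod3; meas. Qed.

Lemma le_off_null (N : set V) (x y z : \bar R) (v : V) : 0 <= x -> 0 <= z ->
  (v \notin N -> y <= z) -> x * y <= x * z + infty_on N v.
Proof.
move=> x0 z0 yz; rewrite /infty_on indicE; case: (boolP (v \in N)) => vN.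
  rewrite mule1 addey ?leey//.
  by rewrite -ltNye (lt_le_trans _ (mule_ge0 x0 z0)).
by rewrite mule0 adde0; apply: lee_wpmul2l => //; exact: yz.
Qed.

(** Pointwise decay is used of [b] only, and [a] contributes its integral. In the orders d, a, b and
    a, d, b the factor [b] is at v_1^* and [near_bound] applies; in the order a, b, d it is at v_1
    and [far_bound] applies. *)
Lemma tri_bound_base : exists2 C : R, (0 <= C)%R & tri_bound C (@slot0 R) (@slot1 R) (@slot1' R).
Proof.
have [C C0 [near_avg far_avg]] : exists2 C : R, (0 <= C)%R &
  (forall v v1 : V, \int[sph]_s ((coll_kernel v v1 s)%:E *
  weight (vpost1 v v1 s)) <= C%:E) /\
  (forall v h, measurable_fun setT h -> (forall x, 0 <= h x) ->
  \int[leb3]_v1 \int[sph]_s ((coll_kernel v v1 s)%:E *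
     (weight v1 * h (vpost1 v v1 s))) <= C%:E * \int[leb3]_x h x).
  have c0 := sphere_avg_const_ge0 R.
  have := @kernel_average R; have := @far_kernel_average R.
  move: (sphere_avg_const R) c0 => c c0 hf hn.
  (* The larger of the constants 2c and 16c of the two averages. *)
  exists (16 * c)%R; first exact: mulr_ge0.
  split=> [v v1|]; last exact: hf.
  by apply: (le_trans (hn v v1)); rewrite lee_fin ler_wpM2r// ler_nat.
exists C => // L K d a b K0 md d0 [ma a0 aL aK] [mb b0 bL [N [mN N0 bN]]].
have [m0 m1 m' m1'] := measurable_slots.
have mw := @measurable_weight R; have w0 := @weight_ge0 R.
pose w x : \bar R := K%:E * weight x.
have mKw : measurable_fun setT w by rewrite /w; meas.
have Kw0 x : 0 <= w x by rewrite /w mule_ge0.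
have bN' v : v \notin N -> b v <= w v.
  move=> /negP vN; apply: contrapT => bv; apply: vN; rewrite inE; exact: bN.
have mI := measurable_infty_on mN; have I0 := infty_on_ge0 N.
have near f g : measurable_fun setT f -> measurable_fun setT g ->
    (forall x, 0 <= f x) -> (forall x, 0 <= g x) ->
    coll_form (prod3 (@slot0 R) (@slot1 R) (@slot1' R) f g b) <=
    (C * K)%:E * (\int[leb3]_x f x * \int[leb3]_x g x).
  move=> mf mg f0 g0.
  apply: le_trans (near_bound C0 near_avg mf mg mKw f0 g0 Kw0 K0 _); last by [].
  have P0 := prod3_ge0 (@slot0 R) (@slot1 R) (@slot1' R) f0 g0 Kw0.
  have mP := measurable_prod3 m0 m1 m1' mf mg mKw.
  have mN1 : measurable_fun setT (infty_on N \o @slot1' R) by exact: measurableT_comp.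
  have := coll_formD mP mN1 P0 (fun p => I0 _).
  rewrite (coll_form_null1' mN N0) adde0 => <-.
  apply: le_coll_form => p; first exact: prod3_ge0.
  by apply: le_off_null; [exact: mule_ge0|exact: Kw0|exact: bN'].
have far f h : measurable_fun setT f -> measurable_fun setT h ->
    (forall x, 0 <= f x) -> (forall x, 0 <= h x) ->
    coll_form (prod3 (@slot0 R) (@slot1 R) (@slot1' R) f b h) <=
    (C * K)%:E * (\int[leb3]_x f x * \int[leb3]_x h x).
  move=> mf mh f0 h0.
  apply: le_trans (far_bound C0 far_avg mf mKw mh f0 Kw0 h0 K0 _); last by [].
  have P0 := prod3_ge0 (@slot0 R) (@slot1 R) (@slot1' R) f0 Kw0 h0.
  have mP := measurable_prod3 m0 m1 m1' mf mKw mh.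
  have mN1 : measurable_fun setT (infty_on N \o @slot1 R) by exact: measurableT_comp.
  have := coll_formD mP mN1 P0 (fun p => I0 _).
  rewrite (coll_form_null1 mN N0) adde0 => <-.
  apply: le_coll_form => p; first exact: prod3_ge0.
  rewrite /prod3 [leLHS]muleAC [X in _ <= X + _]muleAC.
  by apply: le_off_null; [exact: mule_ge0|exact: Kw0|exact: bN'].
have Id : 0 <= \int[leb3]_x d x by exact: integral_ge0.
have Ia : 0 <= \int[leb3]_x a x by exact: integral_ge0.
have CK : 0 <= (C * K)%:E by rewrite lee_fin mulr_ge0.
have fin : (C * K)%:E * (\int[leb3]_x a x * \int[leb3]_x d x) <=
    (C * K * L)%:E * \int[leb3]_x d x.
  by rewrite muleA (EFinM (C * K)%R L); apply: lee_wpmul2r => //; apply: lee_wpmul2l.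
split.
- by rewrite (le_trans (near _ _ md ma d0 a0))// [X in _ * X]muleC.
- exact: le_trans (near _ _ ma md a0 d0) fin.
- exact: le_trans (far _ _ ma md a0 d0) fin.
Qed.

Lemma tri_bound_rot C e1 e2 e3 : tri_bound C e1 e2 e3 -> tri_bound C e3 e1 e2.
Proof.
move=> H L K d a b K0 md d0 ca cb.
have rot f g h : prod3 e3 e1 e2 f g h = prod3 e1 e2 e3 g h f.
  by apply/funext => p; rewrite /prod3 -muleA muleC.
have [_ _ h3] := H L K d a b K0 md d0 ca cb.
have [h1 _ _] := H L K d b a K0 md d0 cb ca.
have [_ h2 _] := H L K d b a K0 md d0 cb ca.
by rewrite !rot; split.
Qed.

Lemma tri_bound_transp C e1 e2 e3 : tri_bound C e1 e2 e3 -> tri_bound C e2 e1 e3.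
Proof.
move=> H L K d a b K0 md d0 ca cb.
have tr f g h : prod3 e2 e1 e3 f g h = prod3 e1 e2 e3 g f h.
  by apply/funext => p; rewrite /prod3 [X in X * _]muleC.
have [h1 h2 _] := H L K d a b K0 md d0 ca cb.
have [_ _ h3] := H L K d b a K0 md d0 cb ca.
by rewrite !tr; split.
Qed.

Lemma tri_bound_sym C e1 e2 e3 (sw : V4 -> V4) :
  (forall Phi, measurable_fun setT Phi -> (forall p, 0 <= Phi p) ->
     coll_form (Phi \o sw) = coll_form Phi) ->
  measurable_fun setT e1 -> measurable_fun setT e2 -> measurable_fun setT e3 ->
  tri_bound C e1 e2 e3 -> tri_bound C (e1 \o sw) (e2 \o sw) (e3 \o sw).
Proof.
move=> sym m1 m2 m3 H L K d a b K0 md d0 ca cb.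
have := H L K d a b K0 md d0 ca cb.
case: ca => ma a0 _ _; case: cb => mb b0 _ _.
have E f g h : measurable_fun setT f -> measurable_fun setT g ->
    measurable_fun setT h -> (forall x, 0 <= f x) -> (forall x, 0 <= g x) ->
    (forall x, 0 <= h x) -> coll_form (prod3 (e1 \o sw) (e2 \o sw) (e3 \o sw) f g h) =
    coll_form (prod3 e1 e2 e3 f g h).
  move=> mf mg mh f0 g0 h0; rewrite -[RHS]sym//; first exact: measurable_prod3.
  exact: prod3_ge0.
by rewrite !E.
Qed.

(** The base case is the first loss term. Exchanging the pairs before and after collision gives the
    first gain term; exchanging the members of each pair then gives the second loss and the second
    gain term. *)
Lemma tri_bound_all : exists2 C : R, (0 <= C)%R &
  [/\ tri_bound C (@slot1 R) (@slot' R) (@slot1' R),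
      tri_bound C (@slot0 R) (@slot' R) (@slot1' R),
      tri_bound C (@slot0 R) (@slot1 R) (@slot1' R) &
      tri_bound C (@slot0 R) (@slot1 R) (@slot' R)].
Proof.
have [C C0 HL1] := tri_bound_base; exists C; first exact: C0.
have [m0 m1 m' m1'] := measurable_slots.
have HG1 := tri_bound_sym (@coll_form_swap_post R) m0 m1 m1' HL1.
have HL2 := tri_bound_sym (@coll_form_swap_pair R) m0 m1 m1' HL1.
have HG2 := tri_bound_sym (@coll_form_swap_pair R) m' m1' m1 HG1.
split.
- exact: (tri_bound_rot HG1).
- exact: (tri_bound_rot (tri_bound_transp HG2)).
- exact: HL1.
- exact: (tri_bound_transp HL2).
Qed.

End TriBound.

(** * Almost everywhere statements and real-valued integrals *)

Section AlmostEverywhere.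
Context d (T : measurableType d) (R : realType) (mu : {measure set T -> \bar R}).
Implicit Types P Q S : T -> Prop.

Lemma ae_sub P Q : (forall x, P x -> Q x) -> {ae mu, forall x, P x} ->
  {ae mu, forall x, Q x}.
Proof. exact: filterS. Qed.

Lemma ae_and P Q S : (forall x, P x -> Q x -> S x) -> {ae mu, forall x, P x} ->
  {ae mu, forall x, Q x} -> {ae mu, forall x, S x}.
Proof. exact: filterS2. Qed.

End AlmostEverywhere.

Section RealIntegral.
Context d (T : measurableType d) (R : realType) (mu : {measure set T -> \bar R}).
Context (D : set T) (mD : measurable D).
Implicit Types f g : T -> R.

Lemma integrable_abs f : measurable_fun setT f ->
  (\int[mu]_(x in D) `|f x|%:E < +oo)%E -> mu.-integrable D (EFin \o f).
Proof.
move=> mf fD; apply/integrableP; split; last by [].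
by apply: measurable_funTS; exact: mfun_EFin.
Qed.

(** Where [f] is not integrable the right side is infinite. *)
Lemma normr_Rint_le f : measurable_fun setT f ->
  (`|\int[mu]_(x in D) f x|%:E <= \int[mu]_(x in D) `|f x|%:E)%E.
Proof.
move=> mf; have [->|foo] := eqVneq (\int[mu]_(x in D) `|f x|%:E)%E +oo%E.
  by rewrite leey.
have fi : mu.-integrable D (EFin \o f) by apply: integrable_abs => //; rewrite ltey.
rewrite EFin_normr_Rintegral//; apply: (le_trans (le_abse_integral mu mD _)) => //.
by apply: measurable_funTS; exact: mfun_EFin.
Qed.

Lemma normr_RintB_le f g : measurable_fun setT f -> measurable_fun setT g ->
  (\int[mu]_(x in D) `|f x|%:E < +oo)%E -> (\int[mu]_(x in D) `|g x|%:E < +oo)%E ->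
  (`|\int[mu]_(x in D) f x - \int[mu]_(x in D) g x|%:E <=
   \int[mu]_(x in D) `|f x - g x|%:E)%E.
Proof.
move=> mf mg fi gi.
rewrite -RintegralB//; [|exact: integrable_abs|exact: integrable_abs].
by apply: normr_Rint_le; exact: mfunB.
Qed.

(* Both sides vanish when [f] is not integrable. *)
Lemma RintZl f (r : R) : measurable_fun setT f ->
  (r * \int[mu]_(x in D) f x = \int[mu]_(x in D) (r * f x))%R.
Proof.
move=> mf; have [->|r0] := eqVneq r 0.
  rewrite mul0r; apply/esym; rewrite /Rintegral.
  by under eq_integral do rewrite mul0r; rewrite integral0.
have [fi|fi] := ltP (\int[mu]_(x in D) `|f x|%:E)%E +oo%E.
  by rewrite RintegralZl//; exact: integrable_abs.
have junk g : measurable_fun setT g ->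
    (+oo <= \int[mu]_(x in D) `|g x|%:E)%E -> \int[mu]_(x in D) g x = 0.
  move=> mg goo; rewrite /Rintegral.
  have := @integral_fin_num_abs _ _ _ mu D g mD (measurable_funTS mg).
  rewrite ltNge goo /=; case: (\int[mu]_(x in D) (g x)%:E)%E => //.
rewrite (junk f mf fi) mulr0 junk//; first by apply: mfunM => //; exact: measurable_cst.
under eq_integral do rewrite normrM EFinM.
rewrite ge0_integralZl//; last first.
  by apply: measurable_funTS; apply: mfun_EFin; exact: mfun_norm.
have -> : (\int[mu]_(x in D) `|f x|%:E = +oo)%E by apply/eqP; rewrite -leye_eq.
by rewrite gt0_muley ?leey// lte_fin normr_gt0.
Qed.

End RealIntegral.

Section MeasurableParameter.
Context d (T : measurableType d) (R : realType).
Notation V := (vec3 R).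
Local Open Scope ereal_scope.

Lemma prod_sphere_tonelli (h : V -> V -> \bar R) :
  measurable_fun setT (fun p : V * V => h p.1 p.2) -> (forall x y, 0 <= h x y) ->
  \int[(@leb3 R \x @sphere_measure R)%E]_p h p.1 p.2 =
  \int[leb3]_v1 \int[sphere_measure]_s h v1 s.
Proof. by move=> mh h0; exact: tonelli1. Qed.

(** The real integral is the finite part of a difference of two nonnegative integrals, each
    measurable in the parameter by Tonelli's theorem; this covers the parameters where the integral
    diverges. *)
Lemma measurable_Rint_param (k : T * V * V -> R) : measurable_fun setT k ->
  measurable_fun setT (fun x =>
    (\int[(@leb3 R \x @sphere_measure R)%E]_p k (x, p.1, p.2))%R).
Proof.
move=> mk.
(* Positive and negative parts, written with the absolute value. *)
pose kp p := ((`|k p| + k p) / 2)%R; pose kn p := ((`|k p| - k p) / 2)%R.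
have mkp : measurable_fun setT kp by rewrite /kp; meas.
have mkn : measurable_fun setT kn by rewrite /kn; meas.
have kp0 p : (0 <= kp p)%R.
  by rewrite /kp divr_ge0// -lerBlDr sub0r -normrN ler_norm.
have kn0 p : (0 <= kn p)%R by rewrite /kn divr_ge0// subr_ge0 ler_norm.
rewrite (_ : (fun x => _) = (fun x => fine (
  \int[leb3]_v1 \int[sphere_measure]_s (kp (x, v1, s))%:E -
  \int[leb3]_v1 \int[sphere_measure]_s (kn (x, v1, s))%:E))).
  apply: (measurableT_comp (measurable_realfun.fine_measurable _)) => //.
  apply: emeasurable_funB.
    by meas => //; nneg.
  by meas => //; nneg.
apply/funext => x; rewrite /Rintegral integralE; congr (fine (_ - _)).
- rewrite -prod_sphere_tonelli; [|by meas|by move=> *; rewrite lee_fin].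
  apply: eq_integral => p _; rewrite funeposE /kp -EFin_max; congr EFin.
  by case: (leP (k (x, p.1, p.2)) 0%R) => h; [rewrite ler0_norm//|rewrite gtr0_norm//]; field.
- rewrite -prod_sphere_tonelli; [|by meas|by move=> *; rewrite lee_fin].
  apply: eq_integral => p _; rewrite funenegE /kn -EFinN -EFin_max; congr EFin.
  case: (leP (- k (x, p.1, p.2))%R 0%R) => h.
    by rewrite ger0_norm -?oppr_le0//; field.
  by rewrite ltr0_norm -?oppr_gt0//; field.
Qed.

End MeasurableParameter.

(** * One term of the collision operator *)

Section CollisionEstimates.
Context (R : realType).
Notation V := (vec3 R).
Notation V4 := (V * V * V * V)%type.
Notation sph := (@sphere_measure R).
Implicit Types (a b : V -> R) (e : V4 -> V).

Definition quad (v v1 s : V) : V4 := (v, v1, vpost v v1 s, vpost1 v v1 s).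

(** One shape for all four terms: where the operator has f(v) in front of the integral, [e1] selects
    v. *)
Definition tri_int e1 e2 e3 a (v : V) : R := coll_int v (fun v1 s =>
  a (e1 (quad v v1 s)) * a (e2 (quad v v1 s)) * a (e3 (quad v v1 s))).

Definition tri_integrand e1 e2 e3 a v v1 s : R := norm3 (v - v1 : V) *
  (a (e1 (quad v v1 s)) * a (e2 (quad v v1 s)) * a (e3 (quad v v1 s))) *
  bcut (dot3 (v - v1 : V) s).

Definition abs_fun a (v : V) : \bar R := `|a v|%:E.

Lemma measurable_abs_fun a : measurable_fun setT a -> measurable_fun setT (abs_fun a).
Proof. by move=> ma; rewrite /abs_fun; meas. Qed.

Lemma abs_fun_ge0 a v : (0 <= abs_fun a v)%E.
Proof. by rewrite lee_fin. Qed.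

Section OneTerm.
Context (e1 e2 e3 : V4 -> V) (me1 : measurable_fun setT e1)
  (me2 : measurable_fun setT e2) (me3 : measurable_fun setT e3).

Lemma measurable_tri_integrand a : measurable_fun setT a ->
  measurable_fun setT (fun p : V * V * V => tri_integrand e1 e2 e3 a p.1.1 p.1.2 p.2).
Proof. by move=> ma; rewrite /tri_integrand /quad; meas. Qed.

Lemma measurable_tri_int a : measurable_fun setT a ->
  measurable_fun setT (tri_int e1 e2 e3 a).
Proof.
move=> ma; rewrite /tri_int /coll_int; apply: mfunM; first exact: measurable_cst.
exact: (measurable_Rint_param (measurable_tri_integrand ma)).
Qed.

Lemma abs_tri_integrand a v v1 s :
  (`|tri_integrand e1 e2 e3 a v v1 s|%:E =
   (coll_kernel v v1 s)%:E *
   prod3 e1 e2 e3 (abs_fun a) (abs_fun a) (abs_fun a) (quad v v1 s))%E.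
Proof.
rewrite /prod3 /abs_fun -!EFinM /tri_integrand /coll_kernel !normrM.
by rewrite (ger0_norm (norm3_ge0 _)) (ger0_norm (bcut_ge0 _)) mulrAC.
Qed.

Lemma integral_abs_tri a v : measurable_fun setT a ->
  (\int[(@leb3 R \x sph)%E]_p `|tri_integrand e1 e2 e3 a v p.1 p.2|%:E =
   \int[leb3]_v1 \int[sph]_s ((coll_kernel v v1 s)%:E *
   prod3 e1 e2 e3 (abs_fun a) (abs_fun a) (abs_fun a) (quad v v1 s)))%E.
Proof.
move=> ma; have mt := measurable_tri_integrand ma.
rewrite (prod_sphere_tonelli (h := fun v1 s => `|tri_integrand e1 e2 e3 a v v1 s|%:E)).
- by do 2 (apply: eq_integral => ? _); rewrite abs_tri_integrand.
- have me : measurable_fun setT (fun p : V * V => (v, p.1, p.2)) by meas.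
  by apply: mfun_EFin; apply: mfun_norm; exact: (mfun_app1 mt me).
- by move=> *; rewrite lee_fin.
Qed.

Lemma normr_tri_int_le a v : measurable_fun setT a ->
  (`|tri_int e1 e2 e3 a v|%:E <=
   \int[leb3]_v1 \int[sph]_s ((coll_kernel v v1 s)%:E *
   prod3 e1 e2 e3 (abs_fun a) (abs_fun a) (abs_fun a) (quad v v1 s)))%E.
Proof.
move=> ma; rewrite -integral_abs_tri// /tri_int /coll_int normrM.
have mt := measurable_tri_integrand ma.
have me : measurable_fun setT (fun p : V * V => (v, p.1, p.2)) by meas.
have mtv : measurable_fun setT (fun p : V * V => tri_integrand e1 e2 e3 a v p.1 p.2).
  exact: (mfun_app1 mt me).
apply: le_trans (normr_Rint_le _ measurableT mtv).
by rewrite lee_fin ger0_norm// ler_piMl// invf_le1 ?ler1n.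
Qed.

Context (C : R) (C0 : 0 <= C) (HC : tri_bound C e1 e2 e3).
Context (L K : R) (L0 : 0 <= L) (K0 : 0 <= K).

Lemma tri_form_le a : measurable_fun setT a -> controlled L K (abs_fun a) ->
  (coll_form (prod3 e1 e2 e3 (abs_fun a) (abs_fun a) (abs_fun a)) <=
   (C * K * L)%:E * \int[leb3]_v (abs_fun a v))%E.
Proof.
move=> ma ca; have [] := HC K0 (measurable_abs_fun ma) (abs_fun_ge0 a) ca ca.
by [].
Qed.

Lemma tri_form_lty a : measurable_fun setT a -> controlled L K (abs_fun a) ->
  (coll_form (prod3 e1 e2 e3 (abs_fun a) (abs_fun a) (abs_fun a)) < +oo)%E.
Proof.
move=> ma ca; apply: (le_lt_trans (tri_form_le ma ca)).
have [_ _ aL _] := ca.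
apply: (@le_lt_trans _ _ ((C * K * L)%:E * L%:E)%E).
  by apply: lee_wpmul2l => //; rewrite lee_fin !mulr_ge0.
by rewrite -EFinM ltry.
Qed.

Lemma integral_tri_int_le a : measurable_fun setT a -> controlled L K (abs_fun a) ->
  (\int[leb3]_v `|tri_int e1 e2 e3 a v|%:E <=
   (C * K * L)%:E * \int[leb3]_v (abs_fun a v))%E.
Proof.
move=> ma ca; apply: le_trans (tri_form_le ma ca).
by apply: ge0_le_integralT => v; [rewrite lee_fin|exact: normr_tri_int_le].
Qed.

(** The collision form of |a| is the integral over v of this quantity; being finite, it forces
    finiteness for almost every v. *)
Lemma ae_tri_integrable a : measurable_fun setT a -> controlled L K (abs_fun a) ->
  {ae @leb3 R, forall v,
   (\int[(@leb3 R \x sph)%E]_p `|tri_integrand e1 e2 e3 a v p.1 p.2|%:E < +oo)%E}.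
Proof.
move=> ma ca.
pose M v := (\int[leb3]_v1 \int[sph]_s ((coll_kernel v v1 s)%:E *
   prod3 e1 e2 e3 (abs_fun a) (abs_fun a) (abs_fun a) (quad v v1 s)))%E.
have P0 := prod3_ge0 e1 e2 e3 (abs_fun_ge0 a) (abs_fun_ge0 a) (abs_fun_ge0 a).
have mab := measurable_abs_fun ma.
have mP := measurable_prod3 me1 me2 me3 mab mab mab.
have K0' v v1 s : (0 <= (coll_kernel v v1 s)%:E :> \bar R)%E by rewrite lee_fin coll_kernel_ge0.
have I0 v v1 s : (0 <= (coll_kernel v v1 s)%:E *
   prod3 e1 e2 e3 (abs_fun a) (abs_fun a) (abs_fun a) (quad v v1 s))%E.
  exact: mule_ge0.
have M0 v : (0 <= M v)%E by do 2 (apply: integral_ge0 => ? _).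
have mM : measurable_fun setT M.
  by rewrite /M /coll_kernel /quad; meas => //; nneg.
have iM : leb3.-integrable setT M.
  apply/integrableP; split=> //.
  under eq_integral do rewrite gee0_abs//.
  exact: tri_form_lty.
have := integrable_ae measurableT iM.
apply: filterS => v /(_ I).
by rewrite integral_abs_tri// ge0_fin_numE.
Qed.

Lemma abs_prodB (x1 x2 x3 y1 y2 y3 : R) :
  `|x1 * x2 * x3 - y1 * y2 * y3| <=
  `|x1 - y1| * `|x2| * `|x3| + `|y1| * `|x2 - y2| * `|x3| + `|y1| * `|y2| * `|x3 - y3|.
Proof.
have -> : x1 * x2 * x3 - y1 * y2 * y3 =
  (x1 - y1) * x2 * x3 + y1 * (x2 - y2) * x3 + y1 * y2 * (x3 - y3) by ring.
by rewrite -!normrM (le_trans (ler_normD _ _))// lerD2r ler_normD.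
Qed.

(** For almost every v both integrals converge and may be subtracted under the integral sign. The
    telescoped difference of products gives three collision forms, one for each position of a - b,
    hence the factor 3. *)
Lemma integral_tri_intB_le a b : measurable_fun setT a -> measurable_fun setT b ->
  controlled L K (abs_fun a) -> controlled L K (abs_fun b) ->
  (\int[leb3]_v `|tri_int e1 e2 e3 a v - tri_int e1 e2 e3 b v|%:E <=
   (3 * (C * K * L))%:E * \int[leb3]_v (abs_fun (fun v => (a v - b v)%R) v))%E.
Proof.
move=> ma mb ca cb.
set dd := abs_fun (fun v => (a v - b v)%R).
have mdd : measurable_fun setT dd by apply: measurable_abs_fun; exact: mfunB.
have maa := measurable_abs_fun ma; have mbb := measurable_abs_fun mb.
have d0 : forall v, (0 <= dd v)%E := abs_fun_ge0 _.
have a0 := abs_fun_ge0 a; have b0 := abs_fun_ge0 b.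
pose P1 := prod3 e1 e2 e3 dd (abs_fun a) (abs_fun a).
pose P2 := prod3 e1 e2 e3 (abs_fun b) dd (abs_fun a).
pose P3 := prod3 e1 e2 e3 (abs_fun b) (abs_fun b) dd.
have mP1 : measurable_fun setT P1 by exact: measurable_prod3.
have mP2 : measurable_fun setT P2 by exact: measurable_prod3.
have mP3 : measurable_fun setT P3 by exact: measurable_prod3.
have P10 p : (0 <= P1 p)%E by exact: prod3_ge0.
have P20 p : (0 <= P2 p)%E by exact: prod3_ge0.
have P30 p : (0 <= P3 p)%E by exact: prod3_ge0.
pose P p := (P1 p + P2 p + P3 p)%E.
have mP : measurable_fun setT P by exact: (mfunDe (mfunDe mP1 mP2) mP3).
have P0 p : (0 <= P p)%E by rewrite !adde_ge0.
have PE : coll_form P = (coll_form P1 + coll_form P2 + coll_form P3)%E.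
  rewrite /P (@coll_formD _ (fun p => (P1 p + P2 p)%E))//; last 2 first.
  - exact: (mfunDe mP1 mP2).
  - by move=> p; exact: adde_ge0.
  by rewrite coll_formD.
have [h1 _ _] := HC K0 mdd d0 ca ca.
have [_ h2 _] := HC K0 mdd d0 cb ca.
have [_ _ h3] := HC K0 mdd d0 cb cb.
apply: (@le_trans _ _ (coll_form P)); last first.
  rewrite PE (_ : (3 * (C * K * L))%:E * \int[leb3]_v dd v =
    (C * K * L)%:E * \int[leb3]_v dd v + (C * K * L)%:E * \int[leb3]_v dd v +
    (C * K * L)%:E * \int[leb3]_v dd v)%E.
    by apply: leeD; [apply: leeD; [exact: h1|exact: h2]|exact: h3].
  have Id : (0 <= \int[leb3]_v dd v)%E by exact: integral_ge0.
  have c0 : 0 <= C * K * L by rewrite !mulr_ge0.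
  rewrite -!ge0_muleDl ?adde_ge0 ?lee_fin// -!EFinD; congr (_%:E * _)%E; ring.
rewrite /coll_form.
apply: ae_ge0_le_integral => //.
- by apply: mfun_EFin; apply: mfun_norm; apply: mfunB; exact: measurable_tri_int.
- move=> v _; do 2 (apply: integral_ge0 => ? _).
  by apply: mule_ge0 => //; rewrite lee_fin coll_kernel_ge0.
- rewrite /coll_kernel; meas => //.
  + by move=> *; apply: mule_ge0 => //; nneg.
  + by move=> *; apply: integral_ge0 => ? _; apply: mule_ge0 => //; nneg.
apply: (@ae_and _ _ _ (@leb3 R) _ _ _ _ (ae_tri_integrable ma ca)
  (ae_tri_integrable mb cb)) => v ia ib _.
have mt c : measurable_fun setT c ->
    measurable_fun setT (fun p : V * V => tri_integrand e1 e2 e3 c v p.1 p.2).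
  move=> mc; have me : measurable_fun setT (fun p : V * V => (v, p.1, p.2)) by meas.
  exact: (mfun_app1 (measurable_tri_integrand mc) me).
apply: (@le_trans _ _ (\int[(@leb3 R \x sph)%E]_p
  `|tri_integrand e1 e2 e3 a v p.1 p.2 - tri_integrand e1 e2 e3 b v p.1 p.2|%:E)%E).
  apply: le_trans (normr_RintB_le measurableT (mt a ma) (mt b mb) ia ib).
  rewrite lee_fin /tri_int /coll_int -mulrBr normrM ger0_norm//.
  by rewrite ler_piMl// invf_le1 ?ler1n.
have mtd : measurable_fun setT (fun p : V * V =>
    `|tri_integrand e1 e2 e3 a v p.1 p.2 - tri_integrand e1 e2 e3 b v p.1 p.2|%:E).
  by apply: mfun_EFin; apply: mfun_norm; apply: mfunB; exact: mt.
rewrite (prod_sphere_tonelli (h := fun v1 s => `|tri_integrand e1 e2 e3 a v v1 s -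
  tri_integrand e1 e2 e3 b v v1 s|%:E)) //.
apply: ge0_le_integralT => v1; first by apply: integral_ge0 => s _; rewrite lee_fin.
apply: ge0_le_integralT => s; first by rewrite lee_fin.
set q := (v, v1, _, _).
pose u1 := e1 q; pose u2 := e2 q; pose u3 := e3 q.
rewrite [P q](_ : _ = (`|a u1 - b u1| * `|a u2| * `|a u3| +
  `|b u1| * `|a u2 - b u2| * `|a u3| + `|b u1| * `|b u2| * `|a u3 - b u3|)%:E)//.
rewrite -EFinM lee_fin /tri_integrand /coll_kernel -/q -mulrBl -mulrBr !normrM.
rewrite (ger0_norm (norm3_ge0 _)) (ger0_norm (bcut_ge0 _)) mulrAC.
by apply: ler_wpM2l; [rewrite mulr_ge0 ?norm3_ge0 ?bcut_ge0|exact: abs_prodB].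
Qed.

End OneTerm.

End CollisionEstimates.

(** * The collision operator *)

Section CollisionOperator.
Context (R : realType).
Notation V := (vec3 R).
Notation sph := (@sphere_measure R).
Implicit Types (a b : V -> R).

Definition coll_v a (v : V) : R :=
  tri_int (@slot1 R) (@slot' R) (@slot1' R) a v + tri_int (@slot0 R) (@slot' R) (@slot1' R) a v -
  tri_int (@slot0 R) (@slot1 R) (@slot1' R) a v - tri_int (@slot0 R) (@slot1 R) (@slot' R) a v.

(** The factor a(v) enters the integral for every v, including those where the integral diverges, by
    the convention on divergent integrals. *)
Lemma tri_int_slot0 (e2 e3 : V * V * V * V -> V) a v : measurable_fun setT e2 ->
  measurable_fun setT e3 -> measurable_fun setT a ->
  a v * coll_int v (fun v1 s => a (e2 (quad v v1 s)) * a (e3 (quad v v1 s))) =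
  tri_int (@slot0 R) e2 e3 a v.
Proof.
move=> me2 me3 ma; rewrite /tri_int /coll_int mulrCA; congr (_ * _).
rewrite RintZl//; last by rewrite /quad; meas.
by apply: eq_Rintegral => p _; rewrite /slot0 /quad /=; ring.
Qed.

Lemma collE (f : phase R -> R) x v : measurable_fun setT (fun w : V => f (x, w)) ->
  coll f (x, v) = coll_v (fun w => f (x, w)) v.
Proof.
move=> mf; have [m0 m1 m' m1'] := measurable_slots R.
rewrite /coll /coll_v /=; congr (_ + _ - _ - _).
- exact: (tri_int_slot0 _ m' m1' mf).
- exact: (tri_int_slot0 _ m1 m1' mf).
- exact: (tri_int_slot0 _ m1 m' mf).
Qed.

Lemma measurable_coll d (T : measurableType d) (u : T -> phase R -> R) :
  measurable_fun setT (fun q : T * phase R => u q.1 q.2) ->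
  measurable_fun setT (fun q : T * phase R => coll (u q.1) q.2).
Proof.
move=> mu.
pose w (q : T * phase R) := u q.1 q.2.
have mw : measurable_fun setT w by [].
have mi (K : T * phase R * V * V -> R) : measurable_fun setT K ->
    measurable_fun setT (fun q => coll_int q.2.2 (fun v1 s => K (q, v1, s))).
  move=> mK; apply: mfunM; first exact: measurable_cst.
  apply: (@measurable_Rint_param _ _ R (fun p : (T * phase R) * V * V =>
    norm3 (p.1.1.2.2 - p.1.2 : V) * K p * bcut (dot3 (p.1.1.2.2 - p.1.2 : V) p.2))).
  by meas.
rewrite /coll; apply: mfunB; first apply: mfunB; first apply: mfunD.
- apply: (mi (fun p => w (p.1.1.1, (p.1.1.2.1, p.1.2)) *
    w (p.1.1.1, (p.1.1.2.1, vpost p.1.1.2.2 p.1.2 p.2)) *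
    w (p.1.1.1, (p.1.1.2.1, vpost1 p.1.1.2.2 p.1.2 p.2)))).
  by meas.
- rewrite /collG2; apply: mfunM.
    rewrite (_ : (fun _ => _) = fun q : T * phase R => w (q.1, (q.2.1, q.2.2)))//.
    by meas.
  apply: (mi (fun p =>
    w (p.1.1.1, (p.1.1.2.1, vpost p.1.1.2.2 p.1.2 p.2)) *
    w (p.1.1.1, (p.1.1.2.1, vpost1 p.1.1.2.2 p.1.2 p.2)))).
  by meas.
- rewrite /collL1; apply: mfunM.
    rewrite (_ : (fun _ => _) = fun q : T * phase R => w (q.1, (q.2.1, q.2.2)))//.
    by meas.
  apply: (mi (fun p =>
    w (p.1.1.1, (p.1.1.2.1, p.1.2)) *
    w (p.1.1.1, (p.1.1.2.1, vpost1 p.1.1.2.2 p.1.2 p.2)))).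
  by meas.
- rewrite /collL2; apply: mfunM.
    rewrite (_ : (fun _ => _) = fun q : T * phase R => w (q.1, (q.2.1, q.2.2)))//.
    by meas.
  apply: (mi (fun p =>
    w (p.1.1.1, (p.1.1.2.1, p.1.2)) *
    w (p.1.1.1, (p.1.1.2.1, vpost p.1.1.2.2 p.1.2 p.2)))).
  by meas.
Qed.

Lemma integral_normr4_le d (T : measurableType d) (mu : {measure set T -> \bar R})
    (g f1 f2 f3 f4 : T -> R) (c : \bar R) :
  measurable_fun setT f1 -> measurable_fun setT f2 ->
  measurable_fun setT f3 -> measurable_fun setT f4 ->
  (forall x, `|g x| <= `|f1 x| + `|f2 x| + `|f3 x| + `|f4 x|) ->
  (\int[mu]_x `|f1 x|%:E <= c)%E -> (\int[mu]_x `|f2 x|%:E <= c)%E ->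
  (\int[mu]_x `|f3 x|%:E <= c)%E -> (\int[mu]_x `|f4 x|%:E <= c)%E ->
  (\int[mu]_x `|g x|%:E <= c + c + c + c)%E.
Proof.
move=> m1 m2 m3 m4 gf h1 h2 h3 h4.
apply: (@le_trans _ _ (\int[mu]_x (`|f1 x|%:E + `|f2 x|%:E + `|f3 x|%:E + `|f4 x|%:E))%E).
  by apply: ge0_le_integralT => x; rewrite ?lee_fin// -!EFinD lee_fin.
have me (f : T -> R) : measurable_fun setT f -> measurable_fun setT (fun x => `|f x|%:E).
  by move=> mf; meas.
have me1 := me _ m1; have me2 := me _ m2; have me3 := me _ m3; have me4 := me _ m4.
rewrite ge0_integralD//; [|by move=> x _; rewrite !adde_ge0 ?lee_fin|
  exact: (mfunDe (mfunDe me1 me2) me3)].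
rewrite ge0_integralD//; [|by move=> x _; rewrite !adde_ge0 ?lee_fin|exact: (mfunDe me1 me2)].
rewrite ge0_integralD//.
by apply: leeD => //; apply: leeD => //; exact: leeD.
Qed.

Lemma coll_v_bounds : exists2 C : R, 0 <= C & forall L K a b, 0 <= L -> 0 <= K ->
  measurable_fun setT a -> measurable_fun setT b ->
  controlled L K (abs_fun a) -> controlled L K (abs_fun b) ->
  (\int[leb3]_v `|coll_v a v|%:E <= (C * K * L)%:E * \int[leb3]_v `|a v|%:E /\
   \int[leb3]_v `|coll_v a v - coll_v b v|%:E <=
     (C * K * L)%:E * \int[leb3]_v `|a v - b v|%:E)%E.
Proof.
have [C C0 [H1 H2 H3 H4]] := tri_bound_all R.
have [m0 m1 m' m1'] := measurable_slots R.
(* Four terms, each with the factor 3 of the telescoped difference. *)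
exists (12 * C); first by rewrite mulr_ge0.
move=> L K a b L0 K0 ma mb ca cb.
have c0 : 0 <= C * K * L by rewrite !mulr_ge0.
have four (k : R) (x : \bar R) : 0 <= k -> (0 <= x)%E -> k <= 3 * (C * K * L) ->
    (k%:E * x + k%:E * x + k%:E * x + k%:E * x <= (12 * C * K * L)%:E * x)%E.
  move=> k0 x0 kC; have kx : (0 <= k%:E * x)%E by rewrite mule_ge0.
  rewrite -!ge0_muleDl ?adde_ge0 ?lee_fin// -!EFinD.
  apply: lee_wpmul2r => //; rewrite lee_fin; lra.
split.
  have Ia : (0 <= \int[leb3]_v `|a v|%:E)%E by apply: integral_ge0 => v _; rewrite lee_fin.
  apply: le_trans (four (C * K * L) _ c0 Ia _); last by lra.
  apply: (@integral_normr4_le _ _ _ _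
    (tri_int (@slot1 R) (@slot' R) (@slot1' R) a) (tri_int (@slot0 R) (@slot' R) (@slot1' R) a)
    (tri_int (@slot0 R) (@slot1 R) (@slot1' R) a) (tri_int (@slot0 R) (@slot1 R) (@slot' R) a));
    try exact: measurable_tri_int.
  - move=> v; rewrite /coll_v; do 2 rewrite (le_trans (ler_normB _ _))// lerD2r.
    exact: ler_normD.
  - exact: (integral_tri_int_le m1 m' m1' H1 K0 ma ca).
  - exact: (integral_tri_int_le m0 m' m1' H2 K0 ma ca).
  - exact: (integral_tri_int_le m0 m1 m1' H3 K0 ma ca).
  - exact: (integral_tri_int_le m0 m1 m' H4 K0 ma ca).
have Ia : (0 <= \int[leb3]_v `|a v - b v|%:E)%E by apply: integral_ge0 => v _; rewrite lee_fin.
apply: le_trans (four (3 * (C * K * L)) _ _ Ia _); [|lra|by []].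
apply: (@integral_normr4_le _ _ _ _
    (fun v => tri_int (@slot1 R) (@slot' R) (@slot1' R) a v - tri_int (@slot1 R) (@slot' R) (@slot1' R) b v)
    (fun v => tri_int (@slot0 R) (@slot' R) (@slot1' R) a v - tri_int (@slot0 R) (@slot' R) (@slot1' R) b v)
    (fun v => tri_int (@slot0 R) (@slot1 R) (@slot1' R) a v - tri_int (@slot0 R) (@slot1 R) (@slot1' R) b v)
    (fun v => tri_int (@slot0 R) (@slot1 R) (@slot' R) a v - tri_int (@slot0 R) (@slot1 R) (@slot' R) b v));
    try (apply: mfunB; exact: measurable_tri_int).
- move=> v; rewrite /coll_v.
  move: (tri_int _ _ _ a v) (tri_int _ _ _ b v) => x1 y1.
  move: (tri_int _ _ _ a v) (tri_int _ _ _ b v) => x2 y2.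
  move: (tri_int _ _ _ a v) (tri_int _ _ _ b v) => x3 y3.
  move: (tri_int _ _ _ a v) (tri_int _ _ _ b v) => x4 y4.
  rewrite (_ : _ - _ = (x1 - y1) + (x2 - y2) - (x3 - y3) - (x4 - y4)); last by ring.
  do 2 rewrite (le_trans (ler_normB _ _))// lerD2r.
  exact: ler_normD.
- exact: (integral_tri_intB_le m1 m' m1' C0 H1 L0 K0 ma mb ca cb).
- exact: (integral_tri_intB_le m0 m' m1' C0 H2 L0 K0 ma mb ca cb).
- exact: (integral_tri_intB_le m0 m1 m1' C0 H3 L0 K0 ma mb ca cb).
- exact: (integral_tri_intB_le m0 m1 m' C0 H4 L0 K0 ma mb ca cb).
Qed.

End CollisionOperator.

(** * From mixed norms to bounds in v for almost every x *)

Section MixedNorms.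
Context (R : realType).
Notation V := (vec3 R).
Implicit Types (f : phase R -> R) (M alpha K k : R).

(** The norm is defined by cases on the total mass; when the mass is zero, the whole space is an
    exceptional null set. *)
Lemma Lnorm_infty_le d (T : measurableType d) (mu : {measure set T -> \bar R})
    (f : T -> \bar R) (y : \bar R) : (Lnorm mu +oo f <= y)%E ->
  {ae mu, forall x, (`|f x| <= y)%E}.
Proof.
rewrite unlock /Lnorm; case: ifPn => [_ H|]; first exact/ess_supP.
rewrite -leNgt => mu0 _; exists setT; split => //.
by apply/eqP; rewrite eq_le mu0 measure_ge0.
Qed.

Lemma L1normE f : measurable_fun setT f ->
  L1norm f = (\int[leb3]_x \int[leb3]_v `|f (x, v)|%:E)%E.
Proof.
move=> mf; rewrite /L1norm /Lxv Lnorm1; apply: eq_integral => x _.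
by rewrite Lnorm1 gee0_abs//; apply: integral_ge0 => v _; rewrite lee_fin.
Qed.

Lemma wLinf_ae M K f : 8 < M -> (wLinf_norm M f <= K%:E)%E ->
  {ae @leb3 R, forall x, {ae @leb3 R, forall v,
    (abs_fun (fun v => f (x, v)) v <= K%:E * weight v)%E}}.
Proof.
move=> M8 /Lnorm_infty_le; apply: (@ae_sub _ _ _ (@leb3 R)) => x.
rewrite gee0_abs ?Lnorm_ge0// => /Lnorm_infty_le; apply: (@ae_sub _ _ _ (@leb3 R)) => v.
rewrite /= /abs_fun /weight normrM (ger0_norm (powR_ge0 _ _)) -EFinM !lee_fin => H.
have j1 : 1 <= japv v := japr_ge1 (norm3 v).
have j0 : 0 < japv v `^ M by rewrite powR_gt0// (lt_le_trans _ j1).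
have K0 : 0 <= K by apply: le_trans H; rewrite mulr_ge0// ltW.
rewrite mulrC -ler_pdivlMr// in H; apply: (le_trans H); apply: ler_wpM2l => //.
by rewrite -powRN ler_powR// lerN2; lra.
Qed.

(** The mean of 1 and of the bound on the integral of the power -2 alpha of the bracket, as produced
    by Young's inequality below. *)
Definition moment_const alpha : R :=
  (1 + 8 * (2 `^ (2 * alpha) / (1 - 2 `^ (3 - 2 * alpha)))) / 2.

(** Young's inequality in place of Cauchy-Schwarz, scaled by [k] so that both halves are linear in
    it. The hypothesis on alpha gives 2 alpha > 3, hence an integrable weight. *)
Lemma L1_le_weighted_L2 alpha k (g : V -> R) : 5 / 2 < alpha -> 0 < k ->
  measurable_fun setT g ->
  (Lnorm (@leb3 R) 2%:E (fun v => (japv v `^ alpha * g v)%:E) <= k%:E)%E ->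
  (\int[leb3]_v abs_fun g v <= (moment_const alpha * k)%:E)%E.
Proof.
move=> a52 k0 mg gk.
have n2 : 2 != 0 :> R by rewrite pnatr_eq0.
have sq v : 0 <= japv v `^ alpha * g v ^+ 2.
  by rewrite mulr_ge0 ?powR_ge0 ?sqr_ge0.
have g2 : (\int[leb3]_v ((japv v `^ alpha * g v) ^+ 2)%:E <= (k ^+ 2)%:E)%E.
  have := @poweR_Lnorm _ _ _ (@leb3 R) (fun v => (japv v `^ alpha * g v)%:E) 2 n2.
  set N := Lnorm _ _ _ => NE.
  have N0 : (0 <= N)%E := Lnorm_ge0 _ _ _.
  have Nk : (N `^ 2 <= (k ^+ 2)%:E)%E.
    have Nf : N \is a fin_num by rewrite ge0_fin_numE// (le_lt_trans gk)// ltry.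
    have {}gk : (N <= k%:E)%E := gk; clearbody N.
    rewrite -(fineK Nf) !lee_fin in gk N0 *.
    by rewrite (powR_mulrn 2) // ler_sqr ?nnegrE// ltW.
  apply: le_trans Nk; rewrite NE le_eqVlt; apply/orP; left; apply/eqP.
  apply: eq_integral => v _; rewrite /=; congr EFin.
  by rewrite (powR_mulrn 2)// real_normK ?num_real.
pose c := 8 * (2 `^ (2 * alpha) / (1 - 2 `^ (3 - 2 * alpha))).
have a3 : 3 < 2 * alpha by lra.
have Jc := @japv_integrable R (2 * alpha) a3; rewrite -/c in Jc.
have k1 : k != 0 by rewrite gt_eqF.
(* With p the weight, the right side minus |g| is the square of p |g| - k / p, divided by 2k. *)
apply: (@le_trans _ _ (\int[leb3]_v ((k^-1 / 2)%:E * ((japv v `^ alpha * g v) ^+ 2)%:E +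
    (k / 2)%:E * (japv v `^ (- (2 * alpha)))%:E))%E).
  apply: ge0_le_integralT => v; first exact: abs_fun_ge0.
  rewrite /abs_fun -!EFinM -EFinD lee_fin.
  have j1 : 1 <= japv v := japr_ge1 (norm3 v).
  have j0 : 0 < japv v `^ alpha by rewrite powR_gt0// (lt_le_trans _ j1).
  set p := japv v `^ alpha in j0 *.
  have -> : japv v `^ (- (2 * alpha)) = p^-1 ^+ 2.
    rewrite -powRN /p -[RHS](powR_mulrn 2) ?powR_ge0// -powRrM; congr powR; ring.
  have p0 : p != 0 by rewrite gt_eqF.
  rewrite -subr_ge0.
  have -> : k^-1 / 2 * (p * g v) ^+ 2 + k / 2 * p^-1 ^+ 2 - `|g v| =
     (2 * k)^-1 * (p * `|g v| - k / p) ^+ 2.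
    rewrite !exprMn -[g v ^+ 2](real_normK (num_real _)).
    by field; rewrite p0 k1.
  by rewrite mulr_ge0 ?sqr_ge0// invr_ge0 mulr_ge0// ltW.
have kk : 0 <= k^-1 / 2 by rewrite divr_ge0 ?invr_ge0// ltW.
have kh : 0 <= k / 2 by rewrite divr_ge0// ltW.
have m1 : measurable_fun setT (fun v => ((japv v `^ alpha * g v) ^+ 2)%:E) by meas.
have m2 : measurable_fun setT (fun v : V => (japv v `^ (- (2 * alpha)))%:E) by meas.
rewrite ge0_integralD//; last 4 first.
- by move=> v _; rewrite mule_ge0 ?lee_fin ?sqr_ge0.
- by apply: mfunMe => //; exact: measurable_cst.
- by move=> v _; rewrite mule_ge0 ?lee_fin ?powR_ge0.
- by apply: mfunMe => //; exact: measurable_cst.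
rewrite intZl//; last by move=> v; rewrite lee_fin sqr_ge0.
rewrite intZl//; last by move=> v; rewrite lee_fin powR_ge0.
apply: (@le_trans _ _ ((k^-1 / 2)%:E * (k ^+ 2)%:E + (k / 2)%:E * c%:E)%E).
  by apply: leeD; apply: lee_wpmul2l.
rewrite -!EFinM -EFinD lee_fin /moment_const -/c le_eqVlt; apply/orP; left; apply/eqP.
by field.
Qed.

Lemma controlled_ae M alpha K k f : 8 < M -> 5 / 2 < alpha -> 0 < k ->
  measurable_fun setT f -> (wLinf_norm M f <= K%:E)%E ->
  (Lxv +oo 2%:E (fun z => japv z.2 `^ alpha * f z)%R <= k%:E)%E ->
  {ae @leb3 R, forall x,
    controlled (moment_const alpha * k) K (abs_fun (fun v => f (x, v)))}.
Proof.
move=> M8 a52 k0 mf fK /Lnorm_infty_le fk.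
apply: (@ae_and _ _ _ (@leb3 R) _ _ _ _ (wLinf_ae M8 fK) fk) => x xK.
rewrite gee0_abs ?Lnorm_ge0//= => xk.
have mfx : measurable_fun setT (fun v => f (x, v)) by meas.
split=> //.
- exact: measurable_abs_fun.
- by move=> v; exact: abs_fun_ge0.
- exact: L1_le_weighted_L2 xk.
Qed.

End MixedNorms.

(** * Duhamel's formula in $L^1$ *)

Section TransportL1.
Context (R : realType).
Notation V := (vec3 R).
Notation leb := (@lebesgue_measure R).
Implicit Types (f g : phase R -> R).
Local Open Scope ereal_scope.

Lemma leb6E (h : phase R -> \bar R) : measurable_fun setT h -> (forall z, 0 <= h z) ->
  \int[leb6]_z h z = \int[leb3]_x \int[leb3]_v h (x, v).
Proof. by move=> mh h0; exact: (@fubini_tonelli1 _ _ _ _ _ (@leb3 R) (@leb3 R) h). Qed.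

(** At fixed v, free transport is a translation in x. *)
Lemma leb6_transport t (h : phase R -> \bar R) : measurable_fun setT h ->
  (forall z, 0 <= h z) ->
  \int[leb6]_z h (z.1 - t *: z.2 : V, z.2)%R = \int[leb6]_z h z.
Proof.
move=> mh h0; pose k x v := h (x - t *: v : V, v)%R.
have mk : measurable_fun setT (fun p : phase R => k p.1 p.2) by rewrite /k; meas.
have mhc : measurable_fun setT (fun p : phase R => h (p.1, p.2)) by meas.
transitivity (\int[leb3]_x \int[leb3]_v k x v).
  by apply: (leb6E mk) => z; rewrite /k.
transitivity (\int[leb3]_v \int[leb3]_x k x v); first by apply: tonelli => // x v; exact: h0.
transitivity (\int[leb3]_v \int[leb3]_x h (x, v)); last first.
  rewrite (leb6E mh h0); apply: esym.
  by apply: (tonelli _ _ mhc).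
apply: eq_integral => v _.
rewrite -[RHS](@leb3_shift _ (- (t *: v))%R (fun x => h (x, v)))//; last by meas.
by apply: eq_integral => x _; rewrite addrC.
Qed.

Lemma L1norm_leb6 f : measurable_fun setT f -> L1norm f = \int[leb6]_z `|f z|%:E.
Proof.
by move=> mf; rewrite L1normE// leb6E//; meas.
Qed.

Lemma measurable_transport t f : measurable_fun setT f ->
  measurable_fun setT (transport t f).
Proof. by move=> mf; rewrite /transport; meas. Qed.

Lemma L1norm_transport t f : measurable_fun setT f ->
  L1norm (transport t f) = L1norm f.
Proof.
move=> mf; rewrite !L1norm_leb6//; last exact: measurable_transport.
apply: (@leb6_transport t (fun z => `|f z|%:E)); first by meas.
by move=> z; rewrite lee_fin.
Qed.

Lemma L1norm_ge0 f : 0 <= L1norm f.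
Proof. exact: Lnorm_ge0. Qed.

Lemma L1norm_ae0 f : measurable_fun setT f -> L1norm f = 0 ->
  {ae leb6, forall z, f z = 0%R}.
Proof.
move=> mf; rewrite L1norm_leb6// => f0.
have mF : measurable_fun setT (EFin \o f) by exact: mfun_EFin.
have /(ae_eq_integral_abs (@leb6 R) measurableT mF) := f0.
by apply: (@ae_sub _ _ _ (@leb6 R)) => z /(_ Logic.I) [].
Qed.

Lemma L1normD f g : measurable_fun setT f -> measurable_fun setT g ->
  L1norm (f \+ g)%R <= L1norm f + L1norm g.
Proof.
move=> mf mg; have mfg : measurable_fun setT (f \+ g)%R by exact: mfunD.
rewrite !L1norm_leb6// -ge0_integralD//; [|by meas..].
apply: ge0_le_integralT => z; first by rewrite lee_fin.
by rewrite -EFinD lee_fin ler_normD.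
Qed.

Lemma L1normN f : L1norm (\- f)%R = L1norm f.
Proof.
rewrite /L1norm /Lxv !Lnorm1; apply: eq_integral => x _; congr `|_|.
by rewrite !Lnorm1; apply: eq_integral => v _; rewrite /= normrN.
Qed.

End TransportL1.

Lemma mfun_swap d1 d2 d3 (T1 : measurableType d1) (T2 : measurableType d2)
    (T3 : measurableType d3) (h : T1 -> T2 -> T3) :
  measurable_fun setT (fun q : T1 * T2 => h q.1 q.2) ->
  measurable_fun setT (fun q : T2 * T1 => h q.2 q.1).
Proof.
move=> mh; have ms : measurable_fun setT (fun q : T2 * T1 => (q.2, q.1)).
  by apply: mfun_pair; [exact: measurable_snd|exact: measurable_fst].
exact: (measurableT_comp mh ms).
Qed.

Lemma normr_EFin_ge0 (R : realType) (x : R) : (0 <= `|x|%:E)%E.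
Proof. by rewrite lee_fin. Qed.

(** * Bounds on the collision operator in L^1 *)

Section CollisionL1.
Context (R : realType).
Notation V := (vec3 R).
Notation leb := (@lebesgue_measure R).
Implicit Types (f g : phase R -> R) (M alpha K k : R).

(** Read at a fixed time: for a small solution, [K] is A eps and [k] carries the additional decay in
    time. *)
Definition decays M alpha K k f := [/\ measurable_fun setT f,
  (wLinf_norm M f <= K%:E)%E &
  (Lxv +oo 2%:E (fun z => japv z.2 `^ alpha * f z)%R <= k%:E)%E].

Lemma moment_const_ge0 alpha : 5 / 2 < alpha -> 0 <= moment_const alpha.
Proof.
move=> a52; have a3 : 3 < 2 * alpha by lra.
have := @japv_integrable R (2 * alpha) a3; rewrite /moment_const.
set c := 8 * _ => Jc; suff : 0 <= c by lra.
by rewrite -lee_fin; apply: le_trans Jc; apply: integral_ge0 => v _; rewrite lee_fin powR_ge0.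
Qed.

Lemma measurable_coll1 f : measurable_fun setT f -> measurable_fun setT (coll f).
Proof.
move=> mf; have mu : measurable_fun setT (fun q : measurableTypeR R * phase R => f q.2).
  by meas.
have mc := @measurable_coll _ _ _ (fun _ : measurableTypeR R => f) mu.
have mp : measurable_fun setT (fun z : phase R => ((0 : measurableTypeR R), z)).
  by apply: mfun_pair; [exact: measurable_cst|exact: measurable_id].
exact: (measurableT_comp mc mp).
Qed.

(** The bounds in v hold for almost every x and are integrated in x. The first makes the time
    integrals of Duhamel's formula converge almost everywhere; the second is the Lipschitz estimate.
    [C] is chosen before all other parameters. *)
Lemma coll_L1_bounds : exists2 C : R, 0 <= C &
  forall M alpha K k f g, 8 < M -> 5 / 2 < alpha -> 0 <= K -> 0 < k ->
  decays M alpha K k f -> decays M alpha K k g ->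
  (\int[leb6]_z `|coll f z|%:E <= (C * K * (moment_const alpha * k))%:E * L1norm f /\
   \int[leb6]_z `|coll f z - coll g z|%:E <=
     (C * K * (moment_const alpha * k))%:E * L1norm (f \- g)%R)%E.
Proof.
have [C C0 H] := coll_v_bounds R; exists C => // M alpha K k f g M8 a52 K0 k0.
move=> [mf fK fk] [mg gK gk].
set L := moment_const alpha * k.
have L0 : 0 <= L by rewrite mulr_ge0 ?moment_const_ge0// ltW.
have c0 : 0 <= C * K * L by exact: mulr_ge0 (mulr_ge0 C0 K0) L0.
have cf := controlled_ae M8 a52 k0 mf fK fk.
have cg := controlled_ae M8 a52 k0 mg gK gk.
have mfx x : measurable_fun setT (fun v => f (x, v)) by meas.
have mgx x : measurable_fun setT (fun v => g (x, v)) by meas.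
have mcf := measurable_coll1 mf; have mcg := measurable_coll1 mg.
have norm0 (h : phase R -> R) z : (0 <= `|h z|%:E)%E by rewrite lee_fin.
have mnorm (h : phase R -> R) : measurable_fun setT h ->
    measurable_fun setT (fun z => `|h z|%:E).
  by move=> mh; meas.
have mnormi (h : phase R -> R) : measurable_fun setT h ->
    measurable_fun setT (fun x => \int[leb3]_v `|h (x, v)|%:E)%E.
  by move=> mh; meas => // *; exact: norm0.
have key (h k' : phase R -> R) : measurable_fun setT h -> measurable_fun setT k' ->
    {ae @leb3 R, forall x, (\int[leb3]_v `|h (x, v)|%:E <=
      (C * K * L)%:E * \int[leb3]_v `|k' (x, v)|%:E)%E} ->
    (\int[leb6]_z `|h z|%:E <= (C * K * L)%:E * L1norm k')%E.
  move=> mh mk hk; rewrite (leb6E (mnorm _ mh) (norm0 h)) (L1normE mk).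
  rewrite -(intZl _ (mnormi _ mk)) ?lee_fin//; last first.
    by move=> x; apply: integral_ge0 => v _; exact: norm0.
  apply: ae_ge0_le_integral => //.
  - by move=> x _; apply: integral_ge0 => v _; exact: norm0.
  - exact: mnormi.
  - by move=> x _; rewrite mule_ge0 ?lee_fin//; apply: integral_ge0 => v _; exact: norm0.
  - by apply: mfunMe; [exact: measurable_cst|exact: mnormi].
  - by apply: (@ae_sub _ _ _ (@leb3 R)) hk => x hx _.
split; apply: key => //.
- apply: (@ae_sub _ _ _ (@leb3 R)) cf => x cfx.
  have [+ _] := H L K _ _ L0 K0 (mfx x) (mfx x) cfx cfx.
  by congr (_ <= _)%E; apply: eq_integral => v _; rewrite collE.
- exact: (mfunB mcf mcg).
- exact: (mfunB mf mg).
- apply: (@ae_and _ _ _ (@leb3 R) _ _ _ _ cf cg) => x cfx cgx.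
  have [_] := H L K _ _ L0 K0 (mfx x) (mgx x) cfx cgx.
  by congr (_ <= _)%E; apply: eq_integral => v _; rewrite /= !collE.
Qed.

End CollisionL1.

Section Duhamel.
Context (R : realType).
Notation V := (vec3 R).
Notation leb := (@lebesgue_measure R).
Implicit Types (f g : phase R -> R) (u w : R -> phase R -> R).

(** The bound is enlarged to all times, so that positive and negative [T] are treated alike. *)
Lemma oint0_normB (T : R) (k l : measurableTypeR R -> R) :
  measurable_fun setT k -> measurable_fun setT l ->
  (\int[leb]_s `|k s|%:E < +oo)%E -> (\int[leb]_s `|l s|%:E < +oo)%E ->
  (`|oint0 T k - oint0 T l|%:E <= \int[leb]_s `|k s - l s|%:E)%E.
Proof.
move=> mk ml ki li.
have sub (D : set (measurableTypeR R)) (h : measurableTypeR R -> R) : measurable D ->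
    measurable_fun setT h -> (\int[leb]_(s in D) `|h s|%:E <= \int[leb]_s `|h s|%:E)%E.
  move=> mD mh; apply: ge0_subset_integral => //; by meas.
have bound (D : set (measurableTypeR R)) : measurable D ->
    (`|\int[leb]_(s in D) k s - \int[leb]_(s in D) l s|%:E <=
       \int[leb]_s `|k s - l s|%:E)%E.
  move=> mD; apply: le_trans (sub D _ mD (mfunB mk ml)).
  apply: normr_RintB_le => //; apply: le_lt_trans (sub D _ mD _) _ => //.
rewrite /oint0; case: ifP => _; first by apply: bound; exact: measurable_itv.
by rewrite -opprD normrN; apply: bound; exact: measurable_itv.
Qed.

Definition jointly_measurable u :=
  measurable_fun [set: measurableTypeR R * phase R] (fun q => u q.1 q.2).

Lemma measurable_duhamel T u : jointly_measurable u ->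
  measurable_fun [set: measurableTypeR R * phase R]
    (fun q => transport (T - q.1) (coll (u q.1)) q.2).
Proof.
move=> mu; have mc := measurable_coll mu; rewrite /transport.
apply: (measurableT_comp mc (g := fun q : measurableTypeR R * phase R =>
  (q.1, (q.2.1 - (T - q.1) *: q.2.2 : V, q.2.2)))).
by meas.
Qed.

Lemma jointly_measurable_at u t : jointly_measurable u -> measurable_fun setT (u t).
Proof.
move=> mu; apply: (measurableT_comp mu (g := fun z : phase R => (t : measurableTypeR R, z))).
by apply: measurable_fun_pair => //; exact: measurable_cst.
Qed.

(** Transport preserves the measure of phase space, so by Tonelli's theorem the integral over z of
    the time integral is the assumed finite quantity. *)
Lemma duhamel_ae_integrable T u : jointly_measurable u ->
  (\int[leb]_s \int[leb6]_z `|coll (u s) z|%:E < +oo)%E ->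
  {ae @leb6 R, forall z,
    (\int[leb]_s `|transport (T - s) (coll (u s)) z|%:E < +oo)%E}.
Proof.
move=> mu fin; have md := measurable_duhamel T mu.
have m1 : measurable_fun setT (fun q : phase R * measurableTypeR R =>
    `|transport (T - q.2) (coll (u q.2)) q.1|%:E).
  exact: (mfun_swap (h := fun (s : measurableTypeR R) (z : phase R) =>
      `|transport (T - s) (coll (u s)) z|%:E)
    (mfun_EFin (mfun_norm md))).
pose h z := (\int[leb]_s `|transport (T - s) (coll (u s)) z|%:E)%E.
have h0 z : (0 <= h z)%E by apply: integral_ge0 => s _; rewrite lee_fin.
have mh : measurable_fun setT h.
  exact: (mfun_int leb (h := fun (z : phase R) (s : measurableTypeR R) =>
    `|transport (T - s) (coll (u s)) z|%:E) m1 (fun z s => normr_EFin_ge0 _)).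
have hfin : (\int[leb6]_z h z < +oo)%E.
  apply: le_lt_trans fin; rewrite le_eqVlt; apply/orP; left; apply/eqP.
  transitivity (\int[leb]_s \int[leb6]_z `|transport (T - s) (coll (u s)) z|%:E)%E.
    exact: (tonelli _ _ (h := fun (z : phase R) (s : measurableTypeR R) =>
      `|transport (T - s) (coll (u s)) z|%:E) m1 (fun z s => normr_EFin_ge0 _)).
  apply: eq_integral => s _.
  have mc : measurable_fun setT (coll (u s)).
    by apply: measurable_coll1; exact: jointly_measurable_at.
  by apply: (@leb6_transport _ _ (fun z => `|coll (u s) z|%:E)) => //; meas.
have hi : (@leb6 R).-integrable setT h.
  apply/integrableP; split => //.
  by rewrite (eq_integral h)// => z _; rewrite gee0_abs.
have := integrable_ae measurableT hi.
by apply: (@ae_sub _ _ _ (@leb6 R)) => z /(_ Logic.I); rewrite ge0_fin_numE.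
Qed.

Lemma duhamel_L1 T (f0 g0 : phase R -> R) u w : measurable_fun setT f0 -> measurable_fun setT g0 ->
  jointly_measurable u -> jointly_measurable w ->
  {ae @leb6 R, forall z, u T z = transport T f0 z +
     oint0 T (fun s => transport (T - s) (coll (u s)) z)} ->
  {ae @leb6 R, forall z, w T z = transport T g0 z +
     oint0 T (fun s => transport (T - s) (coll (w s)) z)} ->
  (\int[leb]_s \int[leb6]_z `|coll (u s) z|%:E < +oo)%E ->
  (\int[leb]_s \int[leb6]_z `|coll (w s) z|%:E < +oo)%E ->
  (L1norm (f0 \- g0)%R <= L1norm (u T \- w T)%R +
     \int[leb]_s \int[leb6]_z `|coll (u s) z - coll (w s) z|%:E)%E.
Proof.
move=> mf0 mg0 mu mw du dw ui wi.
pose k s z := transport (T - s) (coll (u s)) z - transport (T - s) (coll (w s)) z.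
have mk : measurable_fun [set: measurableTypeR R * phase R] (fun q => k q.1 q.2).
  by apply: mfunB; exact: measurable_duhamel.
have mk' : measurable_fun setT (fun q : phase R * measurableTypeR R => `|k q.2 q.1|%:E).
  exact: (mfun_swap (h := fun (s : measurableTypeR R) (z : phase R) => `|k s z|%:E) (mfun_EFin (mfun_norm mk))).
have mfg : measurable_fun setT (f0 \- g0) by exact: mfunB.
have muw : measurable_fun setT (u T \- w T).
  by apply: mfunB; exact: jointly_measurable_at.
rewrite -(L1norm_transport T mfg) L1norm_leb6; last exact: measurable_transport.
rewrite [in leRHS]L1norm_leb6//.
have -> : (\int[leb]_s \int[leb6]_z `|coll (u s) z - coll (w s) z|%:E =
    \int[leb6]_z \int[leb]_s `|k s z|%:E)%E.
  transitivity (\int[leb]_s \int[leb6]_z `|k s z|%:E)%E; last first.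
    exact: esym (tonelli _ _ (h := fun (z : phase R) (s : measurableTypeR R) =>
      `|k s z|%:E) mk' (fun z s => normr_EFin_ge0 _)).
  apply: eq_integral => s _; apply: esym.
  have mcu : measurable_fun setT (coll (u s)).
    by apply: measurable_coll1; exact: jointly_measurable_at.
  have mcw : measurable_fun setT (coll (w s)).
    by apply: measurable_coll1; exact: jointly_measurable_at.
  by apply: (@leb6_transport _ _ (fun z => `|coll (u s) z - coll (w s) z|%:E)) => //; meas.
have mI : measurable_fun setT (fun z => \int[leb]_s `|k s z|%:E)%E.
  exact: (mfun_int leb (h := fun (z : phase R) (s : measurableTypeR R) =>
    `|k s z|%:E) mk' (fun z s => normr_EFin_ge0 _)).
have I0 z : (0 <= \int[leb]_s `|k s z|%:E)%E.
  by apply: integral_ge0 => s _; rewrite lee_fin.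
rewrite -ge0_integralD//; [|by meas].
have mt : measurable_fun setT (transport T (f0 \- g0)) by exact: measurable_transport.
apply: ae_ge0_le_integral => //.
- by meas.
- by move=> z _; rewrite adde_ge0 ?lee_fin.
- by apply: mfunDe => //; meas.
have iu := duhamel_ae_integrable T mu ui; have iw := duhamel_ae_integrable T mw wi.
(* Off one null set, Duhamel's formula holds for both solutions and both time integrals converge. *)
have dd := @ae_and _ _ _ (@leb6 R) _ _ _ (fun z a b => conj a b) du dw.
have ii := @ae_and _ _ _ (@leb6 R) _ _ _ (fun z a b => conj a b) iu iw.
apply: (@ae_and _ _ _ (@leb6 R) _ _ _ _ dd ii) => z [uz wz] [iuz iwz] _.
have ms v : jointly_measurable v -> measurable_fun [set: measurableTypeR R]
    (fun s => transport (T - s) (coll (v s)) z).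
  move=> mv; apply: (measurableT_comp (measurable_duhamel T mv)
    (g := fun s : measurableTypeR R => (s, z))).
  by apply: measurable_fun_pair => //; exact: measurable_cst.
have := oint0_normB T (ms u mu) (ms w mw) iuz iwz.
set a := oint0 _ _; set b := oint0 _ _ => ab.
have -> : transport T (f0 \- g0) z = transport T f0 z - transport T g0 z by [].
set x := transport T f0 z; set y := transport T g0 z.
have -> : (u T \- w T) z = x + a - (y + b) by rewrite /= uz wz.
apply: (@le_trans _ _ (`|x + a - (y + b)|%:E + `|a - b|%:E)%E); last by rewrite leeD2l.
rewrite -EFinD lee_fin (_ : x - y = (x + a - (y + b)) - (a - b)); last by ring.
exact: ler_normB.
Qed.

End Duhamel.

(** * Small solutions *)

Section SmallSolutions.
Context (R : realType).
Notation V := (vec3 R).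
Notation leb := (@lebesgue_measure R).
Implicit Types (f g F G : phase R -> R) (u w : R -> phase R -> R) (M alpha K A eps : R).

Lemma small_solution_bounds M alpha A eps f u : small_solution M alpha A eps f u ->
  forall t, decays M alpha (A * eps) (A * eps * japr t `^ (- (3 / 2))) (u t) /\
            (L1norm (u t) <= (A * eps)%:E)%E.
Proof.
move=> [[mu uM _ _] uA] t; set K := A * eps in uA *.
have j0 : 0 < japr t `^ (3 / 2) by rewrite powR_gt0// japr_gt0.
have ut : ((japr t `^ (3 / 2))%:E * Lxv 2%:E 1 (fun z => (japv z.2 * u t z)%R) +
    (japr t `^ (3 / 2))%:E * Lxv +oo 2%:E (fun z => (japv z.2 `^ alpha * u t z)%R) +
    L1norm (u t) + wLinf_norm M (u t) <= K%:E)%E.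
  by apply: le_trans (ltW uA); apply: ereal_sup_ubound; exists t.
move: ut; set a := Lxv 2%:E 1 _; set b := Lxv +oo 2%:E _; set c := L1norm _;
  set d := wLinf_norm _ _.
have ja : (0 <= (japr t `^ (3 / 2))%:E * a)%E by rewrite mule_ge0 ?Lnorm_ge0 ?lee_fin ?ltW.
have jb : (0 <= (japr t `^ (3 / 2))%:E * b)%E by rewrite mule_ge0 ?Lnorm_ge0 ?lee_fin ?ltW.
have c0 : (0 <= c)%E by exact: Lnorm_ge0.
have d0 : (0 <= d)%E by exact: Lnorm_ge0.
move=> H; split; [split|].
- by have [] := uM t.
- by apply: le_trans H; rewrite leeDr// !adde_ge0.
- rewrite -/b powRN mulrC EFinM lee_pdivlMl//.
  apply: le_trans H; apply: (le_trans _ (leeDl _ d0)); apply: (le_trans _ (leeDl _ c0)).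
  by rewrite leeDr.
- apply: le_trans H; apply: (le_trans _ (leeDl _ d0)).
  by rewrite leeDr// adde_ge0.
Qed.

Definition time_const : R := 2 * (2 `^ (3 / 2) / (1 - 2 `^ (1 - 3 / 2))).

Lemma japr_time_integral : (\int[leb]_s (japr s `^ (- (3 / 2)))%:E <= time_const%:E)%E.
Proof. by apply: leb_japr; lra. Qed.

Lemma time_const_ge0 : 0 <= time_const.
Proof.
rewrite -lee_fin; apply: le_trans japr_time_integral.
by apply: integral_ge0 => s _; rewrite lee_fin powR_ge0.
Qed.

Lemma time_integral_le (c : R) (x : \bar R) (h : R -> \bar R) : 0 <= c -> (0 <= x)%E ->
  (forall s, 0 <= h s)%E -> (forall s, h s <= (c * japr s `^ (- (3 / 2)))%:E * x)%E ->
  (\int[leb]_s h s <= (c * time_const)%:E * x)%E.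
Proof.
move=> c0 x0 h0 hc.
have j0 s : (0 <= (japr s `^ (- (3 / 2)))%:E)%E by rewrite lee_fin powR_ge0.
have mj : measurable_fun setT (fun s : measurableTypeR R => (japr s `^ (- (3 / 2)))%:E).
  by apply: mfun_EFin; apply: mfun_powR; rewrite /japr; meas.
apply: (@le_trans _ _ (\int[leb]_s (c%:E * (japr s `^ (- (3 / 2)))%:E * x))%E).
  by apply: ge0_le_integralT => // s; rewrite -EFinM.
have cE : (0 <= c%:E)%E by rewrite lee_fin.
rewrite (intZr _ (mfunMe (measurable_cst _) mj))//; last by move=> s; rewrite mule_ge0.
by rewrite (intZl _ mj)// EFinM lee_wpmul2r// lee_wpmul2l// japr_time_integral.
Qed.

(** [B] depends on M and alpha only; A and eps enter through the square of A eps, one factor from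
    the weighted sup norm and one from the decaying norm. *)
Lemma data_stability M alpha : 8 < M -> 5 / 2 < alpha ->
  exists2 B : R, 0 <= B & forall A eps f g u w, 0 < A * eps ->
    measurable_fun setT f -> measurable_fun setT g ->
    small_solution M alpha A eps f u -> small_solution M alpha A eps g w ->
    (forall t, L1norm (u t \- w t)%R <= 2%:E * L1norm (f \- g)%R)%E ->
    forall T, (L1norm (f \- g)%R <=
      L1norm (u T \- w T)%R + (B * (A * eps) ^+ 2)%:E * L1norm (f \- g)%R)%E.
Proof.
move=> M8 a52; have [C C0 HC] := coll_L1_bounds R.
have mc0 := moment_const_ge0 a52; have J0 := time_const_ge0.
(* Factors: the Lipschitz constant of the collision operator, the passage from weighted L^2 to L^1
   in v, the integral of the decay in time, and the 2 of the L^1 stability. *)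
exists (C * moment_const alpha * time_const * 2).
  exact: mulr_ge0 (mulr_ge0 (mulr_ge0 C0 mc0) J0) (ler0n _ _).
move=> A eps f g u w K0 mf mg su sw uw T.
have bu := small_solution_bounds su; have bw := small_solution_bounds sw.
have [[mu _ _ du] _] := su; have [[mw _ _ dw] _] := sw.
set K := A * eps in K0 bu bw *; pose c := C * K * (moment_const alpha * K).
have c0 : 0 <= c by exact: mulr_ge0 (mulr_ge0 C0 (ltW K0)) (mulr_ge0 mc0 (ltW K0)).
have cs s : C * K * (moment_const alpha * (K * japr s `^ (- (3 / 2)))) =
    c * japr s `^ (- (3 / 2)) by rewrite /c; ring.
have k0 s : 0 < K * japr s `^ (- (3 / 2)) by rewrite mulr_gt0// powR_gt0// japr_gt0.
have cj0 s : (0 <= (c * japr s `^ (- (3 / 2)))%:E)%E by rewrite lee_fin mulr_ge0 ?powR_ge0.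
have int0 (h : R -> phase R -> R) s : (0 <= \int[leb6]_z `|h s z|%:E)%E.
  by apply: integral_ge0 => z _; exact: normr_EFin_ge0.
have KE : (0 <= K%:E)%E by rewrite lee_fin ltW.
have finite (v : R -> phase R -> R) : (forall t,
    decays M alpha K (K * japr t `^ (- (3 / 2))) (v t) /\ (L1norm (v t) <= K%:E)%E) ->
    (\int[leb]_s \int[leb6]_z `|coll (v s) z|%:E < +oo)%E.
  move=> bv; apply: (@le_lt_trans _ _ ((c * time_const)%:E * K%:E)%E); last first.
    by rewrite -EFinM ltry.
  apply: time_integral_le => // [s|s]; first exact: (int0 (fun s => coll (v s))).
  have [dv vK] := bv s; have [+ _] := HC M alpha _ _ _ _ M8 a52 (ltW K0) (k0 s) dv dv.
  by rewrite cs => /le_trans; apply; rewrite lee_wpmul2l.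
apply: (le_trans (duhamel_L1 (T := T) mf mg mu mw (du T) (dw T) (finite u bu) (finite w bw))).
apply: leeD2l.
have N0 : (0 <= 2%:E * L1norm (f \- g)%R)%E by rewrite mule_ge0 ?L1norm_ge0 ?lee_fin.
apply: (@le_trans _ _ ((c * time_const)%:E * (2%:E * L1norm (f \- g)%R))%E); last first.
  rewrite muleA -EFinM le_eqVlt; apply/orP; left; apply/eqP; congr (_%:E * _)%E.
  by rewrite /c; ring.
apply: time_integral_le => // [s|s].
  exact: (int0 (fun s z => coll (u s) z - coll (w s) z)).
have [du' _] := bu s; have [dw' _] := bw s.
have [_] := HC M alpha _ _ _ _ M8 a52 (ltW K0) (k0 s) du' dw'.
by rewrite cs => /le_trans; apply; rewrite lee_wpmul2l.
Qed.

(** Triangle inequality through the transports of [F] and [G], whose L^1 distance is zero. Being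
    proper, the filter contains a time at which both solutions are within e/2 of their
    transports. *)
Lemma scatters_L1_close M (T : set_system R) u w F G (e : R) : ProperFilter T ->
  (forall t, measurable_fun setT (u t)) -> (forall t, measurable_fun setT (w t)) ->
  scatters_to M T u F -> scatters_to M T w G -> F = G %[ae leb6] -> 0 < e ->
  exists t, (L1norm (u t \- w t)%R <= e%:E)%E.
Proof.
move=> PT mu mw [[mF _] _ uF] [[mG _] _ wG] FG e0.
have e2 : 0 < e / 2 by rewrite divr_gt0.
have near0 : nbhs (0%:E : \bar R) [set y | (y < (e / 2)%:E)%E].
  exact: (@nbhs_open_ereal_lt R 0 (fun=> e / 2) e2).
have nu : T [set t | (wLinf_norm M (u t \- transport t F)%R +
  L1norm (u t \- transport t F)%R < (e / 2)%:E)%E] := uF _ near0.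
have nw : T [set t | (wLinf_norm M (w t \- transport t G)%R +
  L1norm (w t \- transport t G)%R < (e / 2)%:E)%E] := wG _ near0.
have [t [/= ut wt]] := filter_ex (filterI nu nw).
exists t; set SF := transport t F in ut; set SG := transport t G in wt.
have mSF : measurable_fun setT SF by exact: measurable_transport.
have mSG : measurable_fun setT SG by exact: measurable_transport.
have mFG : measurable_fun setT (F \- G) by exact: mfunB.
have half (f : phase R -> R) : (wLinf_norm M f + L1norm f < (e / 2)%:E)%E ->
    (L1norm f <= (e / 2)%:E)%E.
  by move=> /ltW; apply: le_trans; rewrite leeDr// Lnorm_ge0.
have FG0 : L1norm (SF \- SG) = 0%E.
  transitivity (L1norm (F \- G)); first exact: L1norm_transport.
  rewrite L1norm_leb6// -[RHS](integral0 (@leb6 R) setT).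
  apply: ae_eq_integral => //; [by meas|].
  by apply: (@ae_sub _ _ _ (@leb6 R)) FG => z /(_ Logic.I) /= -> _; rewrite subrr normr0.
have -> : u t \- w t = ((u t \- SF) \+ (\- (w t \- SG))) \+ (SF \- SG).
  by apply/funext => z /=; ring.
have m1 : measurable_fun setT (u t \- SF) by exact: mfunB.
have m2 : measurable_fun setT (\- (w t \- SG)) by apply: mfunN; exact: mfunB.
apply: (le_trans (L1normD (mfunD m1 m2) (mfunB mSF mSG))); rewrite FG0 adde0.
apply: (le_trans (L1normD m1 m2)); rewrite L1normN.
by rewrite [e]splitr EFinD leeD// half.
Qed.

(** Finiteness of [N] allows q N to be absorbed into the left side; then N <= e for every e > 0. *)
Lemma le_small_perturbation (N : \bar R) (q : R) : (0 <= N)%E -> (N < +oo)%E -> q <= 1 / 2 ->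
  (forall e : R, 0 < e -> (N <= e%:E + q%:E * N)%E) -> N = 0%E.
Proof.
move=> N0 Nf q2 H; have Nn : N \is a fin_num by rewrite ge0_fin_numE.
rewrite -(fineK Nn) in N0 H *; rewrite lee_fin in N0; set n := fine N in N0 H *.
apply/eqP; rewrite eqe eq_le N0 andbT; apply/ler_addgt0Pr => e e0; rewrite add0r.
have e2 : 0 < e / 2 by rewrite divr_gt0.
have := H _ e2; rewrite -EFinM -EFinD lee_fin => h.
have : q * n <= 1 / 2 * n by rewrite ler_wpM2r.
lra.
Qed.

(** The filter of times is arbitrary, which treats both scattering maps at once. The L^1 distance of
    the data is finite because both lie in L^1, so the perturbation can be absorbed. *)
Lemma small_data_ae_injective M alpha epsbar A : 8 < M -> 5 / 2 < alpha -> 0 < A ->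
  well_posed M alpha epsbar A -> exists2 B : R, 0 <= B & forall eps,
    0 < eps < epsbar -> B * (A * eps) ^+ 2 <= 1 / 2 ->
  forall (T : set_system R) f g u w F G, ProperFilter T ->
    Xball M alpha eps f -> Xball M alpha eps g ->
    small_solution M alpha A eps f u -> small_solution M alpha A eps g w ->
    scatters_to M T u F -> scatters_to M T w G ->
    F = G %[ae leb6] -> f = g %[ae leb6].
Proof.
move=> M8 a52 A0 WP; have [B B0 HB] := data_stability M8 a52.
exists B => // eps /[dup] epsI /andP[eps0 _] Beps T f g u w F G PT Xf Xg su sw uF wG FG.
have [_ L1stab] := WP eps epsI.
have [_ [mf f1] _] := Xf; have [_ [mg g1] _] := Xg.
have uw t : (L1norm (u t \- w t)%R <= 2%:E * L1norm (f \- g)%R)%E.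
  apply: le_trans (L1stab _ _ _ _ Xf Xg su sw).
  by apply: ereal_sup_ubound; exists t.
have [[_ uM _ _] _] := su; have [[_ wM _ _] _] := sw.
have mut t : measurable_fun setT (u t) by have [] := uM t.
have mwt t : measurable_fun setT (w t) by have [] := wM t.
have mfg : measurable_fun setT (f \- g) by exact: mfunB.
have fg0 : L1norm (f \- g)%R = 0%E.
  apply: (@le_small_perturbation _ (B * (A * eps) ^+ 2)) => //.
  - exact: L1norm_ge0.
  - apply: le_lt_trans (L1normD mf (mfunN mg)) _.
    by rewrite (L1normN g) lte_add_pinfty.
  - move=> e e0; have [t te] := scatters_L1_close PT mut mwt uF wG FG e0.
    apply: (le_trans (HB A eps f g u w (mulr_gt0 A0 eps0) mf mg su sw uw t)).
    exact: leeD2r.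
apply: (@ae_sub _ _ _ (@leb6 R)) (L1norm_ae0 mfg fg0) => z /= fgz _.
by apply/eqP; rewrite -subr_eq0 fgz.
Qed.

End SmallSolutions.

Theorem proposition4p4 (R : realType) (M alpha epsbar A : R)
    (hM : 8 < M) (halpha : 5 / 2 < alpha < M - 3 / 2)
    (hepsbar : 0 < epsbar) (hA : 6 < A)
    (hWP : well_posed M alpha epsbar A) :
  exists epsbar3 : R, 0 < epsbar3 < epsbar /\
    forall eps0 : R, 0 < eps0 < epsbar3 ->
      ae_injective (Uplus M alpha A eps0) /\
      ae_injective (Uminus M alpha A eps0).
Proof.
have /andP[a52 _] := halpha; have A0 : 0 < A by lra.
have [B B0 HB] := small_data_ae_injective hM a52 A0 hWP.
pose b := B * A ^+ 2; have b0 : 0 <= b by rewrite mulr_ge0 ?sqr_ge0.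
have b1 : 0 < 2 * b + 1 by lra.
(* Half of [epsbar] keeps the threshold strictly below it. The other bound gives eps0 <= 1 and 2 b
   eps0 <= 1, hence b eps0^2 <= 1/2. *)
exists (Num.min (epsbar / 2) (2 * b + 1)^-1); split.
  by rewrite lt_min divr_gt0// invr_gt0 b1/= gt_min; apply/orP; left; lra.
move=> eps0; rewrite lt_min => /and3P[eps_gt0 eps1 eps2].
have epsI : 0 < eps0 < epsbar by rewrite eps_gt0/=; lra.
have beps : eps0 * (2 * b + 1) < 1 by rewrite -ltr_pdivlMr// div1r.
have Beps : B * (A * eps0) ^+ 2 <= 1 / 2.
  have e1 : eps0 <= 1.
    by apply: ltW; apply: le_lt_trans beps; rewrite ler_peMr ?(ltW eps_gt0)//; lra.
  rewrite (_ : _ * _ = b * eps0 * eps0); last by rewrite /b; ring.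
  have : b * eps0 * eps0 <= b * eps0 by rewrite ler_piMr// mulr_ge0// (ltW eps_gt0).
  lra.
have H := HB eps0 epsI Beps.
split=> f0 g0 F G [Xf [u su uF]] [Xg [w sw wG]] FG.
- exact: (H _ _ _ _ _ _ _ _ Xf Xg su sw uF wG FG).
- exact: (H _ _ _ _ _ _ _ _ Xf Xg su sw uF wG FG).
Qed.
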